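(* As $n\to\infty$, $$\Sigma_n\sim \alpha\,\sqrt{n},\qquad \alpha=\frac{T^2}{\varepsilon^2}\,\vartheta^\star\cdot\frac12\,\sqrt{2\pi\tau},$$ where $f_n\sim g_n$ means $f_n/g_n\to1$ as $n\to\infty$.
   Context: Single-node linear stochastic fluid (shot-noise) model. Fix $\lambda,r,t>0$. Jobs arrive according to a Poisson process of rate $\lambda$ and bring i.i.d. non-negative amounts of work $B_1,B_2,\ldots$, distributed as $B$; the storage level decays exponentially at rate $r$, and the system starts empty. The storage level at time $t$ satisfies $X(t)\stackrel{d}{=}\sum_{j=1}^{N}B_j e^{-rU_j}$, where $N$ is Poisson with mean $\lambda t$, the $U_j$ are i.i.d. uniform on $[0,t]$, and $N$, $(B_j)$, $(U_j)$ are independent. With $\beta(\vartheta)=\mathbb E e^{\vartheta B}$, its moment generating function is $$M(\vartheta)=\mathbb E e^{\vartheta X(t)}=\exp\Big(\lambda\int_0^t(\beta(e^{-ru}\vartheta)-1)\,du\Big),$$ assumed finite in a neighborhood of the origin. Let $m(t)=\mathbb E X(t)=\frac{\lambda}{r}(1-e^{-rt})\mathbb E B$. Scaling: the arrival rate becomes $n\lambda$, $n\in\mathbb N$, so the storage level at time $t$ is $Y_n(t)=\sum_{i=1}^nX_i(t)$ with $X_1(t),\ldots,X_n(t)$ i.i.d. copies of $X(t)$. Fix $a>m(t)$ and put $p_n(a)=\mathbb P(Y_n(t)\ge na)$. Let $\vartheta^\star=\arg\sup_{\vartheta}(\vartheta a-\log M(\vartheta))$. It is assumed that this supremum is attained at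 a point $\vartheta^\star>0$ in the interior of the domain of finiteness of $M$, so that $M'(\vartheta^\star)/M(\vartheta^\star)=a$. Put $\tau=\frac{d^2}{d\vartheta^2}\log M(\vartheta)\big|_{\vartheta=\vartheta^\star}$. Importance sampling: under the measure $\mathbb Q$ (exponential twist by $\vartheta^\star$), the $X_i(t)$ are i.i.d. with moment generating function $M(\vartheta+\vartheta^\star)/M(\vartheta^\star)$. The likelihood ratio is $\mathcal L_n=\frac{d\mathbb P}{d\mathbb Q}=e^{-\vartheta^\star Y_n(t)}e^{n\log M(\vartheta^\star)}$, and $\mathcal I_n$ is the indicator of $\{Y_n(t)\ge na\}$, so $\mathbb E_{\mathbb Q}(\mathcal L_n\mathcal I_n)=p_n(a)$. For a fixed critical value $T>0$ and precision $\varepsilon>0$, the number of runs (in the normal approximation) needed for the ratio of the confidence interval half-width to the estimator to drop to $\varepsilon$ is defined as $$\Sigma_n:=\frac{T^2}{\varepsilon^2}\,\frac{\mathrm{Var}_{\mathbb Q}(\mathcal L_n\mathcal I_n)}{p_n(a)^2}.$$ *)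

(* Defs.v *)
From HB Require Import structures.
From mathcomp Require Import all_boot all_order all_algebra finmap.
From mathcomp Require Import all_classical all_reals all_analysis.

Set Implicit Arguments.
Unset Strict Implicit.
Unset Printing Implicit Defensive.

Import Order.TTheory GRing.Theory Num.Theory.
Import numFieldNormedType.Exports.

Local Open Scope classical_set_scope.
Local Open Scope ring_scope.

Definition sigma_rv d' (T : Type) (T' : measurableType d') (X : T -> T') :
    set_system T :=
  preimage_set_system setT X measurable.

Definition mutually_independent d (T : measurableType d) (R : realType)
    (P : probability T R) (I : choiceType) (F : I -> set_system T) : Prop :=
  forall (J : {fset I}) (E : I -> set T),
    (forall i, i \in J -> F i (E i)) ->
    P (\bigcap_(i in [set` J]) E i) = (\prod_(i <- J) P (E i))%E.

(* Laws are compared on measurable sets only: the value of a measure on the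
   other sets carries no information. *)
Definition same_law d' (T' : measurableType d') (R : realType)
    (mu nu : set T' -> \bar R) : Prop :=
  forall A, measurable A -> mu A = nu A.

(* The sigma-algebras generated by N, by each B_j and by each U_j, as a single
   family, so that one mutual independence statement covers them all. *)
Definition input_sigma d (T : measurableType d) (R : realType)
    (N : T -> nat) (B U : nat -> T -> R) (k : unit + (nat + nat)) :
    set_system T :=
  match k with
  | inl _ => sigma_rv N
  | inr (inl j) => sigma_rv (B j)
  | inr (inr j) => sigma_rv (U j)
  end.

(* poisson_prob has a dummy nat argument, here 0. *)
Record shot_noise_inputs d (T : measurableType d) (R : realType)
    (P : probability T R) (lambda t : R) (t_gt0 : 0 < t)
    (lawB : probability R R) (N : {RV P >-> nat}) (B U : nat -> {RV P >-> R}) :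
    Prop := ShotNoiseInputs {
  sni_N : same_law (distribution P N) (poisson_prob (lambda * t) 0) ;
  sni_B_ge0 : lawB [set x | x < 0] = 0%E ;
  sni_B : forall j, same_law (distribution P (B j)) lawB ;
  sni_U : forall j, same_law (distribution P (U j)) (uniform_prob t_gt0) ;
  sni_indep : mutually_independent P (input_sigma N B U)
}.

Definition shot_noise (T : Type) (R : realType) (r : R)
    (N : T -> nat) (B U : nat -> T -> R) (w : T) : R :=
  \sum_(j < N w) B j w * expR (- (r * U j w)).

Definition total_storage (T : Type) (R : realType) (X : nat -> T -> R) (n : nat)
    (w : T) : R :=
  \sum_(i < n) X i w.

Definition overflow (T : Type) (R : realType) (X : nat -> T -> R) (a : R)
    (n : nat) : set T :=
  [set w | n%:R * a <= total_storage X n w].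

(* log M, as a real function; junk value 0 where M is infinite. *)
Definition logM (R : realType) (M : R -> \bar R) (theta : R) : R :=
  ln (fine (M theta)).

(* theta attains the supremum over the whole real line of
   theta a - log M(theta), which is -oo where M is infinite. *)
Definition is_argsup (R : realType) (M : R -> \bar R) (a theta : R) : Prop :=
  forall v : R,
    ((v * a)%:E - lne (M v) <= (theta * a)%:E - lne (M theta))%E.

Definition likelihood_ratio (T : Type) (R : realType) (M : R -> \bar R)
    (theta : R) (X : nat -> T -> R) (n : nat) (w : T) : R :=
  expR (- (theta * total_storage X n w)) * expR (n%:R * logM M theta).

(* Q is the exponential twist of P by theta, as seen by the first n variables.
   Only the restriction of Q to the sigma-algebra of X_0, ..., X_(n-1) is
   constrained: on the sigma-algebra of the whole sequence, twisting all the
   variables yields a measure that is not equivalent to P. *)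
Record exponential_twist d (T : measurableType d) (R : realType)
    (P Q : probability T R) (M : R -> \bar R) (theta : R)
    (X : nat -> T -> R) (n : nat) : Prop := ExponentialTwist {
  et_indep : mutually_independent Q (fun i : 'I_n => sigma_rv (X i)) ;
  et_ident : forall i j : 'I_n,
    same_law (pushforward Q (X i)) (pushforward Q (X j)) ;
  et_mgf : forall (i : 'I_n) (v : R),
    mmt_gen_fun Q (X i) v = (M (v + theta)%R * ((fine (M theta))^-1)%:E)%E ;
  et_density : forall A : set T,
    g_sigma_preimage (fun i : 'I_n => X i) A ->
    P A = (\int[Q]_(w in A) (likelihood_ratio M theta X n w)%:E)%E
}.

(* Number of runs: Tc is the critical value, eps the precision. *)
Definition number_of_runs d (T : measurableType d) (R : realType)
    (P Q : probability T R) (M : R -> \bar R) (theta : R)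
    (X : nat -> T -> R) (a Tc eps : R) (n : nat) : R :=
  Tc ^+ 2 / eps ^+ 2 *
  (fine (variance Q (fun w =>
     likelihood_ratio M theta X n w * \1_(overflow X a n) w)) /
   fine (P (overflow X a n)) ^+ 2).

(* Main.v *)
(** With S_n = Y_n - n a, both P(Y_n >= n a) and the second moment
    E_Q[(L_n I_n)^2] = E_P[L_n I_n] are, up to explicit powers of a constant,
    expectations of e^{-k S_n} 1_{S_n >= 0} under the exponentially tilted law,
    for k = theta and k = 2 theta.  A local limit theorem, proved by Fourier
    inversion, shows that sqrt n times such an expectation tends to
    1 / (k sqrt(2 pi tau)); the relative second moment is therefore equivalent
    to (theta / 2) sqrt(2 pi tau) sqrt n.  The local limit theorem needs the
    tilted characteristic function phi to satisfy
    1 - |phi(xi)|^2 >= kappa xi^2 / (1 + xi^2); this holds because X(t) has an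
    atom at 0 (no job) and because, given exactly one job of size at least
    b0 > 0, the law of B e^{-rU} is spread out by the uniform arrival time.
    Characteristic functions appear as pairs of cosine and sine integrals. *)
Require Import Defs.
From HB Require Import structures.
From mathcomp Require Import all_boot all_order all_algebra finmap ring lra.
From mathcomp Require Import all_classical all_reals all_analysis.
From mathcomp Require Import measurable_realfun.

Set Implicit Arguments.
Unset Strict Implicit.
Unset Printing Implicit Defensive.

Import Order.TTheory GRing.Theory Num.Theory.
Import numFieldNormedType.Exports.

Local Open Scope classical_set_scope.
Local Open Scope ring_scope.

(** The atom of X(t) at 0 shapes the argument: |phi| does not tend to 0 at infinity and the sums
    have no density, so integrability in xi cannot come from powers of phi. It has to come from the
    test function; but the jump of e^{-kx} 1_{x >= 0} at 0 makes its transform decay only like 1/xi.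
    Inversion is therefore applied to the continuous differences e^{-kx} - e^{-bx} on the half-line,
    whose transforms are O(1 / (1 + xi^2)), and the exponential is squeezed between such a
    difference and a multiple of a slightly shifted one. With xi = eta / sqrt n, the bound on
    |phi|^n times this decay is at most C / (1 + kappa eta^2 / 2), uniformly in n. Dominated
    convergence thus treats all frequencies at once, with no separation of small from large ones.
    The lower bound on 1 - |phi|^2 would fail if B = 0 almost surely; that case is excluded because
    the supremum defining theta would not be attained. *)

Lemma integrable_dominated d (T : measurableType d) (R : realType)
    (m : {measure set T -> \bar R}) (D : set T) (f h : T -> R) (C : R) :
  measurable D -> m.-integrable D (EFin \o f) -> measurable_fun D h ->
  (forall x, D x -> `|h x| <= C * f x) ->
  m.-integrable D (EFin \o h).
Proof.
move=> mD intf mh hf.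
have intCf : m.-integrable D (fun x => (C%:E * (f x)%:E)%E).
  exact: (@integrableZl _ _ _ m _ mD C (EFin \o f)).
apply: le_integrable intCf => //; first exact/measurable_EFinP.
by move=> x Dx /=; rewrite lee_fin (le_trans (hf x Dx))// ler_norm.
Qed.

(** * Fourier inversion *)

Section calculus.
Context {R : realType}.
Notation mu := (@lebesgue_measure R).
Implicit Types (f F : R -> R) (a l s x xi : R).

Lemma ge0_FTC_itvy f F a l : (forall x, is_derive x 1 F (f x)) ->
  continuous f -> (forall x, a <= x -> 0 <= f x) ->
  F x @[x --> +oo] --> l ->
  (\int[mu]_(x in `[a, +oo[) (f x)%:E = (l - F a)%:E)%E.
Proof.
move=> dF cf f0 Fl.
rewrite (@ge0_continuous_FTC2y _ f F a l) ?EFinB//.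
- exact: continuous_subspaceT.
- apply: cvg_at_right_filter.
  by apply/differentiable_continuous/derivable1_diffP; have [] := dF a.
- by move=> x _; rewrite derive1E; exact: derive_val.
Qed.

Lemma ge0_integrable_itvy f a (l : R) : measurable_fun `[a, +oo[ f ->
  (forall x, a <= x -> 0 <= f x) ->
  (\int[mu]_(x in `[a, +oo[) (f x)%:E = l%:E)%E ->
  mu.-integrable `[a, +oo[ (EFin \o f).
Proof.
move=> mf f0 fl; apply/integrableP; split; first exact/measurable_EFinP.
rewrite [ltLHS](_ : _ = l%:E) ?ltry// -fl; apply: eq_integral => x.
by rewrite inE/= in_itv/= andbT => ax; rewrite ger0_norm ?f0.
Qed.

Lemma cvg_expRNMy s : 0 < s -> expR (- (s * x)) @[x --> +oo] --> (0 : R).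
Proof.
move=> s0.
have H : expR (- x) @[x --> +oo] --> (0:R) by exact: cvgr_expR.
apply: (cvg_comp _ _ _ H).
apply/cvgryPge => A; near=> x.
by rewrite -ler_pdivrMl//; near: x; apply: nbhs_pinfty_ge; exact: num_real.
Unshelve. all: by end_near. Qed.

Lemma cvg_expRNM_bounded s (g : R -> R) C : 0 < s -> (forall x, `|g x| <= C) ->
  expR (- (s * x)) * g x @[x --> +oo] --> (0 : R).
Proof.
move=> s0 gC.
apply/norm_cvg0P.
apply: (@squeeze_cvgr _ _ _ _ (cst 0) (fun x => C * expR (- (s * x)))).
- near=> x; rewrite normr_ge0/= normrM gtr0_norm ?expR_gt0// mulrC.
  by rewrite ler_wpM2r ?expR_ge0.
- exact: cvg_cst.
- by rewrite -[X in _ --> X](mulr0 C); apply: cvgMr; exact: cvg_expRNMy.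
Unshelve. all: by end_near. Qed.

Lemma integral_expRNM s : 0 < s ->
  (\int[mu]_(x in `[0%R, +oo[) (expR (- (s * x)))%:E = (s^-1)%:E)%E.
Proof.
move=> s0.
have dF x : is_derive x 1 (fun x => - s^-1 * expR (- (s * x))) (expR (- (s * x))).
  by apply: is_derive_eq; rewrite /GRing.scale/=; field; rewrite gt_eqF.
rewrite (@ge0_FTC_itvy _ _ 0 0 dF).
- by rewrite mulr0 oppr0 expR0 mulr1 opprK add0r.
- by move=> x; apply: continuous_comp; [apply: cvgN; apply: cvgMr; exact: cvg_id|exact: continuous_expR].
- by move=> x _; exact: expR_ge0.
- by rewrite -[X in _ --> X](mulr0 (- s^-1)); apply: cvgMr; exact: cvg_expRNMy.
Qed.

(** Adding 1 to the cosine keeps the integrand nonnegative, as the fundamental theorem on an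
    unbounded interval requires; the cosine integral is recovered afterwards by subtracting
    [integral_expRNM]. *)
Lemma integral_expRNM_1Dcos s xi : 0 < s ->
  (\int[mu]_(x in `[0%R, +oo[) (expR (- (s * x)) * (1 + cos (xi * x)))%:E =
  (s^-1 + s / (s ^+ 2 + xi ^+ 2))%:E)%E.
Proof.
move=> s0.
have sx0 : s ^+ 2 + xi ^+ 2 != 0 by rewrite gt_eqF// ltr_pwDl ?exprn_gt0 ?sqr_ge0.
have dF x : is_derive x 1
    (fun x => expR (- (s * x)) * (- s^-1 + (xi * sin (xi * x) - s * cos (xi * x)) / (s ^+ 2 + xi ^+ 2)))
    (expR (- (s * x)) * (1 + cos (xi * x))).
  apply: is_derive_eq; rewrite /GRing.scale/=.
  by field; rewrite sx0 gt_eqF.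
rewrite (@ge0_FTC_itvy _ _ 0 0 dF).
- rewrite !mulr0 oppr0 expR0 cos0 sin0; congr EFin; field.
  by rewrite sx0 gt_eqF.
- move=> x; apply: cvgM; first by apply: continuous_comp; [apply: cvgN; apply: cvgMr; exact: cvg_id|exact: continuous_expR].
  apply: cvgD; first exact: cvg_cst.
  by apply: continuous_comp; [apply: cvgMr; exact: cvg_id|exact: continuous_cos].
- by move=> x _; rewrite mulr_ge0 ?expR_ge0// -lerBlDl sub0r cos_geN1.
- apply: (@cvg_expRNM_bounded s _ (s^-1 + (`|xi| + s) / (s ^+ 2 + xi ^+ 2))) => // x.
  rewrite (le_trans (ler_normD _ _))// normrN gtr0_norm ?invr_gt0// lerD2l normrM.
  rewrite [X in _ * X <= _]gtr0_norm ?invr_gt0 ?ltr_pwDl ?exprn_gt0 ?sqr_ge0//.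
  rewrite ler_wpM2r ?invr_ge0 ?addr_ge0 ?sqr_ge0// (le_trans (ler_normB _ _))// !normrM lerD//.
    by rewrite ler_piMr ?sin_max.
  by rewrite (gtr0_norm s0) ler_piMr ?cos_max// ltW.
Qed.

Lemma integral_expRNM_1Dsin s xi : 0 < s ->
  (\int[mu]_(x in `[0%R, +oo[) (expR (- (s * x)) * (1 + sin (xi * x)))%:E =
  (s^-1 + xi / (s ^+ 2 + xi ^+ 2))%:E)%E.
Proof.
move=> s0.
have sx0 : s ^+ 2 + xi ^+ 2 != 0 by rewrite gt_eqF// ltr_pwDl ?exprn_gt0 ?sqr_ge0.
have dF x : is_derive x 1
    (fun x => expR (- (s * x)) * (- s^-1 - (xi * cos (xi * x) + s * sin (xi * x)) / (s ^+ 2 + xi ^+ 2)))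
    (expR (- (s * x)) * (1 + sin (xi * x))).
  apply: is_derive_eq; rewrite /GRing.scale/=.
  by field; rewrite sx0 gt_eqF.
rewrite (@ge0_FTC_itvy _ _ 0 0 dF).
- rewrite !mulr0 oppr0 expR0 cos0 sin0; congr EFin; field.
  by rewrite sx0 gt_eqF.
- move=> x; apply: cvgM; first by apply: continuous_comp; [apply: cvgN; apply: cvgMr; exact: cvg_id|exact: continuous_expR].
  apply: cvgD; first exact: cvg_cst.
  by apply: continuous_comp; [apply: cvgMr; exact: cvg_id|exact: continuous_sin].
- by move=> x _; rewrite mulr_ge0 ?expR_ge0// -lerBlDl sub0r sin_geN1.
- apply: (@cvg_expRNM_bounded s _ (s^-1 + (`|xi| + s) / (s ^+ 2 + xi ^+ 2))) => // x.
  rewrite (le_trans (ler_normB _ _))// normrN gtr0_norm ?invr_gt0// lerD2l normrM.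
  rewrite [X in _ * X <= _]gtr0_norm ?invr_gt0 ?ltr_pwDl ?exprn_gt0 ?sqr_ge0//.
  rewrite ler_wpM2r ?invr_ge0 ?addr_ge0 ?sqr_ge0// (le_trans (ler_normD _ _))// !normrM lerD//.
    by rewrite ler_piMr ?cos_max.
  by rewrite (gtr0_norm s0) ler_piMr ?sin_max// ltW.
Qed.

Lemma integrable_expRNM s : 0 < s ->
  mu.-integrable `[0, +oo[ (EFin \o (fun x => expR (- (s * x)))).
Proof.
move=> s0; apply: ge0_integrable_itvy (integral_expRNM s0).
  apply: measurable_funTS; apply: continuous_measurable_fun => x.
  by apply: continuous_comp; [apply: cvgN; apply: cvgMr; exact: cvg_id|exact: continuous_expR].
by move=> x _; exact: expR_ge0.
Qed.

Lemma Rintegral_expRNM s : 0 < s ->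
  \int[mu]_(x in `[0, +oo[) expR (- (s * x)) = s^-1.
Proof. by move=> s0; rewrite /Rintegral integral_expRNM. Qed.

Lemma continuous_cosM xi : continuous (fun x => cos (xi * x)).
Proof.
by move=> x; apply: continuous_comp; [apply: cvgMr; exact: cvg_id|exact: continuous_cos].
Qed.

Lemma continuous_sinM xi : continuous (fun x => sin (xi * x)).
Proof.
by move=> x; apply: continuous_comp; [apply: cvgMr; exact: cvg_id|exact: continuous_sin].
Qed.

Lemma integrable_expRNM_cos s xi : 0 < s ->
  mu.-integrable `[0, +oo[ (EFin \o (fun x => expR (- (s * x)) * cos (xi * x))).
Proof.
move=> s0; apply: (integrable_dominated (C := 1)) (integrable_expRNM s0) _ _ => //.
  apply: measurable_funTS; apply: continuous_measurable_fun => x.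
  apply: cvgM; last exact: continuous_cosM.
  by apply: continuous_comp; [apply: cvgN; apply: cvgMr; exact: cvg_id|exact: continuous_expR].
by move=> x _; rewrite normrM gtr0_norm ?expR_gt0// mulrC ler_wpM2r ?expR_ge0 ?cos_max.
Qed.

Lemma integrable_expRNM_sin s xi : 0 < s ->
  mu.-integrable `[0, +oo[ (EFin \o (fun x => expR (- (s * x)) * sin (xi * x))).
Proof.
move=> s0; apply: (integrable_dominated (C := 1)) (integrable_expRNM s0) _ _ => //.
  apply: measurable_funTS; apply: continuous_measurable_fun => x.
  apply: cvgM; last exact: continuous_sinM.
  by apply: continuous_comp; [apply: cvgN; apply: cvgMr; exact: cvg_id|exact: continuous_expR].
by move=> x _; rewrite normrM gtr0_norm ?expR_gt0// mulrC ler_wpM2r ?expR_ge0 ?sin_max.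
Qed.

Lemma Rintegral_expRNM_cos s xi : 0 < s ->
  \int[mu]_(x in `[0, +oo[) (expR (- (s * x)) * cos (xi * x)) = s / (s ^+ 2 + xi ^+ 2).
Proof.
move=> s0; have := integral_expRNM_1Dcos xi s0 => /(congr1 fine).
have -> : fine (\int[mu]_(x in `[0%R, +oo[) (expR (- (s * x)) * (1 + cos (xi * x)))%:E)%E =
  \int[mu]_(x in `[0, +oo[) (expR (- (s * x)) + expR (- (s * x)) * cos (xi * x)).
  by apply: eq_Rintegral => x _; rewrite mulrDr mulr1.
rewrite RintegralD//; [|exact: integrable_expRNM|exact: integrable_expRNM_cos].
by rewrite Rintegral_expRNM//= => /addrI.
Qed.

Lemma Rintegral_expRNM_sin s xi : 0 < s ->
  \int[mu]_(x in `[0, +oo[) (expR (- (s * x)) * sin (xi * x)) = xi / (s ^+ 2 + xi ^+ 2).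
Proof.
move=> s0; have := integral_expRNM_1Dsin xi s0 => /(congr1 fine).
have -> : fine (\int[mu]_(x in `[0%R, +oo[) (expR (- (s * x)) * (1 + sin (xi * x)))%:E)%E =
  \int[mu]_(x in `[0, +oo[) (expR (- (s * x)) + expR (- (s * x)) * sin (xi * x)).
  by apply: eq_Rintegral => x _; rewrite mulrDr mulr1.
rewrite RintegralD//; [|exact: integrable_expRNM|exact: integrable_expRNM_sin].
by rewrite Rintegral_expRNM//= => /addrI.
Qed.

End calculus.

(** * The Poisson kernel as an approximate identity *)

Section poisson_kernel.
Context {R : realType}.
Notation mu := (@lebesgue_measure R).
Implicit Types (f F : R -> R) (a l s x xi : R).

Lemma poisson_den_gt0 (delta z : R) : 0 < delta -> 0 < delta ^+ 2 + z ^+ 2.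
Proof. by move=> d0; rewrite ltr_pwDl ?exprn_gt0 ?sqr_ge0. Qed.

Lemma continuous_poisson_kernel (delta x : R) : 0 < delta ->
  continuous (fun y : R => delta / (delta ^+ 2 + (y - x) ^+ 2)).
Proof.
move=> d0 y; apply: cvgMr; apply: cvgV; first by rewrite gt_eqF// poisson_den_gt0.
apply: cvgD; first exact: cvg_cst.
apply: (@cvg_comp _ _ _ (fun y : R => y - x) (fun z => z ^+ 2)); last exact: exprn_continuous.
by apply: cvgB; [exact: cvg_id|exact: cvg_cst].
Qed.

Lemma integral_poisson_kernely (delta x : R) : 0 < delta ->
  (\int[mu]_(y in `[x, +oo[) (delta / (delta ^+ 2 + (y - x) ^+ 2))%:E = (pi / 2)%:E)%E.
Proof.
move=> d0.
have dF (y : R) : is_derive y 1 (fun y : R => atan ((y - x) / delta)) (delta / (delta ^+ 2 + (y - x) ^+ 2)).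
  apply: is_derive_eq; rewrite /GRing.scale/=.
  have := poisson_den_gt0 (y - x) d0 => /gt_eqF h.
  by field; rewrite h gt_eqF//=; apply/negP => /eqP; move/eqP: h; lra.
rewrite (@ge0_FTC_itvy _ _ _ x (pi / 2) dF).
- by rewrite subrr mul0r atan0 subr0.
- exact: continuous_poisson_kernel.
- by move=> y _; rewrite divr_ge0 ?(ltW (poisson_den_gt0 _ _))// ltW.
- apply: (cvg_comp _ _ _ (@cvgy_atan R)).
  apply/cvgryPge => A; near=> y.
  rewrite ler_pdivlMr// lerBrDr; near: y; apply: nbhs_pinfty_ge; exact: num_real.
Unshelve. all: by end_near. Qed.

Lemma integral_poisson_kernel (delta x : R) : 0 < delta ->
  (\int[mu]_y (delta / (delta ^+ 2 + (y - x) ^+ 2))%:E = pi%:E)%E.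
Proof.
move=> d0.
have cK := continuous_poisson_kernel (x := x) d0.
have K0 y : 0 <= delta / (delta ^+ 2 + (y - x) ^+ 2).
  by rewrite divr_ge0 ?(ltW (poisson_den_gt0 _ _))// ltW.
have mK : measurable_fun setT (fun y : R => delta / (delta ^+ 2 + (y - x) ^+ 2)).
  exact: continuous_measurable_fun.
rewrite (_ : setT = `]-oo, x[ `|` `[x, +oo[); last first.
  by rewrite -(setCitvl) setUv.
rewrite ge0_integral_setU//=; last 3 first.
- by apply/measurable_EFinP; exact: measurable_funTS.
- by move=> y _; rewrite lee_fin.
- by rewrite -setCitvl disj_set2E setICr.
rewrite integral_poisson_kernely// integral_itv_bndo_bndc; last first.
  by apply/measurable_EFinP; exact: measurable_funTS.
rewrite -{1}(opprK x) ge0_integration_by_substitutionNy; last 2 first.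
- exact: continuous_subspaceT.
- by move=> y _.
rewrite [X in (X + _)%E](_ : _ = (pi / 2)%:E); first by rewrite -EFinD -splitr.
rewrite -(integral_poisson_kernely (- x) d0); apply: eq_integral => y _ /=.
by rewrite -opprD sqrrN opprK.
Qed.

Lemma integrable_poisson_kernel (delta x : R) : 0 < delta ->
  mu.-integrable setT (EFin \o (fun y : R => delta / (delta ^+ 2 + (y - x) ^+ 2))).
Proof.
move=> d0; apply/integrableP; split.
  by apply/measurable_EFinP; apply: continuous_measurable_fun; exact: continuous_poisson_kernel.
rewrite [ltLHS](_ : _ = pi%:E) ?ltry// -(integral_poisson_kernel x d0).
apply: eq_integral => y _ /=.
by rewrite ger0_norm// divr_ge0 ?(ltW (poisson_den_gt0 _ _))// ltW.
Qed.

Lemma Rintegral_poisson_kernel (delta x : R) : 0 < delta ->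
  \int[mu]_y (delta / (delta ^+ 2 + (y - x) ^+ 2)) = pi.
Proof. by move=> d0; rewrite /Rintegral integral_poisson_kernel. Qed.

(** A majorant independent of delta, for dominated convergence. The Lipschitz bound controls the
    region near z = 0, through z delta <= delta^2 + z^2, and the uniform bound D controls the tail.
    It is applied with w = f y - f x and z = y - x. *)
Lemma poisson_kernel_bound (L D delta z w : R) : 0 < delta -> delta <= 1 ->
  0 <= L -> 0 <= D -> `|w| <= L * `|z| -> `|w| <= D ->
  `|w * (delta / (delta ^+ 2 + z ^+ 2))| <= (L + D) * (1 / (1 ^+ 2 + z ^+ 2)).
Proof.
move=> d0 d1 L0 D0 wL wD.
have p0 := poisson_den_gt0 z d0.
have p1 := poisson_den_gt0 z (@ltr01 R).
rewrite normrM (gtr0_norm (divr_gt0 d0 p0)) mulrA mulrA ler_pdivrMr// mulrAC ler_pdivlMr//.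
rewrite mulr1 expr1n.
have z2 : z ^+ 2 = `|z| ^+ 2 by rewrite real_normK// num_real.
rewrite z2; move: wL; move: (normr_ge0 z) (normr_ge0 w) => zz ww wL.
set Z := `|z| in wL zz *; set W := `|w| in wL ww wD *.
have h1 : W * delta <= L * (delta ^+ 2 + Z ^+ 2).
  apply: (@le_trans _ _ (L * Z * delta)); first by rewrite ler_wpM2r// ltW.
  rewrite -mulrA ler_wpM2l//.
  have : 0 <= (Z - delta) ^+ 2 by exact: sqr_ge0.
  by nra.
have h2 : W * delta * Z ^+ 2 <= D * (delta ^+ 2 + Z ^+ 2).
  apply: (@le_trans _ _ (D * Z ^+ 2)).
    rewrite ler_wpM2r ?sqr_ge0// (le_trans _ wD)// ler_piMr//.
  by rewrite ler_wpM2l// lerDr sqr_ge0.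
by rewrite mulrDr mulr1 mulrDl; exact: lerD.
Qed.

Lemma Rdominated_convergence d (T : measurableType d) (m : {measure set T -> \bar R})
    (D : set T) (f_ : nat -> T -> R) (f g : T -> R) : measurable D ->
  (forall n, measurable_fun D (f_ n)) ->
  (forall t, D t -> f_ n t @[n --> \oo] --> f t) ->
  m.-integrable D (EFin \o g) ->
  (forall n t, D t -> `|f_ n t| <= g t) ->
  m.-integrable D (EFin \o f) /\
  \int[m]_(t in D) f_ n t @[n --> \oo] --> \int[m]_(t in D) f t.
Proof.
move=> mD mf_ cvf intg fg.
have mf : measurable_fun D f by apply: (measurable_fun_cvg mf_) => t Dt; exact: cvf.
have [] := @dominated_convergence _ _ _ m _ mD (fun n => EFin \o f_ n) (EFin \o f) (EFin \o g).
- by move=> n; exact/measurable_EFinP.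
- exact/measurable_EFinP.
- apply: aeW => t Dt; apply: cvg_EFin; last exact: cvf.
  by near=> n.
- exact: intg.
- by apply: aeW => t n Dt; rewrite /= lee_fin fg.
move=> intf _ cv.
split => //; apply: fine_cvg.
rewrite fineK; first exact: cv.
exact: integrable_fin_num.
Unshelve. all: by end_near. Qed.

Lemma cvg_harmonicR : (n.+1%:R^-1 : R) @[n --> \oo] --> (0 : R).
Proof. exact: cvg_harmonic. Qed.

Lemma poisson_kernel_approx (f : R -> R) (L D x : R) : continuous f ->
  mu.-integrable setT (EFin \o f) ->
  (forall y, `|f y - f x| <= L * `|y - x|) -> (forall y, `|f y - f x| <= D) ->
  \int[mu]_y (f y * (n.+1%:R^-1 / (n.+1%:R^-1 ^+ 2 + (y - x) ^+ 2))) @[n --> \oo] --> pi * f x.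
Proof.
move=> cf intf fL fD.
have L0 : 0 <= L.
  by have := fL (x + 1); rewrite [x + 1]addrC addrK normr1 mulr1 => /(le_trans _); apply.
have D0 : 0 <= D by apply: le_trans (fD x).
pose K n y : R := n.+1%:R^-1 / (n.+1%:R^-1 ^+ 2 + (y - x) ^+ 2).
have mK n : measurable_fun setT (K n).
  by apply: continuous_measurable_fun; apply: continuous_poisson_kernel.
have mf : measurable_fun setT f by exact: continuous_measurable_fun.
have bnd n y : `|(f y - f x) * K n y| <= (L + D) * (1 / (1 ^+ 2 + (y - x) ^+ 2)).
  by apply: poisson_kernel_bound => //; rewrite invf_le1// ler1n.
have intg : mu.-integrable setT (EFin \o (fun y : R => (L + D) * (1 / (1 ^+ 2 + (y - x) ^+ 2)))).
  apply: (@integrable_dominated _ _ _ mu _ _ _ (L + D)) (integrable_poisson_kernel x (@ltr01 R)) _ _ => //.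
    by apply: measurable_funM => //; apply: continuous_measurable_fun; apply: continuous_poisson_kernel.
  move=> y _; rewrite ger0_norm// mulr_ge0 ?addr_ge0// divr_ge0//.
  by apply: ltW; exact: poisson_den_gt0.
have mfK n : measurable_fun setT (fun y : R => (f y - f x) * K n y).
  by apply: measurable_funM => //; apply: measurable_funB.
(* Subtracting [f x] first makes the integrand vanish at y = x, where the kernel itself blows up, so
   that it tends to 0 at every point. *)
have cv0 : \int[mu]_y ((f y - f x) * K n y) @[n --> \oo] --> (0 : R).
  have [|||_] := @Rdominated_convergence _ _ mu setT (fun n y => (f y - f x) * K n y)
    (cst 0) _ measurableT _ _ intg.
  - exact: mfK.
  - move=> y _; have [->|yx] := eqVneq y x.
      by under eq_fun do rewrite subrr mul0r; exact: cvg_cst.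
    apply/norm_cvg0P; apply: (@squeeze_cvgr _ _ _ _ (cst 0) (fun n => n.+1%:R^-1 * (D / (y - x) ^+ 2))).
    + near=> n; rewrite normr_ge0/= normrM.
      have p0 : 0 < n.+1%:R^-1 ^+ 2 + (y - x) ^+ 2 by apply: poisson_den_gt0.
      have yx2 : 0 < (y - x) ^+ 2 by rewrite exprn_even_gt0//= subr_eq0.
      rewrite (gtr0_norm (divr_gt0 _ p0))// mulrCA ler_wpM2l//.
      by apply: ler_pM => //; rewrite ?invr_ge0 ?(ltW p0)// lef_pV2 ?posrE// lerDr sqr_ge0.
    + exact: cvg_cst.
    + rewrite -[X in _ --> X](mul0r (D / (y - x) ^+ 2)); apply: cvgMl.
      exact: cvg_harmonicR.
  - by move=> n y _; exact: bnd.
  - by rewrite Rintegral_cst// mul0r.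
have -> : (fun n => \int[mu]_y (f y * (n.+1%:R^-1 / (n.+1%:R^-1 ^+ 2 + (y - x) ^+ 2)))) =
   (fun n => \int[mu]_y ((f y - f x) * K n y) + pi * f x).
  apply/funext => n.
  have iK : mu.-integrable setT (EFin \o K n) by apply: integrable_poisson_kernel.
  rewrite -(@Rintegral_poisson_kernel n.+1%:R^-1 x)// -RintegralZr//.
  rewrite -RintegralD//.
  - by apply: eq_Rintegral => y _; rewrite /K; ring.
  - apply: (integrable_dominated (C := 1)) intg _ _ => //.
      exact: mfK.
    by move=> y _; rewrite mul1r.
  - apply: (integrable_dominated (C := `|f x|)) iK _ _ => //.
      by apply: (measurable_funM (mK n)); exact: measurable_cst.
    move=> y _; rewrite normrM mulrC ler_wpM2l// ger0_norm// divr_ge0//.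
    by apply: ltW; exact: poisson_den_gt0.
rewrite -[X in _ --> X]add0r; apply: cvgD => //; exact: cvg_cst.
Unshelve. all: by end_near. Qed.

End poisson_kernel.

Lemma integral_indicM d (T : measurableType d) (R : realType)
    (m : {measure set T -> \bar R}) (D : set T) (f : T -> R) :
  (\int[m]_(x in D) (f x)%:E = \int[m]_x (f x * \1_D x)%:E)%E.
Proof.
rewrite integral_mkcond; apply: eq_integral => x _.
by rewrite /patch indicE; case: (x \in D); rewrite ?mulr1 ?mulr0.
Qed.

Section Rintegrable.
Context d (T : measurableType d) (R : realType) (m : {measure set T -> \bar R}).
Variables (D : set T) (mD : measurable D).
Implicit Types f g : T -> R.

Lemma RintegrableZl (c : R) f : m.-integrable D (EFin \o f) ->
  m.-integrable D (EFin \o (fun x => c * f x)).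
Proof. by move=> intf; exact: (@integrableZl _ _ _ m _ mD c (EFin \o f)). Qed.

Lemma RintegrableZr (c : R) f : m.-integrable D (EFin \o f) ->
  m.-integrable D (EFin \o (fun x => f x * c)).
Proof.
move=> intf; rewrite (_ : (fun x => f x * c) = (fun x => c * f x)); first exact: RintegrableZl.
by apply/funext => x; rewrite mulrC.
Qed.

Lemma RintegrableD f g : m.-integrable D (EFin \o f) -> m.-integrable D (EFin \o g) ->
  m.-integrable D (EFin \o (fun x => f x + g x)).
Proof. by move=> intf intg; exact: (integrableD mD intf intg). Qed.

Lemma RintegrableB f g : m.-integrable D (EFin \o f) -> m.-integrable D (EFin \o g) ->
  m.-integrable D (EFin \o (fun x => f x - g x)).
Proof. by move=> intf intg; exact: (integrableB mD intf intg). Qed.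

End Rintegrable.

(** * Fubini for real-valued integrals under a product majorant *)

Section Rfubini.
Context d1 d2 (T1 : measurableType d1) (T2 : measurableType d2) (R : realType).
Variables (m1 : {sigma_finite_measure set T1 -> \bar R})
  (m2 : {sigma_finite_measure set T2 -> \bar R}).
Variables (D1 : set T1) (D2 : set T2) (h : T1 * T2 -> R) (g1 : T1 -> R) (g2 : T2 -> R).
Hypotheses (mD1 : measurable D1) (mD2 : measurable D2) (mh : measurable_fun setT h).
Hypotheses (ig1 : m1.-integrable D1 (EFin \o g1)) (ig2 : m2.-integrable D2 (EFin \o g2)).
Hypothesis hg : forall x y, D1 x -> D2 y -> `|h (x, y)| <= g1 x * g2 y.

(** The extension of [h] by 0 off D1 x D2, so that Fubini can be applied on the whole product
    space. *)
Let H (z : T1 * T2) : R := h z * \1_D1 z.1 * \1_D2 z.2.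

Let mH : measurable_fun setT H.
Proof.
apply: measurable_funM; first apply: measurable_funM => //.
- apply: (@measurableT_comp _ _ _ _ _ _ (\1_D1 : T1 -> R)); [exact: measurable_indic|exact: measurable_fst].
- apply: (@measurableT_comp _ _ _ _ _ _ (\1_D2 : T2 -> R)); [exact: measurable_indic|exact: measurable_snd].
Qed.

Let G1 x : R := `|g1 x| * \1_D1 x.
Let G2 x : R := `|g2 x| * \1_D2 x.

Let iG1 : (\int[m1]_x (G1 x)%:E < +oo)%E.
Proof. by rewrite /G1 -integral_indicM; case/integrableP: ig1. Qed.

Let iG2 : (\int[m2]_x (G2 x)%:E < +oo)%E.
Proof. by rewrite /G2 -integral_indicM; case/integrableP: ig2. Qed.

Let mG1 : measurable_fun setT G1.
Proof.
have /(measurable_int m1) /measurable_EFinP := ig1 => m.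
have : measurable_fun setT ((fun x => `|g1 x|) \_ D1).
  by apply/(measurable_restrictT _ mD1).1; exact: measurableT_comp.
apply: eq_measurable_fun => x _.
by rewrite /G1 /patch indicE; case: (x \in D1); rewrite ?mulr1 ?mulr0.
Qed.

Let mG2 : measurable_fun setT G2.
Proof.
have /(measurable_int m2) /measurable_EFinP := ig2 => m.
have : measurable_fun setT ((fun x => `|g2 x|) \_ D2).
  by apply/(measurable_restrictT _ mD2).1; exact: measurableT_comp.
apply: eq_measurable_fun => x _.
by rewrite /G2 /patch indicE; case: (x \in D2); rewrite ?mulr1 ?mulr0.
Qed.

Let HG x y : `|H (x, y)| <= G1 x * G2 y.
Proof.
rewrite /H /G1 /G2 !indicE/=.
have [/set_mem xD|xD] := boolP (x \in D1); last by rewrite !(mulr0, mul0r) normr0.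
have [/set_mem yD|yD] := boolP (y \in D2); last by rewrite !(mulr0, mul0r) normr0.
by rewrite !mulr1 (le_trans (hg xD yD))// (le_trans (ler_norm _))// normrM.
Qed.

Let G10 x : 0 <= G1 x. Proof. by rewrite mulr_ge0. Qed.
Let G20 x : 0 <= G2 x. Proof. by rewrite mulr_ge0. Qed.

Let iH : (m1 \x m2)%E.-integrable setT (EFin \o H).
Proof.
apply/integrable12ltyP; first exact/measurable_EFinP.
have fin2 : (\int[m2]_y (G2 y)%:E)%E \is a fin_num.
  by rewrite ge0_fin_numE// integral_ge0// => y _; rewrite lee_fin.
apply: (@le_lt_trans _ _ (\int[m1]_x ((G1 x)%:E * \int[m2]_y (G2 y)%:E))%E).
  apply: ge0_le_integral => //.
  - by move=> x _; exact: integral_ge0.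
  - apply: (@measurable_fun_fubini_tonelli_F _ _ _ _ _ _ (fun z => `|H z|%:E)).
      by apply/measurable_EFinP; exact: measurableT_comp.
    by move=> z; rewrite lee_fin.
  - by apply: emeasurable_funM; [exact/measurable_EFinP|exact: measurable_cst].
  - move=> x _; rewrite -ge0_integralZl//.
    + apply: ge0_le_integral => //.
      * apply/measurable_EFinP; apply: measurableT_comp => //.
        exact: (measurableT_comp mH).
      * by apply: emeasurable_funM; [exact: measurable_cst|exact/measurable_EFinP].
      * by move=> y _; rewrite -EFinM lee_fin; exact: HG.
    + exact/measurable_EFinP.
    + by move=> y _; rewrite lee_fin.
    + by rewrite lee_fin.
rewrite ge0_integralZr//; last 3 first.
- exact/measurable_EFinP.
- by move=> x _; rewrite lee_fin.
- by apply: integral_ge0 => y _; rewrite lee_fin.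
apply: lte_mul_pinfty => //.
- by apply: integral_ge0 => y _; rewrite lee_fin.
- by rewrite ge0_fin_numE// integral_ge0// => y _; rewrite lee_fin.
Qed.

Lemma Rfubini : \int[m1]_(x in D1) \int[m2]_(y in D2) h (x, y) =
  \int[m2]_(y in D2) \int[m1]_(x in D1) h (x, y).
Proof.
(* The majorant holds at every point, so every inner integral is finite, not merely almost every
   one; [fine] inside [Rintegral] then loses nothing. *)
have fin1 x : (\int[m2]_y (H (x, y))%:E)%E \is a fin_num.
  apply: integrable_fin_num => //.
  apply: (@integrable_dominated _ _ _ m2 setT G2 (fun y => H (x, y)) (G1 x)) => //.
  - apply/integrableP; split; first exact/measurable_EFinP.
    by under eq_integral do rewrite /= ger0_norm//.
  - exact: (measurableT_comp mH).
have fin2 y : (\int[m1]_x (H (x, y))%:E)%E \is a fin_num.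
  apply: integrable_fin_num => //.
  apply: (@integrable_dominated _ _ _ m1 setT G1 (fun z => H (z, y)) (G2 y)) => //.
  - apply/integrableP; split; first exact/measurable_EFinP.
    by under eq_integral do rewrite /= ger0_norm//.
  - exact: (measurableT_comp mH).
  - by move=> z _; rewrite mulrC.
have := Fubini iH.
move=> E; rewrite /Rintegral (integral_indicM m1 D1) (integral_indicM m2 D2); congr fine.
transitivity (\int[m1]_x \int[m2]_y (EFin \o H) (x, y))%E.
  apply: eq_integral => x _; rewrite integral_indicM -[RHS](fineK (fin1 x)); congr (_%:E).
  have [xD|xD] := boolP (x \in D1).
    rewrite indicE xD mulr1; congr fine; apply: eq_integral => y _.
    by rewrite /H/= !indicE xD mulr1.
  rewrite indicE (negbTE xD) mulr0 integral0_eq// => y _.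
  by rewrite /H/= !indicE (negbTE xD) mulr0 mul0r.
rewrite E; apply: eq_integral => y _; rewrite integral_indicM -[LHS](fineK (fin2 y)); congr (_%:E).
have [yD|yD] := boolP (y \in D2).
  rewrite indicE yD mulr1; congr fine; apply: eq_integral => x _.
  by rewrite /H/= !indicE yD mulr1.
rewrite indicE (negbTE yD) mulr0 integral0_eq// => x _.
by rewrite /H/= !indicE (negbTE yD) mulr0.
Qed.

End Rfubini.

(** * The inversion formula *)

Section inversion.
Context {R : realType}.
Notation mu := (@lebesgue_measure R).
Variables (f A B : R -> R) (L D C : R).
Hypotheses (cf : continuous f) (intf : mu.-integrable setT (EFin \o f)).
Hypotheses (fL : forall x y, `|f y - f x| <= L * `|y - x|) (fD : forall y, `|f y| <= D).
Hypotheses (cA : continuous A) (cB : continuous B).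
Hypotheses (AE : forall xi, \int[mu]_y (f y * cos (xi * y)) = A xi).
Hypotheses (BE : forall xi, \int[mu]_y (f y * sin (xi * y)) = B xi).
Hypotheses (AC : forall xi, `|A xi| <= C / (1 + xi ^+ 2)).
Hypotheses (BC : forall xi, `|B xi| <= C / (1 + xi ^+ 2)).

(** Up to a constant factor this is the Poisson kernel of width 1 / sigma centred at 0. *)
Lemma integrable_inv1Dsqr (sigma : R) : 0 < sigma ->
  mu.-integrable setT (EFin \o (fun y : R => 1 / (1 + (sigma * y) ^+ 2))).
Proof.
move=> s0; have si : 0 < sigma^-1 by rewrite invr_gt0.
have E (y : R) : 1 / (1 + (sigma * y) ^+ 2) =
   sigma^-1 * (sigma^-1 / (sigma^-1 ^+ 2 + (y - 0) ^+ 2)).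
  have h : 1 + (sigma * y) ^+ 2 != 0 by rewrite gt_eqF// ltr_pwDl ?sqr_ge0.
  rewrite subr0; have h2 := gt_eqF (poisson_den_gt0 y si).
  have -> : sigma^-1 ^+ 2 + y ^+ 2 = (1 + (sigma * y) ^+ 2) / sigma ^+ 2.
    by field; rewrite gt_eqF.
  by field; rewrite h gt_eqF.
have mE : measurable_fun setT (fun y : R => 1 / (1 + (sigma * y) ^+ 2)).
  under eq_fun do rewrite E.
  apply: measurable_funM; first exact: measurable_cst.
  by apply: continuous_measurable_fun; exact: continuous_poisson_kernel.
apply: (@integrable_dominated _ _ _ mu _ _ _ sigma^-1) (integrable_poisson_kernel 0 si) _ _ => //.
move=> y _; rewrite ger0_norm ?E//.
by rewrite mulr_ge0// ?divr_ge0 ?(ltW si)// ltW// poisson_den_gt0.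
Qed.

Lemma measurable_cosMM (sigma x : R) :
  measurable_fun setT (fun z : R * R => cos (sigma * z.1 * (z.2 - x))).
Proof.
apply: (measurableT_comp (f := @cos R)).
  by apply: continuous_measurable_fun; exact: continuous_cos.
apply: measurable_funM; first by apply: measurable_funM; [exact: measurable_cst|exact: measurable_fst].
by apply: measurable_funB; [exact: measurable_snd|exact: measurable_cst].
Qed.

Let Cge0 : 0 <= C.
Proof. by have := AC 0; rewrite expr0n addr0 divr1; apply: le_trans. Qed.

Let continuous_Mr (sigma : R) : continuous (fun y : R => sigma * y).
Proof. by move=> y; apply: cvgMr; exact: cvg_id. Qed.

Let G (sigma x eta : R) : R :=
  A (sigma * eta) * cos (sigma * eta * x) + B (sigma * eta) * sin (sigma * eta * x).

Let mG (sigma x : R) : measurable_fun setT (G sigma x).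
Proof.
have c1 : continuous (fun eta : R => sigma * eta * x).
  by move=> y; apply: cvgMl; exact: continuous_Mr.
apply: continuous_measurable_fun => y; apply: cvgD; apply: cvgM.
- by apply: continuous_comp; [exact: continuous_Mr|exact: cA].
- by apply: continuous_comp; [exact: c1|exact: continuous_cos].
- by apply: continuous_comp; [exact: continuous_Mr|exact: cB].
- by apply: continuous_comp; [exact: c1|exact: continuous_sin].
Qed.

Let bG (sigma x eta : R) : `|G sigma x eta| <= (C + C) * (1 / (1 + (sigma * eta) ^+ 2)).
Proof.
rewrite (le_trans (ler_normD _ _))// mulrDl !normrM mul1r lerD//.
  by rewrite (le_trans _ (AC _))// ler_piMr// cos_max.
by rewrite (le_trans _ (BC _))// ler_piMr// sin_max.
Qed.

Lemma fourier_integrable (sigma x : R) : 0 < sigma ->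
  mu.-integrable `[0, +oo[ (EFin \o (fun eta : R =>
    A (sigma * eta) * cos (sigma * eta * x) + B (sigma * eta) * sin (sigma * eta * x))).
Proof.
move=> s0.
apply: (integrableS (E := setT)) => //.
apply: (@integrable_dominated _ _ _ mu _ _ _ (C + C)) (integrable_inv1Dsqr s0) _ _ => //.
  exact: (mG sigma x).
by move=> y _; exact: bG.
Qed.

(** As f is real, A is even and B is odd, so the integrand is even in eta and a half-line suffices:
    hence pi instead of 2 pi. The scale sigma, later 1 / sqrt n, is built in so that no change of
    variables is needed afterwards. *)
Lemma fourier_inversion (sigma x : R) : 0 < sigma ->
  \int[mu]_(eta in `[0, +oo[)
     (A (sigma * eta) * cos (sigma * eta * x) + B (sigma * eta) * sin (sigma * eta * x))
  = pi / sigma * f x.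
Proof.
move=> s0.
have mf : measurable_fun setT f by exact: continuous_measurable_fun.
(* Abel summation: with the extra factor e^{-sigma eta / (n + 1)}, Fubini turns
   the integral into a Poisson kernel average of f around x. *)
pose I n : R := \int[mu]_(eta in `[0, +oo[) (expR (- (n.+1%:R^-1 * sigma * eta)) * G sigma x eta).
have mexp (c : R) : measurable_fun setT (fun eta : R => expR (- (c * eta))).
  apply: continuous_measurable_fun => y.
  by apply: continuous_comp; [apply: cvgN; exact: continuous_Mr|exact: continuous_expR].
have cv1 : I n @[n --> \oo] --> \int[mu]_(eta in `[0, +oo[) G sigma x eta.
  have ig : mu.-integrable `[0, +oo[ (EFin \o (fun y : R => (C + C) * (1 / (1 + (sigma * y) ^+ 2)))).
    apply: (integrableS (E := setT)) => //.
    apply: (@integrable_dominated _ _ _ mu _ _ _ (C + C)) (integrable_inv1Dsqr s0) _ _ => //.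
      apply: (measurable_funM (f := cst (C + C))); first exact: measurable_cst.
      by have /measurable_int/measurable_EFinP := integrable_inv1Dsqr s0.
    move=> y _; rewrite ger0_norm// mulr_ge0 ?addr_ge0// divr_ge0//.
    by rewrite addr_ge0// sqr_ge0.
  have [||||_] // := @Rdominated_convergence _ _ _ mu `[0, +oo[%classic
    (fun n eta => expR (- (n.+1%:R^-1 * sigma * eta)) * G sigma x eta) (G sigma x) _ _ _ _ ig _.
  - move=> n; apply: measurable_funTS.
    exact: (measurable_funM (mexp _) (mG _ _)).
  - move=> eta _; rewrite -[X in _ --> X]mul1r; apply: cvgMl.
    have l0 : - (n.+1%:R^-1 * sigma * eta) @[n --> \oo] --> (- (0 * sigma * eta) : R).
      by apply: cvgN; apply: cvgMl; apply: cvgMl; exact: cvg_harmonicR.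
    have := continuous_cvg _ (@continuous_expR R _) l0.
    by rewrite !mul0r oppr0 expR0; exact.
  - move=> n eta /=; rewrite in_itv/= andbT => e0.
    rewrite normrM (le_trans _ (bG sigma x eta))// ler_piMl// gtr0_norm ?expR_gt0//.
    by rewrite -expR0 ler_expR oppr_le0 !mulr_ge0// ltW.
have IE n : I n = sigma^-1 * \int[mu]_y (f y * (n.+1%:R^-1 / (n.+1%:R^-1 ^+ 2 + (y - x) ^+ 2))).
  set delta : R := n.+1%:R^-1.
  have d0 : 0 < delta by rewrite invr_gt0.
  have ds0 : 0 < delta * sigma by rewrite mulr_gt0.
  pose h (z : R * R) := expR (- (delta * sigma * z.1)) * f z.2 * cos (sigma * z.1 * (z.2 - x)).
  have mh : measurable_fun setT h.
    apply: measurable_funM; last exact: measurable_cosMM.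
    apply: measurable_funM.
      by apply: (measurableT_comp (mexp (delta * sigma))); exact: measurable_fst.
    by apply: (measurableT_comp mf); exact: measurable_snd.
  have hb (u v : R) : `[0, +oo[%classic u -> setT v -> `|h (u, v)| <= expR (- (delta * sigma * u)) * `|f v|.
    move=> _ _; rewrite /h/= !normrM (gtr0_norm (expR_gt0 _)) -mulrA ler_wpM2l ?expR_ge0//.
    by rewrite ler_piMr// cos_max.
  have iabsf : mu.-integrable setT (EFin \o (fun y => `|f y|)) by exact: integrable_norm.
  have swap := @Rfubini _ _ _ _ _ mu mu `[0, +oo[%classic setT h _ _ (measurable_itv _) measurableT mh
    (integrable_expRNM ds0) iabsf hb.
  transitivity (\int[mu]_(u in `[0, +oo[) \int[mu]_v h (u, v)).
    clear swap hb; apply: eq_Rintegral => u _.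
    rewrite -[in LHS]/(G sigma x u) /G -AE -BE /h/=.
    have ic (g : R -> R) : continuous g -> (forall v, `|g v| <= 1) ->
        mu.-integrable setT (EFin \o (fun y => f y * g y)).
      move=> cg g1; apply: (integrable_dominated (C := 1)) iabsf _ _ => //.
        exact: (measurable_funM mf (continuous_measurable_fun cg)).
      by move=> y _; rewrite normrM mul1r ler_piMr.
    have i1 := ic _ (continuous_cosM (xi := sigma * u)) (fun v => cos_max _).
    have i2 := ic _ (continuous_sinM (xi := sigma * u)) (fun v => sin_max _).
    rewrite -(RintegralZr (cos (sigma * u * x)) measurableT i1) -(RintegralZr (sin (sigma * u * x)) measurableT i2).
    have i1' := RintegrableZr measurableT (cos (sigma * u * x)) i1.
    have i2' := RintegrableZr measurableT (sin (sigma * u * x)) i2.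
    rewrite -(RintegralD measurableT i1' i2').
    rewrite -(RintegralZl _ measurableT (RintegrableD measurableT i1' i2')).
    by apply: eq_Rintegral => y _; rewrite mulrBr cosB; ring.
  rewrite swap {swap hb} -RintegralZl//; last first.
    apply: (integrable_dominated (C := delta^-1)) iabsf _ _ => //.
      exact: (measurable_funM mf (continuous_measurable_fun (continuous_poisson_kernel d0))).
    move=> y _; rewrite normrM mulrC ler_wpM2r// ger0_norm; last first.
      by rewrite divr_ge0 ?(ltW d0)// ltW// poisson_den_gt0.
    rewrite ler_pdivrMr ?poisson_den_gt0// ler_pdivlMl// -expr2.
    by rewrite lerDl sqr_ge0.
  apply: eq_Rintegral => y _; rewrite /h/=.
  transitivity (f y * \int[mu]_(u in `[0, +oo[) (expR (- (delta * sigma * u)) * cos (sigma * (y - x) * u))).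
    rewrite -RintegralZl//; last exact: integrable_expRNM_cos.
    by apply: eq_Rintegral => u _; rewrite [sigma * u * _]mulrAC; ring.
  rewrite Rintegral_expRNM_cos//.
  have h1 := gt_eqF (poisson_den_gt0 (y - x) d0).
  have -> : (delta * sigma) ^+ 2 + (sigma * (y - x)) ^+ 2 = sigma ^+ 2 * (delta ^+ 2 + (y - x) ^+ 2) by ring.
  by field; rewrite h1 gt_eqF.
have cv2 : I n @[n --> \oo] --> pi / sigma * f x.
  rewrite (funext IE) [pi / sigma]mulrC -mulrA; apply: cvgMr.
  apply: (@poisson_kernel_approx _ f L (D + D)) => // y.
  by rewrite (le_trans (ler_normB _ _))// lerD.
exact: (cvg_unique _ cv1 cv2).
Qed.

End inversion.

(** * Local limit theorem *)

Section local_limit.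
Context {R : realType}.
Notation mu := (@lebesgue_measure R).
Variables (f A B : R -> R) (L Df C : R).
Hypotheses (cf : continuous f) (intf : mu.-integrable setT (EFin \o f)).
Hypotheses (fL : forall x y, `|f y - f x| <= L * `|y - x|) (fD : forall y, `|f y| <= Df).
Hypotheses (cA : continuous A) (cB : continuous B).
Hypotheses (AE : forall xi, \int[mu]_y (f y * cos (xi * y)) = A xi).
Hypotheses (BE : forall xi, \int[mu]_y (f y * sin (xi * y)) = B xi).
Hypotheses (AC : forall xi, `|A xi| <= C / (1 + xi ^+ 2)).
Hypotheses (BC : forall xi, `|B xi| <= C / (1 + xi ^+ 2)).

Context d (T : measurableType d) (P : probability T R).

(** Inversion at the point S w, followed by Fubini. The majorant W w * 2C / (1 + (sigma eta)^2)
    comes entirely from the decay of A and B, so nothing is asked of the law of S, which may have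
    atoms. *)
Lemma expectation_fourier (W S : T -> R) (sigma : R) : 0 < sigma ->
  measurable_fun setT S -> (forall w, 0 <= W w) -> P.-integrable setT (EFin \o W) ->
  \int[P]_w (W w * f (S w)) = sigma / pi *
  \int[mu]_(eta in `[0, +oo[)
     (A (sigma * eta) * \int[P]_w (W w * cos (sigma * eta * S w)) +
      B (sigma * eta) * \int[P]_w (W w * sin (sigma * eta * S w))).
Proof.
move=> s0 mS W0 iW.
have C0 : 0 <= C by have := AC 0; rewrite expr0n addr0 divr1; apply: le_trans.
have mW : measurable_fun setT W by exact/measurable_EFinP/(measurable_int P).
pose G (eta x : R) : R :=
  A (sigma * eta) * cos (sigma * eta * x) + B (sigma * eta) * sin (sigma * eta * x).
pose h (z : T * R) : R := W z.1 * G z.2 (S z.1).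
have mse : measurable_fun setT (fun z : T * R => sigma * z.2).
  by apply: measurable_funM; [exact: measurable_cst|exact: measurable_snd].
have mseS : measurable_fun setT (fun z : T * R => sigma * z.2 * S z.1).
  by apply: measurable_funM => //; apply: (measurableT_comp mS); exact: measurable_fst.
have mh : measurable_fun setT h.
  apply: measurable_funM; first by apply: (measurableT_comp mW); exact: measurable_fst.
  apply: measurable_funD; apply: measurable_funM.
  - by apply: (measurableT_comp (f := A)) => //; exact: continuous_measurable_fun.
  - by apply: (measurableT_comp (f := @cos R)) => //; apply: continuous_measurable_fun; exact: continuous_cos.
  - by apply: (measurableT_comp (f := B)) => //; exact: continuous_measurable_fun.
  - by apply: (measurableT_comp (f := @sin R)) => //; apply: continuous_measurable_fun; exact: continuous_sin.
have hb (w : T) (eta : R) : setT w -> `[0, +oo[%classic eta ->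
    `|h (w, eta)| <= W w * ((C + C) * (1 / (1 + (sigma * eta) ^+ 2))).
  move=> _ _; rewrite /h/= normrM (ger0_norm (W0 w)) ler_wpM2l//.
  rewrite /G (le_trans (ler_normD _ _))// mulrDl !normrM mul1r lerD//.
    by rewrite (le_trans _ (AC _))// ler_piMr// cos_max.
  by rewrite (le_trans _ (BC _))// ler_piMr// sin_max.
have ig : mu.-integrable `[0, +oo[ (EFin \o (fun y : R => (C + C) * (1 / (1 + (sigma * y) ^+ 2)))).
  have i0 : mu.-integrable `[0, +oo[ (EFin \o (fun y : R => 1 / (1 + (sigma * y) ^+ 2))).
    by apply: integrableS (integrable_inv1Dsqr s0).
  exact: (@RintegrableZl _ _ _ mu _ (measurable_itv _) (C + C) _ i0).
have swap := @Rfubini _ _ _ _ _ P mu setT `[0, +oo[%classic h _ _ measurableT (measurable_itv _) mh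
    iW ig hb.
have E1 w : \int[mu]_(y in `[0, +oo[) h (w, y) = W w * (pi / sigma * f (S w)).
  rewrite -(fourier_inversion cf intf fL fD cA cB AE BE AC BC (S w) s0).
  rewrite -RintegralZl//.
  exact: (fourier_integrable cA cB AC BC).
transitivity (sigma / pi * \int[P]_w \int[mu]_(y in `[0, +oo[) h (w, y)).
  have iWf : P.-integrable setT (EFin \o (fun w => W w * f (S w))).
    apply: (integrable_dominated (C := Df)) iW _ _ => //.
      apply: measurable_funM => //; apply: (measurableT_comp (f := f)) => //.
      exact: continuous_measurable_fun.
    by move=> w _; rewrite normrM (ger0_norm (W0 w)) mulrC ler_wpM2r.
  under [in RHS]eq_Rintegral do rewrite E1.
  have -> : (fun w => W w * (pi / sigma * f (S w))) = (fun w => pi / sigma * (W w * f (S w))).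
    by apply/funext => w; ring.
  rewrite RintegralZl// mulrA [X in X * _](_ : _ = 1) ?mul1r//.
  by rewrite mulrA divfK ?divff ?lt0r_neq0 ?pi_gt0.
congr (_ * _); rewrite swap; apply: eq_Rintegral => eta _.
have ic (g : R -> R) : continuous g -> (forall v, `|g v| <= 1) ->
    P.-integrable setT (EFin \o (fun w => W w * g (sigma * eta * S w))).
  move=> cg g1; apply: (integrable_dominated (C := 1)) iW _ _ => //.
    apply: measurable_funM => //; apply: (measurableT_comp (f := g)).
      exact: continuous_measurable_fun.
    by apply: measurable_funM.
  by move=> w _; rewrite mul1r normrM (ger0_norm (W0 w)) ler_piMr.
have i1 := ic _ (@continuous_cos R) (@cos_max R).
have i2 := ic _ (@continuous_sin R) (@sin_max R).
rewrite -(RintegralZl _ measurableT i1) -(RintegralZl _ measurableT i2).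
rewrite -(RintegralD measurableT (RintegrableZl measurableT _ i1) (RintegrableZl measurableT _ i2)).
by apply: eq_Rintegral => w _; rewrite /h/G/=; ring.
Qed.

(** Half the mass of the normal density of variance 1 / tau. The value sqrt (pi / (2 tau)) is
    written with pi in the numerator so as to cancel the 1 / pi of the inversion formula. *)
Lemma Rintegral_gauss_half (tau : R) : 0 < tau ->
  \int[mu]_(x in `[0, +oo[) expR (- (tau * x ^+ 2 / 2)) = pi / Num.sqrt (2 * pi * tau).
Proof.
move=> t0.
pose s : R := (Num.sqrt tau)^-1.
have st0 : 0 < Num.sqrt tau by rewrite sqrtr_gt0.
have s0 : s != 0 by rewrite gt_eqF// invr_gt0.
have s2 : s ^+ 2 = tau^-1 by rewrite /s exprVn sqr_sqrtr// ltW.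
have pdfE (x : R) : normal_pdf 0 s x = normal_peak s * expR (- (tau * x ^+ 2 / 2)).
  rewrite normal_pdfE//; congr (_ * expR _).
  rewrite subr0 s2 -mulr_natr; field.
  by rewrite gt_eqF.
have := @integral_normal_pdf R 0 s.
rewrite (@ge0_symfun_integralT _ (normal_pdf 0 s)); last 3 first.
- by move=> x; exact: normal_pdf_ge0.
- exact: continuous_normal_pdf.
- by move=> x /=; rewrite !pdfE sqrrN.
rewrite (_ : [set x | _] = `[0, +oo[%classic); last first.
  by apply/seteqP; split => x/=; rewrite in_itv/= andbT.
have ip : mu.-integrable `[0, +oo[ (EFin \o normal_pdf 0 s).
  by apply: integrableS (integrable_normal_pdf 0 s).
have fin : (\int[mu]_(x in `[0%R, +oo[) (normal_pdf 0 s x)%:E)%E \is a fin_num.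
  by apply: integrable_fin_num ip.
rewrite -(fineK fin) -EFinM => -[half].
have pk0 := normal_peak_gt0 s0.
have -> : \int[mu]_(x in `[0, +oo[) expR (- (tau * x ^+ 2 / 2)) =
   \int[mu]_(x in `[0, +oo[) ((normal_peak s)^-1 * normal_pdf 0 s x).
  by apply: eq_Rintegral => x _; rewrite pdfE mulKf// gt_eqF.
rewrite RintegralZl//.
have -> : \int[mu]_(x in `[0, +oo[) normal_pdf 0 s x = 2^-1.
  by apply: (mulfI (x := 2)) => //; rewrite half divff.
rewrite /normal_peak invrK s2.
have h1 : 0 < Num.sqrt (2 * pi * tau) by rewrite sqrtr_gt0 !mulr_gt0// pi_gt0.
have -> : tau^-1 * pi *+ 2 = (2 * pi * tau) * (tau^-1) ^+ 2.
  by rewrite -mulr_natr; field; rewrite gt_eqF.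
rewrite sqrtrM ?mulr_ge0 ?pi_ge0 ?(ltW t0)// sqrtr_sqr ger0_norm ?invr_ge0 ?(ltW t0)//.
rewrite -[LHS](mulfK (negbT (gt_eqF h1))); congr (_ / _).
set q := Num.sqrt _ in h1 *.
have -> : q / tau / 2 * q = q ^+ 2 / tau / 2 by ring.
rewrite sqr_sqrtr ?mulr_ge0 ?pi_ge0 ?(ltW t0)//.
by field; rewrite gt_eqF.
Qed.

(** Dominated convergence in the inversion integral at scale [sg n]; index n stands for n + 1
    summands. The assumed bounds on c and s have the numerator 1 + xi^2 precisely in order to cancel
    the denominator in [AC] and [BC]: what remains is at most C / (1 + kappa eta^2), whatever n is.
    In the limit A and B are evaluated at 0, against a Gaussian and against 0. *)
Lemma local_limit (W S : nat -> T -> R) (tau kappa : R) : 0 < tau -> 0 < kappa ->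
  (forall n, measurable_fun setT (S n)) -> (forall n w, 0 <= W n w) ->
  (forall n, P.-integrable setT (EFin \o W n)) ->
  let c n xi := \int[P]_w (W n w * cos (xi * S n w)) in
  let s n xi := \int[P]_w (W n w * sin (xi * S n w)) in
  let sg n := (Num.sqrt n.+1%:R)^-1 in
  (forall n eta, `|c n (sg n * eta)| <= (1 + (sg n * eta) ^+ 2) / (1 + (sg n * eta) ^+ 2 + kappa * eta ^+ 2)) ->
  (forall n eta, `|s n (sg n * eta)| <= (1 + (sg n * eta) ^+ 2) / (1 + (sg n * eta) ^+ 2 + kappa * eta ^+ 2)) ->
  (forall n, measurable_fun setT (c n)) ->
  (forall n, measurable_fun setT (s n)) ->
  (forall eta, c n (sg n * eta) @[n --> \oo] --> expR (- (tau * eta ^+ 2 / 2))) ->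
  (forall eta, s n (sg n * eta) @[n --> \oo] --> (0 : R)) ->
  Num.sqrt n.+1%:R * \int[P]_w (W n w * f (S n w)) @[n --> \oo] --> A 0 / Num.sqrt (2 * pi * tau).
Proof.
move=> t0 k0 mS W0 iW c s sg cb sb mc ms cvc cvs.
have C0 : 0 <= C by have := AC 0; rewrite expr0n addr0 divr1; apply: le_trans.
have q0 n : 0 < Num.sqrt (n.+1%:R : R) by rewrite sqrtr_gt0.
have sg0 n : 0 < sg n by rewrite invr_gt0.
have cvsg : sg n @[n --> \oo] --> (0 : R).
  have -> : sg = (fun n => Num.sqrt (n.+1%:R^-1 : R)) by apply/funext => n; rewrite /sg sqrtrV.
  rewrite -(@sqrtr0 R); apply: continuous_cvg; first exact: sqrt_continuous.
  exact: cvg_harmonicR.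
pose F n (eta : R) := A (sg n * eta) * c n (sg n * eta) + B (sg n * eta) * s n (sg n * eta).
have mcM (g : R -> R) n : measurable_fun setT g -> measurable_fun setT (fun eta : R => g (sg n * eta)).
  by move=> mg; apply: (measurableT_comp (f := g)).
have mF n : measurable_fun setT (F n).
  apply: measurable_funD; apply: measurable_funM; apply: mcM => //; exact: continuous_measurable_fun.
have -> : (fun n => Num.sqrt n.+1%:R * \int[P]_w (W n w * f (S n w))) =
    (fun n => pi^-1 * \int[mu]_(eta in `[0, +oo[) F n eta).
  apply/funext => n; rewrite (expectation_fourier (sg0 n) (mS n) (W0 n) (iW n)).
  rewrite mulrA (_ : Num.sqrt n.+1%:R * (sg n / pi) = pi^-1)//.
  by rewrite mulrA divff ?mul1r// lt0r_neq0.
pose g (eta : R) := (C + C) * (1 / (1 + (Num.sqrt kappa * eta) ^+ 2)).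
have kk : 0 < Num.sqrt kappa by rewrite sqrtr_gt0.
have ig : mu.-integrable `[0, +oo[ (EFin \o g).
  have i0 : mu.-integrable `[0, +oo[ (EFin \o (fun y : R => 1 / (1 + (Num.sqrt kappa * y) ^+ 2))).
    by apply: integrableS (integrable_inv1Dsqr kk).
  exact: (@RintegrableZl _ _ _ mu _ (measurable_itv _) (C + C) _ i0).
have Fg n eta : `|F n eta| <= g eta.
  rewrite /g mulrDl (le_trans (ler_normD _ _))// !normrM.
  have key : C / (1 + (sg n * eta) ^+ 2) *
     ((1 + (sg n * eta) ^+ 2) / (1 + (sg n * eta) ^+ 2 + kappa * eta ^+ 2)) <=
     C * (1 / (1 + (Num.sqrt kappa * eta) ^+ 2)).
    have h1 : 0 < 1 + (sg n * eta) ^+ 2 by rewrite ltr_pwDl ?sqr_ge0.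
    rewrite mulrA divfK ?lt0r_neq0// mul1r ler_wpM2l// [(Num.sqrt kappa * eta) ^+ 2]exprMn sqr_sqrtr ?(ltW k0)//.
    have ke : 0 <= kappa * eta ^+ 2 by rewrite mulr_ge0 ?sqr_ge0// ltW.
    rewrite lef_pV2 ?posrE; [|exact: ltr_wpDr|exact: ltr_wpDr].
    by rewrite lerD2r lerDl sqr_ge0.
  by apply: lerD; apply: le_trans key; apply: ler_pM => //; rewrite ?AC ?BC.
have lim (eta : R) : F n eta @[n --> \oo] --> A 0 * expR (- (tau * eta ^+ 2 / 2)).
  have cvse : sg n * eta @[n --> \oo] --> (0 : R).
    by rewrite -(mul0r eta); apply: cvgMl.
  rewrite -[X in _ --> X]addr0 -[X in _ --> _ + X](mulr0 (B 0)).
  apply: cvgD; apply: cvgM => //.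
    by apply: continuous_cvg => //; exact: cA.
  by apply: continuous_cvg => //; exact: cB.
have [||||_ cv] // := @Rdominated_convergence _ _ _ mu `[0, +oo[%classic
    F (fun eta => A 0 * expR (- (tau * eta ^+ 2 / 2))) g _ _ _ ig _.
  by move=> n; exact: measurable_funTS (mF n).
have cgauss : continuous (fun y : R => expR (- (tau * y ^+ 2 / 2))).
  move=> y; apply: continuous_cvg; first exact: continuous_expR.
  by apply: cvgN; apply: cvgMl; apply: cvgMr; exact: exprn_continuous.
have -> : A 0 / Num.sqrt (2 * pi * tau) =
    pi^-1 * \int[mu]_(eta in `[0, +oo[) (A 0 * expR (- (tau * eta ^+ 2 / 2))).
  rewrite RintegralZl//; last first.
    have t2 : 0 < Num.sqrt (tau / 2) by rewrite sqrtr_gt0 divr_gt0.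
    have i0 : mu.-integrable `[0, +oo[ (EFin \o (fun y : R => 1 / (1 + (Num.sqrt (tau / 2) * y) ^+ 2))).
      by apply: integrableS (integrable_inv1Dsqr t2).
    apply: (@integrable_dominated _ _ _ mu _ _ _ 1) i0 _ _ => //.
      by apply: measurable_funTS; apply: continuous_measurable_fun; exact: cgauss.
    move=> y _; rewrite mul1r ger0_norm ?expR_ge0// exprMn sqr_sqrtr ?divr_ge0 ?(ltW t0)//.
    have ty : 0 <= tau / 2 * y ^+ 2 by rewrite mulr_ge0 ?sqr_ge0// divr_ge0// ltW.
    rewrite expRN mul1r lef_pV2 ?posrE ?expR_gt0 ?ltr_wpDr//.
    by rewrite mulrAC expR_ge1Dx.
  rewrite Rintegral_gauss_half// mulrCA; congr (_ * _).
  by rewrite mulrA mulVf ?mul1r// lt0r_neq0 ?pi_gt0.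
exact: cvgMr.
Qed.

End local_limit.

(** * Continuous test functions with explicit transforms *)

Section test_function.
Context {R : realType}.
Notation mu := (@lebesgue_measure R).
Variables (s b : R).
Hypotheses (s0 : 0 < s) (sb : s < b).

Let b0 : 0 < b. Proof. exact: lt_trans sb. Qed.

(* Vanishes on the negative half-line; being continuous there at 0, unlike
   e^{-s x} 1_{x >= 0}, it has an integrable Fourier transform. *)
Definition expdiff (x : R) : R :=
  expR (- (s * Num.max x 0)) - expR (- (b * Num.max x 0)).

Definition expdiff_cos (xi : R) : R := s / (s ^+ 2 + xi ^+ 2) - b / (b ^+ 2 + xi ^+ 2).
Definition expdiff_sin (xi : R) : R := xi / (s ^+ 2 + xi ^+ 2) - xi / (b ^+ 2 + xi ^+ 2).

Lemma continuous_expdiff : continuous expdiff.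
Proof.
move=> x.
have cm : (fun y : R => Num.max y 0) y @[y --> x] --> Num.max x 0.
  by apply: (@continuous_max _ _ (fun y : R => y) (cst 0)); [exact: cvg_id|exact: cvg_cst].
by apply: cvgB; apply: continuous_cvg; try exact: continuous_expR; apply: cvgN; exact: cvgMr.
Qed.

Lemma expRNM_lipschitz (k u v : R) : 0 <= k -> 0 <= u -> u <= v ->
  `|expR (- (k * v)) - expR (- (k * u))| <= k * (v - u).
Proof.
move=> k0 u0 uv; rewrite distrC ger0_norm; last first.
  by rewrite subr_ge0 ler_expR lerN2 ler_wpM2l.
have -> : expR (- (k * v)) = expR (- (k * u)) * expR (- (k * (v - u))).
  by rewrite -expRD; congr expR; ring.
rewrite -{1}[expR (- (k * u))]mulr1 -mulrBr.
apply: (@le_trans _ _ (1 * (1 - expR (- (k * (v - u)))))).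
  apply: ler_wpM2r; last by rewrite -expR0 ler_expR oppr_le0 mulr_ge0.
  by rewrite subr_ge0 -expR0 ler_expR oppr_le0 mulr_ge0// subr_ge0.
rewrite mul1r lerBlDr addrC -lerBlDr.
exact: expR_ge1Dx.
Qed.

Lemma expdiff_lipschitz (x y : R) : `|expdiff y - expdiff x| <= (s + b) * `|y - x|.
Proof.
wlog xy : x y / x <= y.
  move=> H; have [/H//|/ltW/H] := leP x y.
  by rewrite distrC [X in _ <= _ * X -> _]distrC.
have m0 z : 0 <= Num.max z 0 :> R by rewrite le_max lexx orbT.
have mm : Num.max x 0 <= Num.max y 0.
  by rewrite ge_max !le_max xy lexx orbT.
have md : Num.max y 0 - Num.max x 0 <= y - x.
  have [hx|hx] := leP x 0; have [hy|hy] := leP y 0; rewrite ?subrr ?subr0 ?subr_ge0//; lra.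
rewrite (ger0_norm (_ : 0 <= y - x)) ?subr_ge0//.
rewrite /expdiff.
have -> : forall p q u v : R, p - q - (u - v) = (p - u) - (q - v) by move=> *; ring.
rewrite (le_trans (ler_normB _ _))// mulrDl lerD//.
  apply: (le_trans (expRNM_lipschitz (ltW s0) (m0 x) mm)).
  by rewrite ler_wpM2l// ltW.
apply: (le_trans (expRNM_lipschitz (ltW b0) (m0 x) mm)).
by rewrite ler_wpM2l// ltW.
Qed.

Lemma expdiff_ge0 x : 0 <= expdiff x.
Proof.
rewrite subr_ge0 ler_expR lerN2 ler_wpM2r ?(ltW sb)//.
by rewrite le_max lexx orbT.
Qed.

Lemma expdiff_le_expR x : 0 <= x -> expdiff x <= expR (- (s * x)).
Proof. by move=> x0; rewrite /expdiff max_l// gerBl expR_ge0. Qed.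

Lemma expdiff_bounded x : `|expdiff x| <= 1.
Proof.
rewrite ger0_norm ?expdiff_ge0// (@le_trans _ _ (expR (- (s * Num.max x 0))))//.
  by rewrite gerBl expR_ge0.
by rewrite -expR0 ler_expR oppr_le0 mulr_ge0 ?(ltW s0)// le_max lexx orbT.
Qed.

Lemma expdiff_lt0 x : x < 0 -> expdiff x = 0.
Proof. by move=> x0; rewrite /expdiff max_r ?(ltW x0)// !mulr0 subrr. Qed.

Lemma expdiffM_patch (g : R -> R) :
  (fun x => expdiff x * g x) =
  (fun x => expR (- (s * x)) * g x - expR (- (b * x)) * g x) \_ `[0, +oo[.
Proof.
apply/funext => x; rewrite /patch; case: ifPn.
  by rewrite inE/= in_itv/= andbT => x0; rewrite /expdiff max_l// mulrBl.
rewrite notin_setE/= in_itv/= andbT => /negP; rewrite -ltNge => x0.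
by rewrite expdiff_lt0// mul0r.
Qed.

Lemma integrable_expdiff : mu.-integrable setT (EFin \o expdiff).
Proof.
have -> : expdiff = (fun x => expdiff x * cst 1 x) by apply/funext => x; rewrite mulr1.
rewrite expdiffM_patch -restrict_EFin.
apply: (@integrable_mkcond _ _ _ mu `[0, +oo[%classic _ (measurable_itv _)).1.
rewrite (_ : (fun x : R => expR (- (s * x)) * cst 1 x - expR (- (b * x)) * cst 1 x) =
  (fun x : R => expR (- (s * x)) - expR (- (b * x)))); last by apply/funext => x; rewrite !mulr1.
apply: (@RintegrableB _ _ _ mu _ (measurable_itv _) _ _); exact: integrable_expRNM.
Qed.

Lemma Rintegral_expdiff_cos xi : \int[mu]_y (expdiff y * cos (xi * y)) = expdiff_cos xi.
Proof.
rewrite (expdiffM_patch (fun y => cos (xi * y))) -Rintegral_mkcond.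
rewrite RintegralB//; [|exact: integrable_expRNM_cos|exact: integrable_expRNM_cos].
by rewrite !Rintegral_expRNM_cos.
Qed.

Lemma Rintegral_expdiff_sin xi : \int[mu]_y (expdiff y * sin (xi * y)) = expdiff_sin xi.
Proof.
rewrite (expdiffM_patch (fun y => sin (xi * y))) -Rintegral_mkcond.
rewrite RintegralB//; [|exact: integrable_expRNM_sin|exact: integrable_expRNM_sin].
by rewrite !Rintegral_expRNM_sin.
Qed.

Let cinv (k : R) : 0 < k -> continuous (fun xi : R => (k ^+ 2 + xi ^+ 2)^-1).
Proof.
move=> k0 xi; apply: cvgV; first by rewrite gt_eqF// poisson_den_gt0.
by apply: cvgD; [exact: cvg_cst|exact: exprn_continuous].
Qed.

Lemma continuous_expdiff_cos : continuous expdiff_cos.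
Proof. by move=> xi; apply: cvgB; apply: cvgMr; exact: cinv. Qed.

Lemma continuous_expdiff_sin : continuous expdiff_sin.
Proof. by move=> xi; apply: cvgB; apply: cvgM; try exact: cvg_id; exact: cinv. Qed.

(** A common constant for both transforms: the first two summands bound [expdiff_cos], the last one
    bounds [expdiff_sin]. *)
Definition expdiff_decay : R := (s + s^-1) + (b + b^-1) + b * (1 + (s^-1) ^+ 2).

Lemma poisson_den_decay (k xi : R) : 0 < k -> k / (k ^+ 2 + xi ^+ 2) <= (k + k^-1) / (1 + xi ^+ 2).
Proof.
move=> k0; have p0 := poisson_den_gt0 xi k0.
rewrite ler_pdivrMr// mulrAC ler_pdivlMr ?ltr_pwDl ?sqr_ge0//.
rewrite -subr_ge0.
have -> : (k + k^-1) * (k ^+ 2 + xi ^+ 2) - k * (1 + xi ^+ 2) = k ^+ 3 + k^-1 * xi ^+ 2.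
  by field; rewrite gt_eqF.
by rewrite addr_ge0 ?exprn_ge0 ?(ltW k0)// mulr_ge0 ?sqr_ge0// invr_ge0 ltW.
Qed.

Let den1 xi : 0 < 1 + xi ^+ 2 :> R. Proof. by rewrite ltr_pwDl ?sqr_ge0. Qed.

Lemma expdiff_cos_decay xi : `|expdiff_cos xi| <= expdiff_decay / (1 + xi ^+ 2).
Proof.
rewrite (le_trans (ler_normB _ _))// !ger0_norm ?divr_ge0 ?(ltW (poisson_den_gt0 _ _)) ?(ltW s0) ?(ltW b0)//.
rewrite /expdiff_decay 2!mulrDl -[leLHS]addr0 lerD//.
  by rewrite lerD// poisson_den_decay.
by rewrite divr_ge0 ?(ltW (den1 _))// mulr_ge0 ?(ltW b0)// addr_ge0 ?sqr_ge0.
Qed.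

(** Each of the two terms is only of order 1 / xi, the trace of a jump at 0; in the difference these
    leading terms cancel, which is what continuity of [expdiff] buys. *)
Lemma expdiff_sin_decay xi : `|expdiff_sin xi| <= expdiff_decay / (1 + xi ^+ 2).
Proof.
have ps := poisson_den_gt0 xi s0; have pb := poisson_den_gt0 xi b0.
have -> : expdiff_sin xi = (b ^+ 2 - s ^+ 2) * xi / ((s ^+ 2 + xi ^+ 2) * (b ^+ 2 + xi ^+ 2)).
  by rewrite /expdiff_sin; field; rewrite !gt_eqF.
apply: (@le_trans _ _ (b / (s ^+ 2 + xi ^+ 2))).
  rewrite normrM normfV (gtr0_norm (mulr_gt0 ps pb)) invfM mulrCA [leRHS]mulrC ler_wpM2l ?invr_ge0 ?(ltW ps)//.
  rewrite ler_pdivrMr// normrM ger0_norm; last by rewrite subr_ge0 ler_pXn2r ?nnegrE ?(ltW sb) ?(ltW s0) ?(ltW b0).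
  have x2 : xi ^+ 2 = `|xi| ^+ 2 by rewrite real_normK// num_real.
  rewrite x2; set z := `|xi|; have z0 : 0 <= z by exact: normr_ge0.
  have h : b * (2 * (b * z)) <= b * (2 * (b ^+ 2 + z ^+ 2)).
    by rewrite ler_pM2l//; have := sqr_ge0 (b - z); have := sqr_ge0 b; have := sqr_ge0 z; nra.
  have : 0 <= s ^+ 2 * z by rewrite mulr_ge0 ?sqr_ge0.
  nra.
apply: (@le_trans _ _ (b * (1 + (s^-1) ^+ 2) / (1 + xi ^+ 2))).
  rewrite -mulrA ler_wpM2l ?(ltW b0)// ler_pdivlMr// mulrC ler_pdivrMr//.
  rewrite -subr_ge0.
  have -> : (1 + s^-1 ^+ 2) * (s ^+ 2 + xi ^+ 2) - (1 + xi ^+ 2) = s ^+ 2 + (s^-1) ^+ 2 * xi ^+ 2.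
    by field; rewrite gt_eqF.
  by rewrite addr_ge0 ?sqr_ge0// mulr_ge0 ?sqr_ge0.
rewrite ler_wpM2r ?invr_ge0 ?(ltW (den1 _))// /expdiff_decay lerDr !addr_ge0 ?invr_ge0 ?(ltW s0) ?(ltW b0)//.
Qed.

Lemma expdiff_cos0 : expdiff_cos 0 = s^-1 - b^-1.
Proof. by rewrite /expdiff_cos expr0n !addr0; field; rewrite !gt_eqF. Qed.

(** The upper half of the squeeze. [expdiff] vanishes at 0 and cannot dominate the exponential
    there, but after a shift by delta the factor 1 - e^{-(b - s)(x + delta)} is at least its value
    at x = 0, and dividing by that value is enough. *)
Lemma expR_le_expdiff_shift (delta x : R) : 0 < delta -> 0 <= x ->
  expR (- (s * x)) <= expR (s * delta) / (1 - expR (- ((b - s) * delta))) * expdiff (x + delta).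
Proof.
move=> d0 x0; have q0 : 0 < 1 - expR (- ((b - s) * delta)).
  by rewrite subr_gt0 -expR0 ltr_expR oppr_lt0 mulr_gt0// subr_gt0.
rewrite mulrAC ler_pdivlMr// /expdiff max_l ?addr_ge0 ?(ltW d0)//.
have -> : expR (- (s * (x + delta))) - expR (- (b * (x + delta))) =
   expR (- (s * x)) * expR (- (s * delta)) * (1 - expR (- ((b - s) * delta)) * expR (- ((b - s) * x))).
  rewrite mulrBr mulr1 -!expRD; congr (expR _ - expR _); ring.
have e1 : expR (s * delta) * expR (- (s * delta)) = 1 by rewrite -expRD addrN expR0.
set u := expR (s * delta) in e1 *; set v := expR (- (s * delta)) in e1 *.
rewrite [leRHS](_ : _ = (u * v) * (expR (- (s * x)) *
  (1 - expR (- ((b - s) * delta)) * expR (- ((b - s) * x))))); last by ring.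
rewrite e1 mul1r ler_wpM2l ?expR_ge0//.
rewrite lerD2l lerN2 ler_piMr ?expR_ge0// -expR0 ler_expR oppr_le0 mulr_ge0//.
by rewrite subr_ge0 ltW.
Qed.

End test_function.

Lemma squeeze_family_cvgr (R : realType) (u : nat -> R) (l r : nat -> nat -> R) (l' r' : nat -> R) (a : R) :
  (forall k n, l k n <= u n <= r k n) ->
  (forall k, l k n @[n --> \oo] --> l' k) -> (forall k, r k n @[n --> \oo] --> r' k) ->
  l' k @[k --> \oo] --> a -> r' k @[k --> \oo] --> a -> u n @[n --> \oo] --> a.
Proof.
move=> lur cl cr cl' cr'.
apply/cvgrPdist_lt => e e0; have e2 : 0 < e / 2 by rewrite divr_gt0.
near \oo => k.
have hl : `|a - l' k| < e / 2.
  by near: k; move/cvgrPdist_lt : cl' => /(_ _ e2).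
have hr : `|a - r' k| < e / 2.
  by near: k; move/cvgrPdist_lt : cr' => /(_ _ e2).
near=> n.
have hln : `|l' k - l k n| < e / 2.
  by near: n; move/cvgrPdist_lt : (cl k) => /(_ _ e2).
have hrn : `|r' k - r k n| < e / 2.
  by near: n; move/cvgrPdist_lt : (cr k) => /(_ _ e2).
have /andP[] := lur k n.
move: hl hr hln hrn; rewrite !ltr_distl => /andP[? ?] /andP[? ?] /andP[? ?] /andP[? ?] ? ?.
by apply/andP; split; lra.
Unshelve. all: by end_near. Qed.

Definition exphalf (R : realType) (s x : R) : R := if 0 <= x then expR (- (s * x)) else 0.

Lemma cvg_inv_sqrt (R : realType) : (Num.sqrt n.+1%:R)^-1 @[n --> \oo] --> (0 : R).
Proof.
have -> : (fun n => (Num.sqrt n.+1%:R)^-1) = (fun n => Num.sqrt (n.+1%:R^-1 : R)).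
  by apply/funext => n; rewrite sqrtrV.
rewrite -(@sqrtr0 R); apply: continuous_cvg; first exact: sqrt_continuous.
exact: cvg_harmonicR.
Qed.

(** * Local limit theorem for the one-sided exponential *)

Section exponential_local_limit.
Context {R : realType} d (T : measurableType d) (P : probability T R).
Variables (W S : nat -> T -> R) (tau kappa : R).
Hypotheses (tau_gt0 : 0 < tau) (kappa_gt0 : 0 < kappa).
Hypothesis mS : forall n, measurable_fun setT (S n).
Hypothesis W_ge0 : forall n w, 0 <= W n w.
Hypothesis iW : forall n, P.-integrable setT (EFin \o W n).

(* The weights W n tilt the law of S n, whose characteristic function under the
   tilted law is c n + i s n. *)
Let c n xi := \int[P]_w (W n w * cos (xi * S n w)).
Let s n xi := \int[P]_w (W n w * sin (xi * S n w)).
Let sg n : R := (Num.sqrt n.+1%:R)^-1.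

Hypothesis cs_le : forall n eta, c n (sg n * eta) ^+ 2 + s n (sg n * eta) ^+ 2 <=
   ((1 + (sg n * eta) ^+ 2) / (1 + (sg n * eta) ^+ 2 + kappa * eta ^+ 2)) ^+ 2.
Hypothesis mc : forall n, measurable_fun setT (c n).
Hypothesis ms : forall n, measurable_fun setT (s n).
Hypothesis cvc : forall eta, c n (sg n * eta) @[n --> \oo] --> expR (- (tau * eta ^+ 2 / 2)).
Hypothesis cvs : forall eta, s n (sg n * eta) @[n --> \oo] --> (0 : R).

Let cvsg : sg n @[n --> \oo] --> (0 : R).
Proof. exact: cvg_inv_sqrt. Qed.

Let ic (g : R -> R) n : continuous g -> (forall v, `|g v| <= 1) ->
  P.-integrable setT (EFin \o (fun w => W n w * g (S n w))).
Proof.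
move=> cg g1; apply: (integrable_dominated (C := 1)) (iW n) _ _ => //.
  apply: measurable_funM; first exact/measurable_EFinP/(measurable_int P).
  apply: (measurableT_comp (f := g)) => //.
  exact: continuous_measurable_fun.
by move=> w _; rewrite mul1r normrM (ger0_norm (W_ge0 n w)) ler_piMr.
Qed.

Let icc n xi := ic n (continuous_cosM (xi := xi)) (fun v => cos_max _).
Let ics n xi := ic n (continuous_sinM (xi := xi)) (fun v => sin_max _).

Let cos_shift n delta xi : \int[P]_w (W n w * cos (xi * (S n w + delta))) =
  c n xi * cos (xi * delta) - s n xi * sin (xi * delta).
Proof.
rewrite -(RintegralZr _ measurableT (icc n xi)) -(RintegralZr _ measurableT (ics n xi)).
rewrite -(RintegralB measurableT (RintegrableZr measurableT _ (icc n xi)) (RintegrableZr measurableT _ (ics n xi))).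
by apply: eq_Rintegral => w _; rewrite mulrDr cosD; ring.
Qed.

Let sin_shift n delta xi : \int[P]_w (W n w * sin (xi * (S n w + delta))) =
  s n xi * cos (xi * delta) + c n xi * sin (xi * delta).
Proof.
rewrite -(RintegralZr _ measurableT (icc n xi)) -(RintegralZr _ measurableT (ics n xi)).
rewrite -(RintegralD measurableT (RintegrableZr measurableT _ (ics n xi)) (RintegrableZr measurableT _ (icc n xi))).
by apply: eq_Rintegral => w _; rewrite mulrDr sinD; ring.
Qed.

(** Shifting [S n] by delta multiplies the characteristic function by e^{i xi delta}. This rotation
    preserves the modulus, which is why [cs_le] bounds the sum of squares instead of c and s
    separately; at the scale [sg n] its angle tends to 0, so the limits do not change. *)
Lemma expdiff_local_limit (k b delta : R) : 0 < k -> k < b ->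
  Num.sqrt n.+1%:R * \int[P]_w (W n w * expdiff k b (S n w + delta)) @[n --> \oo] -->
  (k^-1 - b^-1) / Num.sqrt (2 * pi * tau).
Proof.
move=> k0 kb; rewrite -(expdiff_cos0 k0 kb).
have ceq n : (fun xi => \int[P]_w (W n w * cos (xi * (S n w + delta)))) =
   (fun xi => c n xi * cos (xi * delta) - s n xi * sin (xi * delta)).
  by apply/funext => xi; exact: cos_shift.
have seq n : (fun xi => \int[P]_w (W n w * sin (xi * (S n w + delta)))) =
   (fun xi => s n xi * cos (xi * delta) + c n xi * sin (xi * delta)).
  by apply/funext => xi; exact: sin_shift.
have mcosd : measurable_fun setT (fun xi : R => cos (xi * delta)).
  apply: continuous_measurable_fun => x.
  by apply: continuous_comp; [apply: cvgMl; exact: cvg_id|exact: continuous_cos].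
have msind : measurable_fun setT (fun xi : R => sin (xi * delta)).
  apply: continuous_measurable_fun => x.
  by apply: continuous_comp; [apply: cvgMl; exact: cvg_id|exact: continuous_sin].
have cvd (eta : R) : sg n * eta * delta @[n --> \oo] --> (0 : R).
  by rewrite -(mul0r delta) -(mul0r eta); apply: cvgMl; apply: cvgMl.
have cvcos (eta : R) : cos (sg n * eta * delta) @[n --> \oo] --> (1 : R).
  by rewrite -(@cos0 R); apply: continuous_cvg => //; exact: continuous_cos.
have cvsin (eta : R) : sin (sg n * eta * delta) @[n --> \oo] --> (0 : R).
  by rewrite -(@sin0 R); apply: continuous_cvg => //; exact: continuous_sin.
have B0 n eta : 0 <= (1 + (sg n * eta) ^+ 2) / (1 + (sg n * eta) ^+ 2 + kappa * eta ^+ 2).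
  have h : 0 <= kappa * eta ^+ 2 by rewrite mulr_ge0 ?sqr_ge0// ltW.
  by rewrite divr_ge0// !addr_ge0 ?sqr_ge0.
have rot n eta : let x := sg n * eta in
  (c n x * cos (x * delta) - s n x * sin (x * delta)) ^+ 2 +
  (s n x * cos (x * delta) + c n x * sin (x * delta)) ^+ 2 <=
   ((1 + (sg n * eta) ^+ 2) / (1 + (sg n * eta) ^+ 2 + kappa * eta ^+ 2)) ^+ 2.
  rewrite /=; apply: le_trans (cs_le n eta).
  have := cos2Dsin2 (sg n * eta * delta).
  set u := cos _; set v := sin _; set p := c n _; set q := s n _ => uv.
  rewrite [leLHS](_ : _ = (p ^+ 2 + q ^+ 2) * (u ^+ 2 + v ^+ 2)); last by ring.
  by rewrite uv mulr1.
have habs (x y : R) : 0 <= y -> x ^+ 2 <= y ^+ 2 -> `|x| <= y.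
  by move=> y0 xy; rewrite -ler_sqr ?nnegrE// real_normK ?num_real.
refine (@local_limit _ (expdiff k b) (expdiff_cos k b) (expdiff_sin k b) _ _ _
  (@continuous_expdiff R k b) (integrable_expdiff k0 kb) (expdiff_lipschitz k0 kb) (expdiff_bounded k0 kb)
  (continuous_expdiff_cos k0 kb) (continuous_expdiff_sin k0 kb)
  (Rintegral_expdiff_cos k0 kb) (Rintegral_expdiff_sin k0 kb)
  (expdiff_cos_decay k0 kb) (expdiff_sin_decay k0 kb) _ _ P W (fun n w => S n w + delta) tau kappa tau_gt0 kappa_gt0 _ W_ge0 iW _ _ _ _ _ _).
- by move=> n; apply: measurable_funD.
- move=> n eta; rewrite cos_shift; apply: habs; first exact: B0.
  by apply: le_trans (rot n eta); rewrite /= lerDl sqr_ge0.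
- move=> n eta; rewrite sin_shift; apply: habs; first exact: B0.
  by apply: le_trans (rot n eta); rewrite /= lerDr sqr_ge0.
- by move=> n; rewrite ceq; apply: measurable_funB; apply: measurable_funM.
- by move=> n; rewrite seq; apply: measurable_funD; apply: measurable_funM.
- move=> eta; rewrite (eq_cvg _ _ (fun n => cos_shift n delta (sg n * eta))).
  have -> : expR (- (tau * eta ^+ 2 / 2)) = expR (- (tau * eta ^+ 2 / 2)) * 1 - 0 * 0 by rewrite mulr1 mulr0 subr0.
  by apply: cvgB; apply: cvgM.
- move=> eta; rewrite (eq_cvg _ _ (fun n => sin_shift n delta (sg n * eta))).
  have : s n (sg n * eta) * cos (sg n * eta * delta) +
      c n (sg n * eta) * sin (sg n * eta * delta) @[n --> \oo] -->
      0 * 1 + expR (- (tau * eta ^+ 2 / 2)) * 0.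
    by apply: cvgD; apply: cvgM.
  by rewrite mulr0 mul0r addr0.
Qed.

Lemma exphalf_local_limit (k : R) : 0 < k ->
  Num.sqrt n.+1%:R * \int[P]_w (W n w * exphalf k (S n w)) @[n --> \oo] -->
  k^-1 / Num.sqrt (2 * pi * tau).
Proof.
move=> k0.
(* The shift must vanish while (b - k) delta tends to infinity, so that the factor [K j] tends to 1.
   A quadratic growth of [b j] against delta = 1 / (j + 1) makes that product exactly j + 1. *)
pose delta j : R := j.+1%:R^-1.
pose b j : R := k + j.+1%:R ^+ 2.
have kb j : k < b j by rewrite ltrDl exprn_gt0.
have d0 j : 0 < delta j by rewrite invr_gt0.
pose K j := expR (k * delta j) / (1 - expR (- j.+1%:R)).
have KE j : expR (k * delta j) / (1 - expR (- ((b j - k) * delta j))) = K j.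
  by rewrite /K /b addrAC subrr add0r expr2 mulfK// pnatr_eq0.
have K0 j : 0 <= K j by rewrite divr_ge0 ?expR_ge0// subr_ge0 -expR0 ler_expR oppr_le0.
have cexp j delta' : continuous (fun x => expdiff k (b j) (x + delta')).
  move=> x; apply: (@continuous_comp _ _ _ (fun x : R => x + delta')); last exact: continuous_expdiff.
  by apply: cvgD; [exact: cvg_id|exact: cvg_cst].
have iexp n j delta' := ic n (cexp j delta') (fun v => expdiff_bounded k0 (kb j) (v + delta')).
have mhalf : measurable_fun setT (exphalf k).
  rewrite (_ : exphalf k = (fun x => expR (- (k * x))) \_ `[0, +oo[); last first.
    apply/funext => x; rewrite /exphalf /patch; case: ifPn; case: ifPn => //.
      by rewrite notin_setE/= in_itv/= andbT => /negP/negbTE ->.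
    by rewrite inE/= in_itv/= andbT => ->.
  have me : measurable_fun (`[0, +oo[%classic : set R) (fun x : R => expR (- (k * x))).
    apply: measurable_funTS; apply: continuous_measurable_fun => x.
    by apply: continuous_comp; [apply: cvgN; apply: cvgMr; exact: cvg_id|exact: continuous_expR].
  exact: ((measurable_restrictT _ (measurable_itv _)).1 me).
have half0 x : 0 <= exphalf k x by rewrite /exphalf; case: ifP => // _; exact: expR_ge0.
have half1 x : `|exphalf k x| <= 1.
  rewrite ger0_norm// /exphalf; case: ifP => // x0.
  by rewrite -expR0 ler_expR oppr_le0 mulr_ge0// ltW.
have ihalf n : P.-integrable setT (EFin \o (fun w => W n w * exphalf k (S n w))).
  apply: (integrable_dominated (C := 1)) (iW n) _ _ => //.
    apply: measurable_funM; first exact/measurable_EFinP/(measurable_int P).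
    exact: (measurableT_comp mhalf).
  by move=> w _; rewrite mul1r normrM (ger0_norm (W_ge0 n w)) ler_piMr.
have cvb : (b j)^-1 @[j --> \oo] --> (0 : R).
  apply: (@squeeze_cvgr _ _ _ _ (cst 0) (fun j => j.+1%:R^-1)); last 2 first.
  - exact: cvg_cst.
  - exact: cvg_harmonicR.
  near=> j; rewrite invr_ge0 (ltW (lt_trans k0 (kb j)))/= lef_pV2 ?posrE ?(lt_trans k0 (kb j))//.
  by rewrite /b expr2 ler_wpDl ?(ltW k0)// ler_peMr// ler1n.
have cvL : (k^-1 - (b j)^-1) / Num.sqrt (2 * pi * tau) @[j --> \oo] --> k^-1 / Num.sqrt (2 * pi * tau).
  by apply: cvgMl; rewrite -[X in _ --> X]subr0; apply: cvgB => //; exact: cvg_cst.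
have cve : expR (- j.+1%:R) @[j --> \oo] --> (0 : R).
  apply: (@squeeze_cvgr _ _ _ _ (cst 0) (fun j => j.+1%:R^-1)); last 2 first.
  - exact: cvg_cst.
  - exact: cvg_harmonicR.
  near=> j; rewrite expR_ge0/= expRN lef_pV2 ?posrE ?expR_gt0//.
  by rewrite (le_trans _ (expR_ge1Dx _))// lerDr.
have cvK : K j @[j --> \oo] --> (1 : R).
  rewrite -[X in _ --> X]mulr1; apply: cvgM.
    have l0 : k * delta j @[j --> \oo] --> (k * 0 : R) by apply: cvgMr; exact: cvg_harmonicR.
    have := continuous_cvg _ (@continuous_expR R _) l0.
    by rewrite mulr0 expR0; exact.
  rewrite -[X in _ --> X]invr1; apply: cvgV; first exact: oner_neq0.
  by rewrite -[X in _ --> X]subr0; apply: cvgB => //; exact: cvg_cst.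
apply: (@squeeze_family_cvgr _ _
  (fun j n => Num.sqrt n.+1%:R * \int[P]_w (W n w * expdiff k (b j) (S n w + 0)))
  (fun j n => K j * (Num.sqrt n.+1%:R * \int[P]_w (W n w * expdiff k (b j) (S n w + delta j))))
  (fun j => (k^-1 - (b j)^-1) / Num.sqrt (2 * pi * tau))
  (fun j => K j * ((k^-1 - (b j)^-1) / Num.sqrt (2 * pi * tau)))).
- move=> j n; apply/andP; split.
    rewrite ler_wpM2l ?sqrtr_ge0// le_Rintegral// => w _.
    rewrite ler_wpM2l// addr0 /exphalf; case: ifPn => x0.
      exact: expdiff_le_expR.
    by rewrite expdiff_lt0// ltNge.
  rewrite mulrCA ler_wpM2l ?sqrtr_ge0// -RintegralZl// le_Rintegral//.
    exact: (RintegrableZl measurableT).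
  move=> w _; rewrite mulrCA ler_wpM2l// /exphalf; case: ifPn => x0.
    by rewrite -KE; exact: expR_le_expdiff_shift.
  by rewrite mulr_ge0// expdiff_ge0.
- by move=> j; exact: expdiff_local_limit.
- by move=> j; apply: cvgMr; exact: expdiff_local_limit.
- exact: cvL.
- by rewrite -[X in _ --> X]mul1r; apply: cvgM.
Unshelve. all: by end_near. Qed.

End exponential_local_limit.

(** * Independence *)

Lemma finite_measure_prod_unique d1 d2 (T1 : measurableType d1) (T2 : measurableType d2)
    (R : realType) (m1 m2 : {measure set (T1 * T2) -> \bar R}) :
  (m1 setT < +oo)%E ->
  (forall A B, measurable A -> measurable B -> m1 (A `*` B) = m2 (A `*` B)) ->
  forall C, measurable C -> m1 C = m2 C.
Proof.
move=> m1oo m12 C mC.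
pose G : set (set (T1 * T2)) := [set C | exists A, measurable A /\ exists B, measurable B /\ C = A `*` B].
apply: (measure_unique G (fun _ => setT)) => //.
- rewrite measurable_prod_measurableType//; congr (<<s _ >>).
  rewrite predeqE; split => [[A mA [B mB <-]]|[A [mA [B [mB ->]]]]].
    by exists A; split => //; exists B.
  by exists A => //; exists B.
- move=> _ _ [X1 [mX1 [X2 [mX2 ->]]]] [Y1 [mY1 [Y2 [mY2 ->]]]].
  rewrite -setXI; exists (X1 `&` Y1); split; first exact: measurableI.
  by exists (X2 `&` Y2); split => //; exact: measurableI.
- by move=> _; exists setT; split => //; exists setT; split => //; rewrite setXTT.
- by rewrite bigcup_const.
- by move=> _ [A [mA [B [mB ->]]]]; exact: m12.
Qed.

Lemma same_law_integral d1 d2 (T1 : measurableType d1) (T2 : measurableType d2) (R : realType)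
    (P1 : probability T1 R) (P2 : probability T2 R) (U : {RV P1 >-> R}) (V : {RV P2 >-> R})
    (g : R -> R) :
  same_law (distribution P1 U) (distribution P2 V) -> measurable_fun setT g ->
  P2.-integrable setT (EFin \o (g \o V)) ->
  P1.-integrable setT (EFin \o (g \o U)) /\ \int[P1]_w g (U w) = \int[P2]_w g (V w).
Proof.
move=> UV mg ig.
have mU : measurable_fun setT U by exact: measurable_funP.
have iU : P1.-integrable setT (EFin \o (g \o U)).
  apply/integrableP; split; first by apply/measurable_EFinP; exact: measurableT_comp.
  rewrite -(@ge0_integral_distribution _ _ _ _ _ P1 U (fun x => `|(g x)%:E|%E))//; last first.
    by apply: measurableT_comp => //; exact/measurable_EFinP.
  rewrite (eq_measure_integral (distribution P2 V)); last by move=> A mA _; exact: UV.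
  rewrite ge0_integral_distribution//; first by case/integrableP : ig.
  by apply: measurableT_comp => //; exact/measurable_EFinP.
split => //; rewrite /Rintegral; congr fine.
transitivity (\int[distribution P1 U]_x (g x)%:E)%E.
  by rewrite (@integral_distribution _ _ _ _ _ P1 U (EFin \o g))//; exact/measurable_EFinP.
rewrite (eq_measure_integral (distribution P2 V)); last by move=> A mA _; exact: UV.
by rewrite (@integral_distribution _ _ _ _ _ P2 V (EFin \o g))//; exact/measurable_EFinP.
Qed.

(** * Joint law of an independent pair *)

Section independent_pair.
Context d (T : measurableType d) (R : realType) (P : probability T R).
Variables U V : {RV P >-> R}.
Hypothesis UV : forall A C, measurable A -> measurable C ->
  P (U @^-1` A `&` V @^-1` C) = (P (U @^-1` A) * P (V @^-1` C))%E.

Let UVf (w : T) : R * R := (U w, V w).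
Let mUV : measurable_fun setT UVf.
Proof. by apply/measurable_fun_pairP; split; exact: measurable_funP. Qed.
Let pUV : {mfun T >-> (R * R)%type} := HB.pack UVf (isMeasurableFun.Build _ _ _ _ UVf mUV).

Lemma distribution_pairE C : measurable C ->
  distribution P pUV C = (distribution P U \x distribution P V)%E C.
Proof.
move=> mC; apply: finite_measure_prod_unique => //.
  by rewrite /= probability_setT ltry.
move=> A B mA mB; transitivity (distribution P U A * distribution P V B)%E.
  exact: UV.
exact/esym/product_measure1E.
Qed.

Lemma ge0_integral_indep (f : R * R -> \bar R) : measurable_fun setT f -> (forall z, 0 <= f z)%E ->
  (\int[distribution P U \x distribution P V]_z f z = \int[P]_w f (U w, V w))%E.
Proof.
move=> mf f0; transitivity (\int[distribution P pUV]_z f z)%E.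
  by apply: eq_measure_integral => A mA _; exact/esym/distribution_pairE.
by rewrite ge0_integral_distribution.
Qed.

Lemma Rintegral_indepM (g h : R -> R) :
  measurable_fun setT g -> measurable_fun setT h ->
  P.-integrable setT (EFin \o (g \o U)) -> P.-integrable setT (EFin \o (h \o V)) ->
  P.-integrable setT (EFin \o (fun w => g (U w) * h (V w))) /\
  \int[P]_w (g (U w) * h (V w)) = \int[P]_w g (U w) * \int[P]_w h (V w).
Proof.
move=> mg mh ig ih.
have mU : measurable_fun setT U by exact: measurable_funP.
have mV : measurable_fun setT V by exact: measurable_funP.
have ig' : (distribution P U).-integrable setT (EFin \o g).
  by apply: integrable_pushforward => //; exact/measurable_EFinP.
have ih' : (distribution P V).-integrable setT (EFin \o h).
  by apply: integrable_pushforward => //; exact/measurable_EFinP.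
have mgh : measurable_fun setT (fun z : R * R => g z.1 * h z.2).
  apply: measurable_funM.
    by apply: (measurableT_comp mg); exact: measurable_fst.
  by apply: (measurableT_comp mh); exact: measurable_snd.
have fing : (\int[distribution P U]_x `|g x|%:E)%E \is a fin_num.
  rewrite ge0_fin_numE; first by case/integrableP : ig'.
  by apply: integral_ge0 => x _; rewrite lee_fin.
have finh : (\int[distribution P V]_x `|h x|%:E)%E \is a fin_num.
  rewrite ge0_fin_numE; first by case/integrableP : ih'.
  by apply: integral_ge0 => x _; rewrite lee_fin.
have igh : (distribution P U \x distribution P V)%E.-integrable setT
    (fun z : R * R => (g z.1 * h z.2)%:E).
  apply/integrable12ltyP; first exact/measurable_EFinP.
  rewrite [ltLHS](_ : _ = (\int[distribution P U]_x (`|g x|%:E * \int[distribution P V]_y `|h y|%:E))%E).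
    rewrite ge0_integralZr//.
    - by rewrite lte_mul_pinfty// ?ltey_eq ?finh// integral_ge0// => x _; rewrite lee_fin.
    - by apply/measurable_EFinP; exact: measurableT_comp.
    - by apply: integral_ge0 => x _; rewrite lee_fin.
  apply: eq_integral => x _; rewrite -ge0_integralZl//.
  - by apply: eq_integral => y _; rewrite /= normrM EFinM.
  - by apply/measurable_EFinP; exact: measurableT_comp.
have iP : P.-integrable setT (EFin \o (fun w => g (U w) * h (V w))).
  apply/integrableP; split.
    apply/measurable_EFinP; apply: measurable_funM.
      exact: measurableT_comp.
    exact: measurableT_comp.
  have /integrableP[_] := igh.
  rewrite (ge0_integral_indep (f := fun z => `|(g z.1 * h z.2)%:E|%E))//.
  by apply: measurableT_comp => //; exact/measurable_EFinP.
split => //.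
have E1 : (\int[P]_w (g (U w) * h (V w))%:E =
    \int[distribution P U \x distribution P V]_z (g z.1 * h z.2)%:E)%E.
  transitivity (\int[distribution P pUV]_z (g z.1 * h z.2)%:E)%E; last first.
    by apply: eq_measure_integral => A mA _; exact: distribution_pairE.
  rewrite (@integral_distribution _ _ _ _ _ P pUV (fun z => (g z.1 * h z.2)%:E))//.
  exact/measurable_EFinP.
rewrite {1}/Rintegral E1 -integral12_prod_meas1// /fubini_F.
have finih : (\int[distribution P V]_y (h y)%:E)%E \is a fin_num by exact: integrable_fin_num.
have finig : (\int[distribution P U]_y (g y)%:E)%E \is a fin_num by exact: integrable_fin_num.
rewrite (_ : (\int[distribution P U]_x \int[distribution P V]_y (g x * h y)%:E)%E =
  (\int[distribution P U]_x ((g x)%:E * \int[distribution P V]_y (h y)%:E))%E); last first.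
  by apply: eq_integral => x _; rewrite -integralZl//; apply: eq_integral => y _; rewrite EFinM.
rewrite -[in LHS](fineK finih) integralZr// fineM//.
congr (_ * _); congr fine; rewrite ?fineK//.
  by apply: (@integral_distribution _ _ _ _ _ P U (EFin \o g)) => //; exact/measurable_EFinP.
by apply: (@integral_distribution _ _ _ _ _ P V (EFin \o h)) => //; exact/measurable_EFinP.
Qed.

End independent_pair.

(** * Independence of a partial sum from the later variables *)

Section partial_sums.
Context d (T : measurableType d) (R : realType) (P : probability T R).
Variable X : nat -> {RV P >-> R}.

Lemma measurable_total_storage n : measurable_fun setT (total_storage X n).
Proof. by apply: measurable_sum => i; exact: measurable_funP. Qed.

Let Y n : {mfun T >-> R} := HB.pack (total_storage X n)
  (isMeasurableFun.Build _ _ _ _ (total_storage X n) (measurable_total_storage n)).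

Hypothesis X_indep : mutually_independent P (fun i : nat => sigma_rv (X i)).

Let bigcapX (J : {fset nat}) (E : nat -> set T) : (forall j, j \in J -> sigma_rv (X j) (E j)) ->
  measurable (\bigcap_(j in [set` J]) E j).
Proof.
move=> JE; apply: fin_bigcap_measurable => // j /JE [A mA <-].
by rewrite setTI; exact: measurable_funPTI.
Qed.

(** The induction needs independence from every finite family of later events, not only from the
    next variable: passing from m to m + 1 moves [X m] out of the tail and into the sum while the
    remaining events stay. *)
Lemma total_storage_indep_tail m (J : {fset nat}) (E : nat -> set T) (A : set R) :
  (forall j, j \in J -> (m <= j)%N) -> (forall j, j \in J -> sigma_rv (X j) (E j)) ->
  measurable A ->
  P (total_storage X m @^-1` A `&` \bigcap_(j in [set` J]) E j) =
  (P (total_storage X m @^-1` A) * P (\bigcap_(j in [set` J]) E j))%E.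
Proof.
elim: m J E A => [|m IH] J E A Jm JE mA.
  have -> : total_storage X 0 = cst 0 by apply/funext => w; rewrite /total_storage big_ord0.
  rewrite preimage_cst; case: ifPn => _.
    by rewrite setTI probability_setT mul1e.
  by rewrite set0I measure0 mul0e.
set F := \bigcap_(j in _) _.
have mF : measurable F by exact: bigcapX.
have mJ : m \notin J by apply/negP => /Jm; rewrite ltnn.
pose E' (C : set R) j := if j == m then X m @^-1` C else E j.
have E'F C : \bigcap_(j in [set` (m |` J)%fset]) E' C j = X m @^-1` C `&` F.
  apply/seteqP; split => w.
    move=> h; split; first by have := h m; rewrite /E' eqxx; apply; rewrite /= !inE eqxx.
    move=> j /= jJ; have := h j; rewrite /E' ifN; last by apply: contraNneq mJ => <-.
    by apply; rewrite /= !inE jJ orbT.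
  move=> [h1 h2] j /=; rewrite !inE /E' => /orP[/eqP ->|jJ]; first by rewrite eqxx.
  by case: ifPn => [/eqP _ //|_]; exact: h2.
have E'm C : measurable C -> forall j, j \in (m |` J)%fset -> sigma_rv (X j) (E' C j).
  move=> mC j; rewrite !inE /E'; case: ifPn => [/eqP -> _|_ /= jJ].
    by exists C => //; rewrite setTI.
  exact: JE.
have PE' C : measurable C -> P (X m @^-1` C `&` F) = (P (X m @^-1` C) * P F)%E.
  move=> mC; rewrite -E'F X_indep; last exact: E'm.
  rewrite big_fsetU1//= {1}/E' eqxx X_indep//; congr (_ * _)%E.
  by apply: eq_big_seq => j jJ; rewrite /E' ifN//; apply: contraNneq mJ => <-.
have IH' C (B : set R) : measurable B -> measurable C ->
    P (total_storage X m @^-1` B `&` (X m @^-1` C `&` F)) =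
    (P (total_storage X m @^-1` B) * P (X m @^-1` C `&` F))%E.
  move=> mB mC; rewrite -E'F IH//.
    by move=> j; rewrite !inE => /orP[/eqP -> //|/Jm/ltnW].
  exact: E'm.
have IH1 C (B : set R) : measurable B -> measurable C ->
    P (total_storage X m @^-1` B `&` X m @^-1` C) =
    (P (total_storage X m @^-1` B) * P (X m @^-1` C))%E.
  move=> mB mC.
  have e : \bigcap_(j in [set` [fset m]%fset]) (fun=> X m @^-1` C) j = X m @^-1` C.
    by rewrite set_fset1 bigcap_set1.
  rewrite -e IH// => j; rewrite inE => /eqP -> //.
  by exists C => //; rewrite setTI.
pose YX (w : T) : R * R := (total_storage X m w, X m w).
have mYX : measurable_fun setT YX.
  by apply/measurable_fun_pairP; split; [exact: measurable_total_storage|exact: measurable_funP].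
pose pYX : {mfun T >-> (R * R)%type} := HB.pack YX (isMeasurableFun.Build _ _ _ _ YX mYX).
have PF0 : 0 <= fine (P F) by exact: fine_ge0.
pose B : set (R * R) := (fun z => z.1 + z.2) @^-1` A.
have mB : measurable B.
  by rewrite -[B]setTI; apply: measurable_funD.
(* With F fixed, both sides are finite measures of the planar event concerning (Y_m, X_m): one
   restricts P to F, the other scales P by P(F). They agree on rectangles by the induction
   hypothesis, hence on the set [B] where the coordinates sum to an element of A. *)
have := @finite_measure_prod_unique _ _ _ _ R (pushforward (mrestr P mF) pYX)
  (mscale (NngNum PF0) (pushforward P pYX)) _ _ B mB.
move=> /(_ mYX mYX) key.
have -> : total_storage X m.+1 @^-1` A = YX @^-1` B.
  by apply/funext => w; rewrite /B/= /total_storage big_ord_recr.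
apply: (etrans (key _ _)).
- change (P (setT `&` F) < +oo)%E.
  by rewrite setTI (le_lt_trans (probability_le1 P mF))// ltry.
- move=> B1 B2 mB1 mB2;
  change (P ((total_storage X m @^-1` B1 `&` X m @^-1` B2) `&` F) =
    ((fine (P F))%:E * P (total_storage X m @^-1` B1 `&` X m @^-1` B2))%E).
  by rewrite -setIA IH'// PE'// IH1// muleA muleC fineK// fin_num_measure.
- change (((fine (P F))%:E * P (YX @^-1` B))%E = (P (YX @^-1` B) * P F)%E).
  by rewrite muleC fineK// fin_num_measure.
Qed.

Lemma total_storage_indep m (A C : set R) : measurable A -> measurable C ->
  P (total_storage X m @^-1` A `&` X m @^-1` C) =
  (P (total_storage X m @^-1` A) * P (X m @^-1` C))%E.
Proof.
move=> mA mC.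
have e : \bigcap_(j in [set` [fset m]%fset]) (fun=> X m @^-1` C) j = X m @^-1` C.
  by rewrite set_fset1 bigcap_set1.
rewrite -e total_storage_indep_tail// => j; rewrite inE => /eqP -> //.
by exists C => //; rewrite setTI.
Qed.

End partial_sums.

(** * Sums of tilted variables *)

Section trigonometric_bounds.
Context {R : realType}.
Implicit Types (F dF : R -> R) (x : R).

(** The engine of the Taylor inequalities that follow: each is obtained from the previous one, which
    states that its derivative is nonnegative. *)
Lemma ge0_derive_le F dF x : (forall y : R, is_derive y 1 F (dF y)) ->
  (forall y, 0 <= y -> 0 <= dF y) -> 0 <= x -> F 0 <= F x.
Proof.
move=> FdF dF0; rewrite le_eqVlt => /predU1P[<-//|x0].
have cF : {within `[0, x], continuous F}.
  apply: continuous_subspaceT => y.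
  by apply/differentiable_continuous/derivable1_diffP; have [] := FdF y.
have [c] := MVT x0 (fun y _ => FdF y) cF.
rewrite in_itv/= => /andP[c0 _] e.
by rewrite -subr_ge0 e mulr_ge0 ?dF0 ?(ltW c0)// subr_ge0 ltW.
Qed.

Lemma sin_le_id x : 0 <= x -> sin x <= x.
Proof.
move=> x0; rewrite -subr_ge0.
have dF (y : R) : is_derive y 1 (fun y => y - sin y) (1 - cos y) by apply: is_derive_eq.
have := ge0_derive_le (fun y => dF y) _ x0; rewrite sin0 subrr; apply => y _.
by rewrite subr_ge0 cos_le1.
Qed.

Lemma cos_ge_taylor2 x : 0 <= x -> 1 - x ^+ 2 / 2 <= cos x.
Proof.
move=> x0; rewrite -subr_ge0.
have dF (y : R) : is_derive y 1 (fun y => cos y - (1 - y ^+ 2 / 2)) (y - sin y).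
  by apply: is_derive_eq; rewrite /GRing.scale/=; field.
have := ge0_derive_le (fun y => dF y) _ x0; rewrite cos0 expr0n mul0r subr0 subrr; apply => y y0.
by rewrite subr_ge0 sin_le_id.
Qed.

Lemma sin_ge_taylor3 x : 0 <= x -> x - x ^+ 3 / 6 <= sin x.
Proof.
move=> x0; rewrite -subr_ge0.
have dF (y : R) : is_derive y 1 (fun y => sin y - (y - y ^+ 3 / 6)) (cos y - (1 - y ^+ 2 / 2)).
  by apply: is_derive_eq; rewrite /GRing.scale/=; field.
have := ge0_derive_le (fun y => dF y) _ x0; rewrite sin0 expr0n mul0r !subr0; apply => y y0.
by rewrite subr_ge0 cos_ge_taylor2.
Qed.

Lemma cos_le_taylor4 x : 0 <= x -> cos x <= 1 - x ^+ 2 / 2 + x ^+ 4 / 24.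
Proof.
move=> x0; rewrite -subr_ge0.
have dF (y : R) : is_derive y 1 (fun y => 1 - y ^+ 2 / 2 + y ^+ 4 / 24 - cos y) (sin y - (y - y ^+ 3 / 6)).
  by apply: is_derive_eq; rewrite /GRing.scale/=; field.
have := ge0_derive_le (fun y => dF y) _ x0; rewrite cos0 !expr0n !mul0r subr0 addr0 subrr; apply => y y0.
by rewrite subr_ge0 sin_ge_taylor3.
Qed.

Lemma sin_le_taylor5 x : 0 <= x -> sin x <= x - x ^+ 3 / 6 + x ^+ 5 / 120.
Proof.
move=> x0; rewrite -subr_ge0.
have dF (y : R) : is_derive y 1 (fun y => y - y ^+ 3 / 6 + y ^+ 5 / 120 - sin y)
    (1 - y ^+ 2 / 2 + y ^+ 4 / 24 - cos y).
  by apply: is_derive_eq; rewrite /GRing.scale/=; field.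
have := ge0_derive_le (fun y => dF y) _ x0; rewrite sin0 !expr0n !mul0r !subr0 addr0; apply => y y0.
by rewrite subr_ge0 cos_le_taylor4.
Qed.

Lemma sin_sub_id_le x : `|sin x - x| <= `|x| ^+ 3 / 6.
Proof.
wlog x0 : x / 0 <= x.
  move=> H; have [/H//|/ltW x0] := leP 0 x.
  have := H (- x); rewrite oppr_ge0 => /(_ x0).
  by rewrite sinN -opprD !normrN.
rewrite (ger0_norm x0) distrC ger0_norm ?subr_ge0 ?sin_le_id//.
by have := sin_ge_taylor3 x0; lra.
Qed.

Lemma cos_taylor2_le x : `|cos x - (1 - x ^+ 2 / 2)| <= x ^+ 4 / 24.
Proof.
wlog x0 : x / 0 <= x.
  move=> H; have [/H//|/ltW x0] := leP 0 x.
  have := H (- x); rewrite oppr_ge0 => /(_ x0).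
  have e : (- x) ^+ 4 = x ^+ 4 by ring.
  by rewrite cosN sqrrN e.
rewrite ger0_norm; last by rewrite subr_ge0 cos_ge_taylor2.
by have := cos_le_taylor4 x0; lra.
Qed.

(** This is |sin x| / x <= 1 - (2/15) x^2 / (1 + x^2) with denominators cleared. For x < 2 the
    fifth-order term x^5 / 120 is at most x^3 / 30, and 1/6 - 1/30 = 2/15; for x >= 2 the bound |sin
    x| <= 1 is enough. *)
Lemma sinc_bound x : 0 <= x -> `|sin x| * (1 + x ^+ 2) <= x * (1 + x ^+ 2) - 2 / 15 * x ^+ 3.
Proof.
move=> x0; have [x2|x2] := leP 2 x.
  have := sin_max x; set s := `|sin x| => s1.
  have h : s * (1 + x ^+ 2) <= 1 + x ^+ 2.
    by rewrite ler_piMl// addr_ge0 ?sqr_ge0.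
  apply: (le_trans h).
  have : 0 <= (x - 2) * (x ^+ 2) by rewrite mulr_ge0 ?sqr_ge0// subr_ge0.
  have : 0 <= x ^+ 2 by exact: sqr_ge0.
  rewrite (exprSr x 2); nra.
rewrite ger0_norm; last first.
  move: x0; rewrite le_eqVlt => /predU1P[<-|x0]; first by rewrite sin0.
  by apply/ltW/sin2_gt0; rewrite x0 x2.
have h := sin_le_taylor5 x0.
have x2' : 0 <= (2 - x) * (2 + x) by rewrite mulr_ge0// ?subr_ge0 ?addr_ge0// ltW.
have x3 : 0 <= x ^+ 3 by exact: exprn_ge0.
have h2 : sin x <= x - 2 / 15 * x ^+ 3.
  apply: (le_trans h); rewrite (_ : x ^+ 5 = x ^+ 3 * x ^+ 2); last by rewrite -exprD.
  have : x ^+ 3 * x ^+ 2 <= x ^+ 3 * 4 by rewrite ler_wpM2l//; nra.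
  lra.
apply: (@le_trans _ _ ((x - 2 / 15 * x ^+ 3) * (1 + x ^+ 2))).
  by rewrite ler_wpM2r// addr_ge0 ?sqr_ge0.
have : 0 <= x ^+ 3 * x ^+ 2 by rewrite mulr_ge0 ?sqr_ge0.
nra.
Qed.

Lemma normr_exprB_le (u v : R) n : `|u| <= 1 -> `|v| <= 1 -> `|u ^+ n - v ^+ n| <= n%:R * `|u - v|.
Proof.
move=> u1 v1; elim: n => [|n IH]; first by rewrite !expr0 subrr normr0 mul0r.
have -> : u ^+ n.+1 - v ^+ n.+1 = u * (u ^+ n - v ^+ n) + (u - v) * v ^+ n.
  by rewrite !exprS; ring.
rewrite (le_trans (ler_normD _ _))//.
have -> : n.+1%:R * `|u - v| = n%:R * `|u - v| + `|u - v| by rewrite -natr1 mulrDl mul1r.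
apply: lerD.
  rewrite normrM (le_trans _ IH)// ler_piMl//.
by rewrite normrM ler_piMr// normrX exprn_ile1.
Qed.

Lemma expRN_taylor1_le x : 0 <= x -> `|expR (- x) - (1 - x)| <= x ^+ 2.
Proof.
move=> x0; rewrite ger0_norm; last by rewrite subr_ge0; exact: expR_ge1Dx.
have x1 : 0 < 1 + x by rewrite ltr_pwDl.
rewrite lerBlDr expRN (@le_trans _ _ (1 + x)^-1)//.
  by rewrite lef_pV2 ?posrE ?expR_gt0// expR_ge1Dx.
rewrite -div1r ler_pdivrMr//.
have : 0 <= x ^+ 3 by exact: exprn_ge0.
rewrite (exprS x 2); nra.
Qed.

End trigonometric_bounds.

(** * Characteristic function of the tilted sum *)

Section tilted_sums.
Context d (T : measurableType d) (R : realType) (P : probability T R).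
Variable X : nat -> {RV P >-> R}.
Hypothesis X_indep : mutually_independent P (fun i : nat => sigma_rv (X i)).
Hypothesis X_law : forall i A, measurable A -> distribution P (X i) A = distribution P (X 0) A.
Variables (theta a Lam : R).
Hypothesis Lam_gt0 : 0 < Lam.
(** Density of the exponentially tilted law of one summand; the normalization [Ew1] forces Lam = E
    e^{theta (X_0 - a)}. *)
Let w1 (x : R) := expR (theta * (x - a)) / Lam.
Hypothesis iw1 : P.-integrable setT (EFin \o (w1 \o X 0)).
Hypothesis Ew1 : \int[P]_w w1 (X 0 w) = 1.

Definition centered_sum n w := total_storage X n w - n%:R * a.
Definition tilt_weight n w := expR (theta * centered_sum n w) / Lam ^+ n.
Definition tilt_cos n xi := \int[P]_w (tilt_weight n w * cos (xi * centered_sum n w)).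
Definition tilt_sin n xi := \int[P]_w (tilt_weight n w * sin (xi * centered_sum n w)).

Let C1 xi := \int[P]_w (w1 (X 0 w) * cos (xi * (X 0 w - a))).
Let S1 xi := \int[P]_w (w1 (X 0 w) * sin (xi * (X 0 w - a))).

Lemma tilt_weight_ge0 n w : 0 <= tilt_weight n w.
Proof. by rewrite divr_ge0 ?expR_ge0// exprn_ge0// ltW. Qed.

Lemma measurable_centered_sum n : measurable_fun setT (centered_sum n).
Proof. by apply: measurable_funB => //; exact: measurable_total_storage. Qed.

Let mw1 : measurable_fun setT w1.
Proof.
apply: continuous_measurable_fun => x; apply: cvgMl.
apply: (@continuous_comp _ _ _ (fun x : R => theta * (x - a))); last exact: continuous_expR.
by apply: cvgMr; apply: cvgB; [exact: cvg_id|exact: cvg_cst].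
Qed.

Let transfer i (g : R -> R) : measurable_fun setT g ->
  P.-integrable setT (EFin \o (g \o X 0)) ->
  P.-integrable setT (EFin \o (g \o X i)) /\
  \int[P]_w g (X i w) = \int[P]_w g (X 0 w).
Proof. by apply: same_law_integral; exact: X_law. Qed.

Let iw1M (h : R -> R) : measurable_fun setT h -> (forall x, `|h x| <= 1) ->
  P.-integrable setT (EFin \o ((fun x => w1 x * h x) \o X 0)).
Proof.
move=> mh h1; apply: (integrable_dominated (C := 1)) iw1 _ _ => //.
  apply: (measurableT_comp (f := fun x => w1 x * h x)) => //.
  exact: measurable_funM.
move=> w _; rewrite mul1r normrM ger0_norm ?divr_ge0 ?expR_ge0 ?(ltW Lam_gt0)//.
by rewrite ler_piMr// divr_ge0 ?expR_ge0 ?(ltW Lam_gt0).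
Qed.

Lemma centered_sumS n w : centered_sum n.+1 w = centered_sum n w + (X n w - a).
Proof. by rewrite /centered_sum /total_storage big_ord_recr/= -natr1; ring. Qed.

Lemma tilt_weightS n w : tilt_weight n.+1 w = tilt_weight n w * w1 (X n w).
Proof.
rewrite /tilt_weight /w1 centered_sumS mulrDr expRD exprSr.
by field; rewrite !lt0r_neq0// exprn_gt0.
Qed.

Let Y n : {mfun T >-> R} := HB.pack (total_storage X n)
  (isMeasurableFun.Build _ _ _ _ (total_storage X n) (measurable_total_storage X n)).

Let Wy n (y : R) := expR (theta * (y - n%:R * a)) / Lam ^+ n.

Let mWy n : measurable_fun setT (Wy n).
Proof.
apply: continuous_measurable_fun => x; apply: cvgMl.
apply: (@continuous_comp _ _ _ (fun x : R => theta * (x - n%:R * a))); last exact: continuous_expR.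
by apply: cvgMr; apply: cvgB; [exact: cvg_id|exact: cvg_cst].
Qed.

Lemma integrable_tilt_weight n : P.-integrable setT (EFin \o tilt_weight n).
Proof.
elim: n => [|n IH].
  have -> : tilt_weight 0 = cst 1.
    apply/funext => w; rewrite /tilt_weight /centered_sum /total_storage big_ord0.
    by rewrite mul0r subr0 mulr0 expR0 expr0 divr1.
  exact: finite_measure_integrable_cst.
have [iw1n _] := transfer n mw1 iw1.
have := (Rintegral_indepM (U := Y n) (V := X n) (total_storage_indep X_indep n) (mWy n) mw1 IH iw1n).1.
by apply: eq_integrable => // w _; rewrite /= tilt_weightS.
Qed.

Let iWM n (h : R -> R) : measurable_fun setT h -> (forall x, `|h x| <= 1) ->
  P.-integrable setT (EFin \o (fun w => tilt_weight n w * h (centered_sum n w))).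
Proof.
move=> mh h1; apply: (integrable_dominated (C := 1)) (integrable_tilt_weight n) _ _ => //.
  apply: measurable_funM; first exact/measurable_EFinP/(measurable_int P)/integrable_tilt_weight.
  by apply: (measurableT_comp mh); exact: measurable_centered_sum.
move=> w _; rewrite mul1r normrM ger0_norm ?tilt_weight_ge0//.
by rewrite ler_piMr// tilt_weight_ge0.
Qed.

(** The weight of n + 1 summands is a product, so tilting preserves independence: the last summand
    factors out of the tilted expectation. *)
Let step n (g h : R -> R) : measurable_fun setT g -> (forall x, `|g x| <= 1) ->
    measurable_fun setT h -> (forall x, `|h x| <= 1) ->
  P.-integrable setT (EFin \o (fun w => tilt_weight n.+1 w * (g (centered_sum n w) * h (X n w - a)))) /\
  \int[P]_w (tilt_weight n.+1 w * (g (centered_sum n w) * h (X n w - a))) =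
  \int[P]_w (tilt_weight n w * g (centered_sum n w)) * \int[P]_w (w1 (X 0 w) * h (X 0 w - a)).
Proof.
move=> mg g1 mh h1.
have mBa : measurable_fun setT (fun x : R => x - a) by exact: measurable_funB.
have mh' : measurable_fun setT (fun x : R => h (x - a)) by exact: (measurableT_comp mh).
have mG : measurable_fun setT (fun y : R => Wy n y * g (y - n%:R * a)).
  apply: measurable_funM => //; apply: (measurableT_comp mg).
  exact: measurable_funB.
have mH : measurable_fun setT (fun x : R => w1 x * h (x - a)) by exact: measurable_funM.
have [iH eH] := transfer n mH (iw1M mh' (fun x => h1 _)).
have [i e] := Rintegral_indepM (U := Y n) (V := X n) (total_storage_indep X_indep n) mG mH
  (iWM n mg g1) iH.
have eqf w : tilt_weight n.+1 w * (g (centered_sum n w) * h (X n w - a)) =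
  Wy n (Y n w) * g (Y n w - n%:R * a) * (w1 (X n w) * h (X n w - a)).
  by rewrite tilt_weightS /tilt_weight /Wy /centered_sum /=; ring.
split; first by apply: eq_integrable i => // w _; rewrite /= eqf.
by rewrite -eH -e; apply: eq_Rintegral => w _; exact: eqf.
Qed.

Let mcos xi : measurable_fun setT (fun x : R => cos (xi * x)).
Proof. by apply: continuous_measurable_fun; exact: continuous_cosM. Qed.
Let msin xi : measurable_fun setT (fun x : R => sin (xi * x)).
Proof. by apply: continuous_measurable_fun; exact: continuous_sinM. Qed.

(** Real part of the complex product phi_{n+1} = phi_n phi_1; [tilt_sinS] is the imaginary part. *)
Lemma tilt_cosS n xi : tilt_cos n.+1 xi = tilt_cos n xi * C1 xi - tilt_sin n xi * S1 xi.
Proof.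
have [i1 e1] := step n (mcos xi) (fun x => cos_max _) (mcos xi) (fun x => cos_max _).
have [i2 e2] := step n (msin xi) (fun x => sin_max _) (msin xi) (fun x => sin_max _).
rewrite -e1 -e2 -RintegralB//; apply: eq_Rintegral => w _.
by rewrite centered_sumS mulrDr cosD mulrBr.
Qed.

Lemma tilt_sinS n xi : tilt_sin n.+1 xi = tilt_sin n xi * C1 xi + tilt_cos n xi * S1 xi.
Proof.
have [i1 e1] := step n (msin xi) (fun x => sin_max _) (mcos xi) (fun x => cos_max _).
have [i2 e2] := step n (mcos xi) (fun x => cos_max _) (msin xi) (fun x => sin_max _).
rewrite -e1 -e2 -RintegralD//; apply: eq_Rintegral => w _.
by rewrite centered_sumS mulrDr sinD mulrDr.
Qed.

Lemma tilt_cos0 xi : tilt_cos 0 xi = 1.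
Proof.
rewrite /tilt_cos; under eq_Rintegral.
  move=> w _; rewrite /tilt_weight /centered_sum /total_storage big_ord0 mul0r subr0.
  rewrite !mulr0 expR0 cos0 expr0 divr1 mulr1; over.
have PT : fine (P setT) = 1 by rewrite probability_setT.
by rewrite (Rintegral_cst P measurableT) ?PT ?mulr1 ?probability_setT ?ltry.
Qed.

Lemma tilt_sin0 xi : tilt_sin 0 xi = 0.
Proof.
rewrite /tilt_sin; under eq_Rintegral.
  move=> w _; rewrite /tilt_weight /centered_sum /total_storage big_ord0 mul0r subr0.
  rewrite !mulr0 sin0 mulr0; over.
by rewrite Rintegral_cst// mul0r.
Qed.

(* |phi_n|^2 = |phi_1|^2n for the characteristic function phi_n of the tilted
   sum of n variables. *)
Lemma tilt_sqr n xi : tilt_cos n xi ^+ 2 + tilt_sin n xi ^+ 2 = (C1 xi ^+ 2 + S1 xi ^+ 2) ^+ n.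
Proof.
elim: n => [|n IH]; first by rewrite tilt_cos0 tilt_sin0 expr1n expr0n addr0.
by rewrite [RHS]exprSr -IH tilt_cosS tilt_sinS; ring.
Qed.

Variables (tau kappa : R).
Hypothesis i1 : P.-integrable setT (EFin \o (fun w => w1 (X 0 w) * (X 0 w - a))).
Hypothesis E1 : \int[P]_w (w1 (X 0 w) * (X 0 w - a)) = 0.
Hypothesis i2 : P.-integrable setT (EFin \o (fun w => w1 (X 0 w) * (X 0 w - a) ^+ 2)).
Hypothesis E2 : \int[P]_w (w1 (X 0 w) * (X 0 w - a) ^+ 2) = tau.
Hypothesis i3 : P.-integrable setT (EFin \o (fun w => w1 (X 0 w) * `|X 0 w - a| ^+ 3)).
Hypothesis i4 : P.-integrable setT (EFin \o (fun w => w1 (X 0 w) * (X 0 w - a) ^+ 4)).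
Hypothesis kappa_gt0 : 0 < kappa.
Hypothesis nonlattice : forall xi, C1 xi ^+ 2 + S1 xi ^+ 2 <= 1 - kappa * (xi ^+ 2 / (1 + xi ^+ 2)).

Let K3 := \int[P]_w (w1 (X 0 w) * `|X 0 w - a| ^+ 3) / 6.
Let K4 := \int[P]_w (w1 (X 0 w) * (X 0 w - a) ^+ 4) / 24.

Let w10 x : 0 <= w1 x.
Proof. by rewrite divr_ge0 ?expR_ge0 ?(ltW Lam_gt0). Qed.

Let mBa (h : R -> R) : measurable_fun setT h -> measurable_fun setT (fun x : R => h (x - a)).
Proof. by move=> mh; apply: (measurableT_comp mh); exact: measurable_funB. Qed.

Let iC xi : P.-integrable setT (EFin \o (fun w => w1 (X 0 w) * cos (xi * (X 0 w - a)))).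
Proof. exact: (iw1M (mBa (mcos xi)) (fun x => cos_max _)). Qed.

Let iS xi : P.-integrable setT (EFin \o (fun w => w1 (X 0 w) * sin (xi * (X 0 w - a)))).
Proof. exact: (iw1M (mBa (msin xi)) (fun x => sin_max _)). Qed.

(** The tilted mean of X_0 is a, by [E1], so the linear term of the sine drops out and the imaginary
    part is of third order. *)
Lemma tilt_sin1_le xi : `|S1 xi| <= K3 * `|xi| ^+ 3.
Proof.
have i1' := RintegrableZl measurableT xi i1.
have -> : S1 xi = \int[P]_w (w1 (X 0 w) * sin (xi * (X 0 w - a)) - xi * (w1 (X 0 w) * (X 0 w - a))).
  by rewrite RintegralB// RintegralZl// E1 mulr0 subr0.
have iB := RintegrableB measurableT (iS xi) i1'.
apply: (le_trans (le_normr_Rintegral measurableT iB)).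
rewrite [leRHS](_ : _ = \int[P]_w (w1 (X 0 w) * `|X 0 w - a| ^+ 3) * (`|xi| ^+ 3 / 6)); last by rewrite /K3; ring.
rewrite -RintegralZr//.
apply: le_Rintegral => //; first exact: integrable_norm.
  exact: (RintegrableZr measurableT).
move=> w _; rewrite (_ : _ - _ = w1 (X 0 w) * (sin (xi * (X 0 w - a)) - xi * (X 0 w - a))); last by ring.
rewrite normrM (ger0_norm (w10 _)) -mulrA ler_wpM2l//.
apply: (le_trans (sin_sub_id_le _)).
rewrite normrM exprMn [leLHS](_ : _ = `|X 0 w - a| ^+ 3 * (`|xi| ^+ 3 / 6))//.
by rewrite mulrAC mulrC.
Qed.

Lemma tilt_cos1_le xi : `|C1 xi - (1 - tau * xi ^+ 2 / 2)| <= K4 * xi ^+ 4.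
Proof.
have i2' := RintegrableZl measurableT (xi ^+ 2 / 2) i2.
have iB1 := RintegrableB measurableT iw1 i2'.
have iB := RintegrableB measurableT (iC xi) iB1.
have -> : C1 xi - (1 - tau * xi ^+ 2 / 2) =
  \int[P]_w (w1 (X 0 w) * cos (xi * (X 0 w - a)) - (w1 (X 0 w) - xi ^+ 2 / 2 * (w1 (X 0 w) * (X 0 w - a) ^+ 2))).
  rewrite (RintegralB measurableT (iC xi) iB1) (RintegralB measurableT iw1 i2').
  by rewrite RintegralZl// E2 Ew1; congr (_ - (_ - _)); ring.
apply: (le_trans (le_normr_Rintegral measurableT iB)).
rewrite [leRHS](_ : _ = \int[P]_w (w1 (X 0 w) * (X 0 w - a) ^+ 4) * (xi ^+ 4 / 24)); last by rewrite /K4; ring.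
rewrite -RintegralZr//.
apply: le_Rintegral => //; first exact: integrable_norm.
  exact: (RintegrableZr measurableT).
move=> w _; rewrite (_ : _ - _ = w1 (X 0 w) * (cos (xi * (X 0 w - a)) - (1 - (xi * (X 0 w - a)) ^+ 2 / 2))); last by rewrite /=; field.
rewrite normrM (ger0_norm (w10 _)) -mulrA ler_wpM2l//.
apply: (le_trans (cos_taylor2_le _)).
by rewrite exprMn mulrAC mulrC.
Qed.

Let K30 : 0 <= K3.
Proof. by rewrite divr_ge0// Rintegral_ge0// => w _; rewrite mulr_ge0. Qed.

Let K40 : 0 <= K4.
Proof. by rewrite divr_ge0// Rintegral_ge0// => w _; rewrite mulr_ge0// exprn_even_ge0. Qed.

Let nonlattice1 xi : C1 xi ^+ 2 + S1 xi ^+ 2 <= 1.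
Proof.
apply: (le_trans (nonlattice xi)); rewrite lerBlDr lerDl.
by rewrite mulr_ge0 ?(ltW kappa_gt0)// divr_ge0 ?sqr_ge0// addr_ge0 ?sqr_ge0.
Qed.

(** With tau = 0, integrating cos y >= 1 - y^2 / 2 would give C1 1 >= 1, against [nonlattice] at xi
    = 1. *)
Lemma tilt_variance_gt0 : 0 < tau.
Proof.
have t0 : 0 <= tau by rewrite -E2 Rintegral_ge0// => w _; rewrite mulr_ge0 ?sqr_ge0.
rewrite lt_neqAle t0 andbT; apply/eqP => t00.
have C11 : 1 <= C1 1.
  have i2' := RintegrableZl measurableT (2^-1) i2.
  have iB1 := RintegrableB measurableT iw1 i2'.
  have e : \int[P]_w (w1 (X 0 w) - 2^-1 * (w1 (X 0 w) * (X 0 w - a) ^+ 2)) = 1.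
    by rewrite (RintegralB measurableT iw1 i2') RintegralZl// E2 Ew1 -t00 mulr0 subr0.
  rewrite -[leLHS]e; apply: le_Rintegral => // w _.
  rewrite (_ : _ - _ = w1 (X 0 w) * (1 - (1 * (X 0 w - a)) ^+ 2 / 2)); last by field.
  rewrite ler_wpM2l//; have := cos_taylor2_le (1 * (X 0 w - a)).
  set y := 1 * _ => _.
  have [y0|/ltW y0] := leP 0 y; first exact: cos_ge_taylor2.
  by rewrite -cosN -sqrrN; apply: cos_ge_taylor2; rewrite oppr_ge0.
have := nonlattice 1; rewrite expr1n => h.
have h1 : 1 <= C1 1 ^+ 2 by rewrite exprn_ege1.
have h2 : 0 <= S1 1 ^+ 2 by exact: sqr_ge0.
have := le_trans (lerD h1 h2) h; rewrite addr0 lerBrDr gerDl => h3.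
by move: h3; rewrite pmulr_rle0// leNgt divr_gt0.
Qed.

Let absC1 xi : `|C1 xi| <= 1.
Proof.
rewrite -ler_sqr ?nnegrE// real_normK ?num_real// expr1n.
by apply: le_trans (nonlattice1 xi); rewrite lerDl sqr_ge0.
Qed.

Let abs_cos n xi : `|tilt_cos n xi| <= 1.
Proof.
rewrite -ler_sqr ?nnegrE// real_normK ?num_real// expr1n.
apply: (@le_trans _ _ (tilt_cos n xi ^+ 2 + tilt_sin n xi ^+ 2)); first by rewrite lerDl sqr_ge0.
by rewrite tilt_sqr exprn_ile1// ?nonlattice1// addr_ge0// sqr_ge0.
Qed.

Lemma tilt_sin_le n xi : `|tilt_sin n xi| <= n%:R * `|S1 xi|.
Proof.
elim: n => [|n IH]; first by rewrite tilt_sin0 normr0 mul0r.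
rewrite tilt_sinS (le_trans (ler_normD _ _))// !normrM.
have -> : n.+1%:R * `|S1 xi| = n%:R * `|S1 xi| + 1 * `|S1 xi| by rewrite -natr1 mulrDl.
apply: lerD; last by rewrite ler_wpM2r.
by apply: le_trans IH; rewrite ler_piMr.
Qed.

(** Replaces the power of a complex number by that of its real part, so that no complex logarithm is
    needed. As S1 is of order xi^3, the error n^2 S1^2 is of order 1 / n when xi is of order 1 /
    sqrt n. *)
Lemma tilt_cos_le n xi : `|tilt_cos n xi - C1 xi ^+ n| <= n%:R ^+ 2 * S1 xi ^+ 2.
Proof.
elim: n => [|n IH]; first by rewrite tilt_cos0 expr0 subrr normr0 expr0n mul0r.
have -> : tilt_cos n.+1 xi - C1 xi ^+ n.+1 =
    (tilt_cos n xi - C1 xi ^+ n) * C1 xi - tilt_sin n xi * S1 xi.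
  by rewrite tilt_cosS exprSr; ring.
rewrite (le_trans (ler_normB _ _))// !normrM.
have S2 : S1 xi ^+ 2 = `|S1 xi| ^+ 2 by rewrite real_normK// num_real.
apply: (@le_trans _ _ (n%:R ^+ 2 * S1 xi ^+ 2 + n%:R * S1 xi ^+ 2)).
  apply: lerD; first by apply: le_trans IH; rewrite ler_piMr.
  by rewrite S2 expr2 mulrA ler_wpM2r// tilt_sin_le.
rewrite -mulrDl ler_wpM2r ?sqr_ge0// -natr1.
have : 0 <= n%:R :> R by [].
set q := n%:R => q0; nra.
Qed.

Let mCS1 (f : R -> R) : continuous f -> (forall x, `|f x| <= 1) ->
  measurable_fun setT (fun xi : R => \int[P]_w (w1 (X 0 w) * f (xi * (X 0 w - a)))).
Proof.
move=> cf f1; apply: continuous_measurable_fun => xi.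
apply: (@continuity_under_integral _ _ _ P (fun (v : R) w => w1 (X 0 w) * f (v * (X 0 w - a))) setT
  measurableT (xi - 1) (xi + 1) _ _ (w1 \o X 0)).
- move=> v _; apply: (iw1M (h := fun x => f (v * (x - a)))) => //.
  apply: (mBa (h := fun x => f (v * x))); apply: continuous_measurable_fun => x.
  by apply: (@continuous_comp _ _ _ (fun x : R => v * x)); [apply: cvgMr; exact: cvg_id|exact: cf].
- apply: aeW => w _ v _; apply: cvgMr.
  by apply: (@continuous_comp _ _ _ (fun v : R => v * (X 0 w - a))); [apply: cvgMl; exact: cvg_id|exact: cf].
- by have := iw1.
- move=> v _; apply: aeW => w _; rewrite normrM (ger0_norm (w10 _)).
  by rewrite ler_piMr//.
- by rewrite inE/= in_itv/= ltrDl gtrDl ltrN10 ltr01.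
Qed.

Let mtilt n : measurable_fun setT (tilt_cos n) /\ measurable_fun setT (tilt_sin n).
Proof.
elim: n => [|n [mc ms]].
  split; first by rewrite (_ : tilt_cos 0 = cst 1)//; apply/funext => xi; exact: tilt_cos0.
  by rewrite (_ : tilt_sin 0 = cst 0)//; apply/funext => xi; exact: tilt_sin0.
have mC : measurable_fun setT C1 by exact: (mCS1 (@continuous_cos R) (@cos_max R)).
have mS : measurable_fun setT S1 by exact: (mCS1 (@continuous_sin R) (@sin_max R)).
split.
  rewrite (_ : tilt_cos n.+1 = fun xi => tilt_cos n xi * C1 xi - tilt_sin n xi * S1 xi).
    by apply: measurable_funB; exact: measurable_funM.
  by apply/funext => xi; exact: tilt_cosS.
rewrite (_ : tilt_sin n.+1 = fun xi => tilt_sin n xi * C1 xi + tilt_cos n xi * S1 xi).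
  by apply: measurable_funD; exact: measurable_funM.
by apply/funext => xi; exact: tilt_sinS.
Qed.

Let sg n : R := (Num.sqrt n.+1%:R)^-1.

Let sgE n eta : (sg n * eta) ^+ 2 = eta ^+ 2 * n.+1%:R^-1.
Proof. by rewrite exprMn exprVn sqr_sqrtr// mulrC. Qed.

(** With N = n + 1 and p = xi^2 / (1 + xi^2), the chain is (1 - kappa p)^N <= e^{-kappa p N} <= (1 +
    kappa p N / 2)^{-2}, and N xi^2 = eta^2. The constant is halved because the target is a
    square. *)
Let tilt_sqr_le n eta : tilt_cos n.+1 (sg n * eta) ^+ 2 + tilt_sin n.+1 (sg n * eta) ^+ 2 <=
  ((1 + (sg n * eta) ^+ 2) / (1 + (sg n * eta) ^+ 2 + kappa / 2 * eta ^+ 2)) ^+ 2.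
Proof.
rewrite tilt_sqr; set xi := sg n * eta; set p := xi ^+ 2 / (1 + xi ^+ 2).
have x0 : 0 <= xi ^+ 2 by exact: sqr_ge0.
have x1 : 0 < 1 + xi ^+ 2 by rewrite ltr_pwDl.
have p0 : 0 <= p by rewrite divr_ge0// ltW.
have q0 : 0 <= kappa / 2 * p * n.+1%:R by apply: mulr_ge0 => //; apply: mulr_ge0 => //; rewrite ltW// divr_gt0.
have e : (1 + xi ^+ 2) / (1 + xi ^+ 2 + kappa / 2 * eta ^+ 2) = (1 + kappa / 2 * p * n.+1%:R)^-1.
  have -> : eta ^+ 2 = xi ^+ 2 * n.+1%:R by rewrite sgE mulrVK// unitfE pnatr_eq0.
  have h : 0 < 1 + xi ^+ 2 + kappa / 2 * (xi ^+ 2 * n.+1%:R).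
    rewrite ltr_wpDr//; apply: mulr_ge0; first by rewrite ltW// divr_gt0.
    exact: mulr_ge0.
  rewrite /p; move: q0; rewrite /p; set N := n.+1%:R => q0; field.
  rewrite (lt0r_neq0 x1)/=; apply/lt0r_neq0.
  rewrite [ltRHS](_ : _ = 2 * (1 + xi ^+ 2 + kappa / 2 * (xi ^+ 2 * n.+1%:R))); last by rewrite -natr1; field.
  by rewrite mulr_gt0.
rewrite e.
have C0 : 0 <= C1 xi ^+ 2 + S1 xi ^+ 2 by rewrite addr_ge0 ?sqr_ge0.
apply: (@le_trans _ _ (expR (- (kappa * p)) ^+ n.+1)).
  rewrite lerXn2r ?nnegrE ?expR_ge0//.
  by apply: (le_trans (nonlattice xi)); exact: expR_ge1Dx.
rewrite -expRM_natl (_ : n.+1%:R * - (kappa * p) = 2%:R * - (kappa / 2 * p * n.+1%:R)); last by field.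
rewrite expRM_natl lerXn2r ?nnegrE ?expR_ge0 ?invr_ge0 ?addr_ge0//.
by rewrite expRN lef_pV2 ?posrE ?expR_gt0// ?ltr_pwDl// expR_ge1Dx.
Qed.

Let tilt_cos_cvg eta : tilt_cos n.+1 (sg n * eta) @[n --> \oo] --> expR (- (tau * eta ^+ 2 / 2)).
Proof.
have t0 := tilt_variance_gt0.
(* The Gaussian limit is written as the power n + 1 of g = e^{-tau xi^2 / 2}. The three terms come
   from dropping S1, from the fourth-order remainder of C1 and from the second-order remainder of g;
   since xi^2 = eta^2 / (n + 1), each error is its term divided by n + 1. *)
pose D := K3 ^+ 2 * eta ^+ 6 + (K4 * eta ^+ 4 + (tau * eta ^+ 2 / 2) ^+ 2).
apply/subr_cvg0; apply: norm_cvg0.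
apply: (@squeeze_cvgr _ _ _ _ (fun=> 0) (fun n => D * n.+1%:R^-1)).
- apply: nearW => n; rewrite normr_ge0/=.
  set xi := sg n * eta; set N := n.+1%:R.
  have N0 : N != 0 by rewrite pnatr_eq0.
  have N1 : 0 <= N by [].
  have xi2 : xi ^+ 2 = eta ^+ 2 / N by exact: sgE.
  pose g := expR (- (tau * xi ^+ 2 / 2)).
  have y0 : 0 <= tau * xi ^+ 2 / 2 by rewrite divr_ge0// mulr_ge0 ?sqr_ge0// ltW.
  have g1 : `|g| <= 1 by rewrite ger0_norm ?expR_ge0// -expR0 ler_expR oppr_le0.
  have -> : expR (- (tau * eta ^+ 2 / 2)) = g ^+ n.+1.
    by rewrite -expRM_natl xi2; congr expR; field.
  have -> : tilt_cos n.+1 xi - g ^+ n.+1 =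
    (tilt_cos n.+1 xi - C1 xi ^+ n.+1) + (C1 xi ^+ n.+1 - g ^+ n.+1) by ring.
  rewrite (le_trans (ler_normD _ _))// mulrDl lerD//.
    apply: (le_trans (tilt_cos_le _ _)); rewrite -/N.
    apply: (@le_trans _ _ (N ^+ 2 * (K3 * `|xi| ^+ 3) ^+ 2)).
      rewrite ler_wpM2l ?sqr_ge0// -(real_normK (num_real (S1 xi))).
      have K0 : 0 <= K3 * `|xi| ^+ 3 by rewrite mulr_ge0// exprn_ge0.
      by rewrite ler_sqr ?nnegrE//; exact: tilt_sin1_le.
    rewrite [leLHS](_ : _ = N ^+ 2 * K3 ^+ 2 * (`|xi| ^+ 2) ^+ 3); last by ring.
    rewrite real_normK ?num_real// xi2.
    by rewrite [leLHS](_ : _ = K3 ^+ 2 * eta ^+ 6 / N)//; field.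
  apply: (le_trans (normr_exprB_le n.+1 (absC1 xi) g1)); rewrite -/N.
  apply: (@le_trans _ _ (N * (K4 * xi ^+ 4 + (tau * xi ^+ 2 / 2) ^+ 2))).
    rewrite ler_wpM2l//.
    have -> : C1 xi - g = (C1 xi - (1 - tau * xi ^+ 2 / 2)) - (g - (1 - tau * xi ^+ 2 / 2)) by ring.
    rewrite (le_trans (ler_normB _ _))// lerD ?tilt_cos1_le//.
    exact: expRN_taylor1_le.
  rewrite [xi ^+ 4](_ : _ = (xi ^+ 2) ^+ 2); last by ring.
  rewrite xi2 [leLHS](_ : _ = (K4 * eta ^+ 4 + (tau * eta ^+ 2 / 2) ^+ 2) / N)//.
  by field.
- exact: cvg_cst.
- by rewrite -[X in _ --> X](mulr0 D); apply: cvgMr; exact: cvg_harmonicR.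
Qed.

Let tilt_sin_cvg eta : tilt_sin n.+1 (sg n * eta) @[n --> \oo] --> (0 : R).
Proof.
apply: norm_cvg0.
apply: (@squeeze_cvgr _ _ _ _ (fun=> 0) (fun n => K3 * `|eta| ^+ 3 * sg n)).
- apply: nearW => n; rewrite normr_ge0/=.
  apply: (le_trans (tilt_sin_le _ _)).
  apply: (@le_trans _ _ (n.+1%:R * (K3 * `|sg n * eta| ^+ 3))); first by rewrite ler_wpM2l// tilt_sin1_le.
  have sg0 : 0 < sg n by rewrite invr_gt0 sqrtr_gt0.
  rewrite normrM (ger0_norm (ltW sg0)) exprMn (exprSr (sg n)).
  have -> : sg n ^+ 2 = n.+1%:R^-1 by rewrite exprVn sqr_sqrtr.
  by rewrite le_eqVlt; apply/orP; left; apply/eqP; field; rewrite addrC natr1 pnatr_eq0.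
- exact: cvg_cst.
- by rewrite -[X in _ --> X](mulr0 (K3 * `|eta| ^+ 3)); apply: cvgMr; exact: cvg_inv_sqrt.
Qed.

Lemma tilted_local_limit k : 0 < k ->
  Num.sqrt n.+1%:R * \int[P]_w (tilt_weight n.+1 w * exphalf k (centered_sum n.+1 w)) @[n --> \oo] -->
  k^-1 / Num.sqrt (2 * pi * tau).
Proof.
move=> k0; apply: (@exphalf_local_limit _ _ _ P (fun n => tilt_weight n.+1) (fun n => centered_sum n.+1) tau (kappa / 2)) => //.
- exact: tilt_variance_gt0.
- by rewrite divr_gt0.
- by move=> n; exact: measurable_centered_sum.
- by move=> n w; exact: tilt_weight_ge0.
- by move=> n; exact: integrable_tilt_weight.
- by move=> n; exact: (mtilt n.+1).1.
- by move=> n; exact: (mtilt n.+1).2.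
Qed.

End tilted_sums.

(** * Exponential moments *)

Section exponential_moments.
Context d (T : measurableType d) (R : realType) (P : probability T R).
Variable Z : {RV P >-> R}.
Variables (M : R -> \bar R) (a theta : R).
Hypothesis ME : M = mmt_gen_fun P Z.
Hypothesis theta_argsup : is_argsup M a theta.
Hypothesis theta_int : (interior [set v : R | (M v < +oo)%E]) theta.

Let Y w := Z w - a.

(** The successive derivatives of the moment generating function of Z - a. Centring at a turns the
    saddle-point equation M' / M = a into the vanishing of the first of them. *)
Definition centered_moment j v := \int[P]_w (Y w ^+ j * expR (v * Y w)).
Local Notation psi := centered_moment.

Let mY : measurable_fun setT Y.
Proof. by apply: measurable_funB => //; exact: measurable_funP. Qed.

Let mexpY v : measurable_fun setT (fun w => expR (v * Y w)).
Proof.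
apply: (measurableT_comp (f := fun y : R => expR (v * y))) => //.
apply: continuous_measurable_fun => y.
by apply: (@continuous_comp _ _ _ (fun y : R => v * y)); [apply: cvgMr; exact: cvg_id|exact: continuous_expR].
Qed.

Let mE j v : measurable_fun setT (fun w => Y w ^+ j * expR (v * Y w)).
Proof. by apply: measurable_funM => //; exact: measurable_funX. Qed.

Let MEY v : M v = ((expR (v * a))%:E * \int[P]_w (expR (v * Y w))%:E)%E.
Proof.
rewrite ME /mmt_gen_fun unlock -ge0_integralZl//.
- apply: eq_integral => w _ /=; rewrite -EFinM -expRD; congr (expR _)%:E.
  by rewrite /Y; ring.
- exact/measurable_EFinP.
Qed.

Let iexpY v : (M v < +oo)%E -> P.-integrable setT (fun w => (expR (v * Y w))%:E).
Proof.
rewrite MEY => h; apply/integrableP; split; first exact/measurable_EFinP.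
under eq_integral => w _ do rewrite gee0_abs ?lee_fin ?expR_ge0//.
rewrite ltNge; apply/negP; rewrite leye_eq => /eqP e.
by move: h; rewrite e gt0_muley// lte_fin expR_gt0.
Qed.

Let psi0E v : psi 0 v = \int[P]_w expR (v * Y w).
Proof. by apply: eq_Rintegral => w _; rewrite expr0 mul1r. Qed.

Lemma mgf_centered_moment v : (M v < +oo)%E -> M v = (expR (v * a) * psi 0 v)%:E.
Proof.
move=> Mv; rewrite MEY EFinM psi0E /Rintegral fineK//.
by apply: integrable_fin_num => //; exact: iexpY.
Qed.

Let psi0_gt0 v : (M v < +oo)%E -> 0 < psi 0 v.
Proof.
move=> Mv; rewrite lt_neqAle; apply/andP; split; last first.
  by rewrite psi0E Rintegral_ge0// => w _; rewrite expR_ge0.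
apply/eqP => e.
have /ae_eq_integral_abs : (\int[P]_w `|(expR (v * Y w))%:E| = 0)%E.
  transitivity (\int[P]_w (expR (v * Y w))%:E)%E.
    by apply: eq_integral => w _; rewrite gee0_abs// lee_fin expR_ge0.
  have := integrable_fin_num measurableT (iexpY Mv) => /fineK <-.
  by move: e; rewrite psi0E /Rintegral => <-.
case=> //; first exact/measurable_EFinP.
move=> A [mA A0 sub].
have AT : A = setT.
  apply/seteqP; split => // w _; apply: sub => /=.
  by move=> /(_ Logic.I) [] /eqP; rewrite gt_eqF// expR_gt0.
have PA : P A = 0%E by exact: A0.
by move: PA; rewrite AT probability_setT => /eqP; rewrite onee_eq0.
Qed.

Let exists_radius : exists2 e : R, 0 < e & forall v, `|v - theta| <= e -> (M v < +oo)%E.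
Proof.
move: theta_int => /nbhs_ballP[e /= e0 he]; exists (e / 2); first by rewrite divr_gt0.
move=> v ve; apply: he; rewrite /ball/= distrC (le_lt_trans ve)//.
by rewrite ltr_pdivrMr// ltr_pMr// ltr1n.
Qed.

Let moment_bound e : 0 < e -> exists2 C : R, 0 <= C &
  forall j y v, (j <= 4)%N -> `|v - theta| <= e / 2 ->
    `|y ^+ j * expR (v * y)| <= C * (expR ((theta + e) * y) + expR ((theta - e) * y)).
Proof.
(* Half of the margin e absorbs v - theta; the other half, cut into four eighths, absorbs the fourth
   power, since c (1 + |y|) <= 1 + (e / 8) |y| <= e^{(e / 8) |y|}. The two exponentials at theta + e
   and theta - e serve the two signs of y. *)
move=> e0; pose c := Num.min 1 (e / 8).
have c0 : 0 < c by rewrite lt_min ltr01 divr_gt0.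
have c1 : c <= 1 by rewrite ge_min lexx.
have c8 : c <= e / 8 by rewrite ge_min lexx orbT.
exists (c^-1 ^+ 4); first by rewrite exprn_ge0// invr_ge0 ltW.
move=> j y v j4 ve; rewrite normrM (ger0_norm (expR_ge0 _)) normrX.
have y0 : 0 <= `|y| by [].
apply: (@le_trans _ _ (c^-1 ^+ 4 * expR (e / 2 * `|y|) * expR (v * y))).
  rewrite ler_wpM2r ?expR_ge0//.
  apply: (@le_trans _ _ ((1 + `|y|) ^+ 4)).
    apply: (@le_trans _ _ ((1 + `|y|) ^+ j)).
      by rewrite lerXn2r ?nnegrE ?addr_ge0// lerDr.
    by apply: ler_weXn2l => //; rewrite lerDl.
  have -> : expR (e / 2 * `|y|) = expR (e / 8 * `|y|) ^+ 4.
    by rewrite -expRM_natl; congr expR; field.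
  rewrite -exprMn lerXn2r ?nnegrE ?addr_ge0 ?mulr_ge0 ?expR_ge0 ?invr_ge0 ?(ltW c0)//.
  rewrite ler_pdivlMl//; apply: (@le_trans _ _ (1 + c * `|y|)).
    by rewrite mulrDr mulr1 lerD.
  apply: (le_trans (expR_ge1Dx _)).
  by rewrite ler_expR ler_wpM2r.
rewrite -mulrA ler_wpM2l ?exprn_ge0 ?invr_ge0 ?(ltW c0)// -expRD.
have vy : (v - theta) * y <= e / 2 * `|y|.
  by rewrite (le_trans (ler_norm _))// normrM ler_wpM2r.
have [yp|yn] := leP 0 y.
  rewrite (@le_trans _ _ (expR ((theta + e) * y)))//; last by rewrite lerDl expR_ge0.
  rewrite ler_expR; move: vy; rewrite (ger0_norm yp); lra.
rewrite (@le_trans _ _ (expR ((theta - e) * y)))//; last by rewrite lerDr expR_ge0.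
rewrite ler_expR; move: vy; rewrite (ltr0_norm yn); lra.
Qed.

Let dominating e : 0 < e -> (forall v, `|v - theta| <= e -> (M v < +oo)%E) ->
  exists G : T -> R, [/\ forall w, 0 <= G w, P.-integrable setT (EFin \o G) &
    forall j w v, (j <= 4)%N -> `|v - theta| <= e / 2 -> `|Y w ^+ j * expR (v * Y w)| <= G w].
Proof.
move=> e0 he; have [C C0 hC] := moment_bound e0.
exists (fun w => C * (expR ((theta + e) * Y w) + expR ((theta - e) * Y w))); split.
- by move=> w; rewrite mulr_ge0// addr_ge0 ?expR_ge0.
- apply: (RintegrableZl measurableT); apply: (RintegrableD measurableT); apply: iexpY; apply: he.
    by rewrite addrAC subrr add0r gtr0_norm.
  by rewrite addrAC subrr add0r normrN gtr0_norm.
- by move=> j w v j4 ve; exact: hC.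
Qed.

Let integrable_E j v e : 0 < e -> (forall v, `|v - theta| <= e -> (M v < +oo)%E) ->
  (j <= 4)%N -> `|v - theta| <= e / 2 ->
  P.-integrable setT (EFin \o (fun w => Y w ^+ j * expR (v * Y w))).
Proof.
move=> e0 he j4 ve; have [G [G0 iG hG]] := dominating e0 he.
apply: (integrable_dominated (C := 1)) iG _ _ => // w _.
by rewrite mul1r; exact: hG.
Qed.

Let is_derive_E j w (v : R) :
  is_derive v 1 (fun v => Y w ^+ j * expR (v * Y w)) (Y w ^+ j.+1 * expR (v * Y w)).
Proof. by apply: is_derive_eq; rewrite /GRing.scale/= exprSr; ring. Qed.

Let is_derive_psi j v e : 0 < e -> (forall v, `|v - theta| <= e -> (M v < +oo)%E) ->
  (j < 4)%N -> `|v - theta| < e / 2 -> is_derive v 1 (psi j) (psi j.+1 v).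
Proof.
move=> e0 he j4 ve; have [G [G0 iG hG]] := dominating e0 he.
pose f (v : R) w := Y w ^+ j * expR (v * Y w).
have Iv u : u \in `]theta - e / 2, theta + e / 2[ -> `|u - theta| <= e / 2.
  by rewrite in_itv/= => /andP[h1 h2]; rewrite ler_norml; apply/andP; split; lra.
have vI : v \in `]theta - e / 2, theta + e / 2[.
  by move: ve; rewrite in_itv/= ltr_norml => /andP[h1 h2]; apply/andP; split; lra.
have intf u : [set` `]theta - e / 2, theta + e / 2[%R] u -> P.-integrable setT (EFin \o f u).
  by move=> /Iv h; apply: integrable_E h => //; exact: ltnW.
have df u w : partial1of2 f u w = Y w ^+ j.+1 * expR (u * Y w).
  by rewrite partial1of2E; have [_ ->] := is_derive_E j w u.
have derf u w : [set` `]theta - e / 2, theta + e / 2[%R] u -> setT w -> derivable (f ^~ w) u 1.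
  by move=> _ _; have [] := is_derive_E j w u.
have Gub u w : [set` `]theta - e / 2, theta + e / 2[%R] u -> setT w -> `|partial1of2 f u w| <= G w.
  by move=> /Iv h _; rewrite df; exact: hG.
apply: DeriveDef; first exact: (derivable_under_integral measurableT vI intf derf G0 iG Gub).
rewrite -derive1E (differentiation_under_integral measurableT vI intf derf G0 iG Gub).
by apply: eq_Rintegral => w _; exact: df.
Qed.

(** Wherever M is finite, v a - log M(v) = - log (psi 0 v): maximizing the former is minimizing
    [psi 0]. As theta is an interior point, the derivative [psi 1] then vanishes there. *)
Let psi_min v : (M v < +oo)%E -> psi 0 theta <= psi 0 v.
Proof.
move=> Mv; have Mth : (M theta < +oo)%E by exact: (interior_subset theta_int).
have pv := psi0_gt0 Mv; have pt := psi0_gt0 Mth.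
have := theta_argsup v; rewrite (mgf_centered_moment Mv) (mgf_centered_moment Mth).
move: (psi 0 theta) (psi 0 v) pt pv => p q p0 q0.
rewrite !lne_EFin ?mulr_gt0 ?expR_gt0// !lnM ?posrE ?expR_gt0// !expRK.
rewrite -!EFinB lee_fin => h.
rewrite -ler_ln ?posrE//; lra.
Qed.

Let psi1 : psi 1 theta = 0.
Proof.
have [e e0 he] := exists_radius.
have Iv u : u \in `]theta - e / 2, theta + e / 2[ -> `|u - theta| < e / 2.
  by rewrite in_itv/= => /andP[h1 h2]; rewrite ltr_norml; apply/andP; split; lra.
have tI : theta \in `]theta - e / 2, theta + e / 2[ by rewrite in_itv/=; apply/andP; split; lra.
have [] := @derive1_at_min R (psi 0) (theta - e / 2) (theta + e / 2) theta.
- by lra.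
- by move=> u /Iv h; have [] := is_derive_psi e0 he (isT : (0 < 4)%N) h.
- exact: tI.
- by move=> u /Iv h; apply/psi_min/he; rewrite (le_trans (ltW h))// ler_pdivrMr// ler_pMr// ler1n.
by move=> _ <-; have [_ ->] := is_derive_psi e0 he (isT : (0 < 4)%N) (Iv _ tI).
Qed.

(** Around theta, log M(v) = v a + ln (psi 0 v); farther away M may be infinite and [logM] a default
    value, so the derivatives are compared only locally. The squared term of the second derivative
    disappears because [psi 1 theta] is 0. *)
Let tau_psi : derive1n 2 (logM M) theta = psi 2 theta / psi 0 theta.
Proof.
have [e e0 he] := exists_radius.
have tI : theta \in `]theta - e / 2, theta + e / 2[ by rewrite in_itv/=; apply/andP; split; lra.
have Iv u : u \in `]theta - e / 2, theta + e / 2[ -> `|u - theta| < e / 2.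
  by rewrite in_itv/= => /andP[h1 h2]; rewrite ltr_norml; apply/andP; split; lra.
have Mu u : u \in `]theta - e / 2, theta + e / 2[ -> (M u < +oo)%E.
  by move=> /Iv h; apply: he; rewrite (le_trans (ltW h))// ler_pdivrMr// ler_pMr// ler1n.
pose g (v : R) := v * a + ln (psi 0 v).
have logE u : u \in `]theta - e / 2, theta + e / 2[ -> g u = logM M u.
  move=> /Mu h; rewrite /logM (mgf_centered_moment h)/=.
  by rewrite lnM ?posrE ?expR_gt0 ?psi0_gt0// expRK.
have dlog (u : R) : u \in `]theta - e / 2, theta + e / 2[ ->
    (logM M)^`()%classic u = a + psi 1 u / psi 0 u.
  move=> uI; rewrite derive1E -(@near_eq_derive _ _ _ g); last first.
    by near=> z; apply: logE; near: z; exact: near_in_itvoo.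
  have d0 := is_derive_psi e0 he (isT : (0 < 4)%N) (Iv _ uI).
  have d1 := is_derive1_ln (psi0_gt0 (Mu _ uI)).
  have d2 : is_derive u 1 (fun v => ln (psi 0 v)) (psi 1 u * (psi 0 u)^-1).
    have := is_derive1_comp d1 d0; rewrite mulrC; exact.
  apply: derive_val; apply: is_derive_eq.
  by rewrite /GRing.scale/=; ring.
have p0 := psi0_gt0 (Mu _ tI).
rewrite derive1nS derive1n1 derive1E.
rewrite -(@near_eq_derive _ _ _ (fun u => a + psi 1 u / psi 0 u)); last first.
  by near=> z; apply/esym/dlog; near: z; exact: near_in_itvoo.
have d0 := is_derive_psi e0 he (isT : (0 < 4)%N) (Iv _ tI).
have d1 := is_derive_psi e0 he (isT : (1 < 4)%N) (Iv _ tI).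
have dV := is_deriveV (lt0r_neq0 p0) d0.
apply: derive_val; apply: is_derive_eq.
by rewrite /GRing.scale/= psi1; ring.
Unshelve. all: by end_near. Qed.

Lemma twisted_moments (Lam := psi 0 theta) (w1 := fun x => expR (theta * (x - a)) / Lam) :
  [/\ 0 < Lam, (fine (M theta) = expR (theta * a) * Lam),
    (forall j, (j <= 4)%N -> P.-integrable setT (EFin \o (fun w => w1 (Z w) * (Z w - a) ^+ j))) &
    [/\ \int[P]_w w1 (Z w) = 1, \int[P]_w (w1 (Z w) * (Z w - a)) = 0 &
     \int[P]_w (w1 (Z w) * (Z w - a) ^+ 2) = derive1n 2 (logM M) theta]].
Proof.
have [e e0 he] := exists_radius.
have Mth : (M theta < +oo)%E by exact: (interior_subset theta_int).
have L0 : 0 < Lam by exact: psi0_gt0.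
have eqj j w : w1 (Z w) * (Z w - a) ^+ j = Lam^-1 * (Y w ^+ j * expR (theta * Y w)).
  by rewrite /w1 /Y; ring.
have iE j : (j <= 4)%N -> P.-integrable setT (EFin \o (fun w => Y w ^+ j * expR (theta * Y w))).
  by move=> j4; apply: (integrable_E e0 he j4); rewrite subrr normr0 divr_ge0// ltW.
have int j : (j <= 4)%N -> \int[P]_w (w1 (Z w) * (Z w - a) ^+ j) = psi j theta / Lam.
  move=> j4; rewrite mulrC -RintegralZl//; last exact: iE.
  by apply: eq_Rintegral => w _; exact: eqj.
split => //; first by rewrite (mgf_centered_moment Mth).
  move=> j j4; apply: eq_integrable (RintegrableZl measurableT Lam^-1 (iE j j4)) => // w _.
  by rewrite /= eqj.
split.
- have := int 0 isT; rewrite divff ?lt0r_neq0// => <-.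
  by apply: eq_Rintegral => w _; rewrite expr0 mulr1.
- by have := int 1 isT; rewrite psi1 mul0r.
- by rewrite (int 2 isT) tau_psi.
Qed.

End exponential_moments.

(** * The law of the shot noise *)

Section oscillation.
Context {R : realType}.
Variables r t : R.
Hypotheses (r_gt0 : 0 < r) (t_gt0 : 0 < t).
Let q := expR (- (r * t)).
Local Notation leb := (@lebesgue_measure R).

Let q1 : 0 < 1 - q.
Proof. by rewrite subr_gt0 -expR0 ltr_expR oppr_lt0 mulr_gt0. Qed.

Let q0 : 0 < q. Proof. exact: expR_gt0. Qed.

Let integral_decay_cos z : 0 < z ->
  (\int[leb]_(u in `[0%R, t]) (expR (- (r * u)) * (1 - cos (z * expR (- (r * u)))))%:E =
   ((1 - q) / r - (sin z - sin (z * q)) / (r * z))%:E)%E.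
Proof.
move=> z0; pose F (u : R) := - (expR (- (r * u)) / r) + sin (z * expR (- (r * u))) / (r * z).
have dF (u : R) : is_derive u 1 F (expR (- (r * u)) * (1 - cos (z * expR (- (r * u))))).
  apply: is_derive_eq; rewrite /GRing.scale/=; field.
  by rewrite !lt0r_neq0.
have cf : continuous (fun u : R => expR (- (r * u)) * (1 - cos (z * expR (- (r * u))))).
  move=> u; apply/differentiable_continuous/derivable1_diffP.
  by apply: ex_derive.
have cF : continuous F.
  move=> u; apply/differentiable_continuous/derivable1_diffP.
  by have [] := dF u.
rewrite (@continuous_FTC2 _ _ F)//.
- rewrite -EFinB; congr (_%:E); rewrite /F mulr0 oppr0 expR0 mulr1 -/q.
  by field; rewrite !lt0r_neq0.
- exact: continuous_subspaceT.
- split; first by move=> u _; have [] := dF u.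
    exact/cvg_at_right_filter/cF.
  exact/cvg_at_left_filter/cF.
- by move=> u _; rewrite derive1E; have [_ ->] := dF u.
Qed.

(** The difference of sines is 2 cos(z (1 + q) / 2) sin x with x half the length of [z q, z]; the
    cosine is bounded by 1 and [sinc_bound] applies to x. *)
Let decay_cos_bound z (x := z * (1 - q) / 2) : 0 < z ->
  (1 - q) / r * (2 / 15 * (x ^+ 2 / (1 + x ^+ 2))) <= (1 - q) / r - (sin z - sin (z * q)) / (r * z).
Proof.
move=> z0; have x0 : 0 < x by rewrite divr_gt0// mulr_gt0.
have sB : sin z - sin (z * q) = 2 * (cos (z * (1 + q) / 2) * sin x).
  have -> : z = z * (1 + q) / 2 + x by rewrite /x; field.
  rewrite (_ : (_ + x) * q = z * (1 + q) / 2 - x); last by rewrite /x; field.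
  rewrite (_ : (_ + x) * (1 + q) / 2 = z * (1 + q) / 2); last by rewrite /x; field.
  by rewrite sinD sinB; ring.
have h1 : sin z - sin (z * q) <= 2 * `|sin x|.
  rewrite sB (le_trans (ler_norm _))// normrM ger0_norm// ler_wpM2l// normrM.
  by rewrite ler_piMl// cos_max.
have x1 : 0 < 1 + x ^+ 2 by rewrite ltr_pwDl// sqr_ge0.
have h2 := sinc_bound (ltW x0).
have h3 : `|sin x| <= x * (1 - 2 / 15 * (x ^+ 2 / (1 + x ^+ 2))).
  rewrite -(ler_pM2r x1) (le_trans h2)// le_eqVlt; apply/orP; left; apply/eqP.
  by field; exact: lt0r_neq0.
have rz : 0 < r * z by rewrite mulr_gt0.
have h4 : (sin z - sin (z * q)) / (r * z) <= (1 - q) / r * (1 - 2 / 15 * (x ^+ 2 / (1 + x ^+ 2))).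
  rewrite ler_pdivrMr// (le_trans h1)//.
  rewrite [leRHS](_ : _ = 2 * (x * (1 - 2 / 15 * (x ^+ 2 / (1 + x ^+ 2))))).
    by rewrite ler_wpM2l.
  have e y : (1 - q) / r * (1 - y) * (r * z) = 2 * (x * (1 - y)).
    by rewrite /x; field; exact: lt0r_neq0.
  exact: e.
rewrite mulrBr mulr1 in h4; lra.
Qed.

Lemma decay_oscillation b0 : 0 < b0 -> exists2 k, 0 < k & forall xi b, b0 <= b ->
  ((k * (xi ^+ 2 / (1 + xi ^+ 2)))%:E <=
   \int[leb]_(u in `[0%R, t]) (1 - cos (xi * (b * expR (- (r * u)))))%:E)%E.
Proof.
move=> b00; pose be := b0 * (1 - q) / 2.
have be0 : 0 < be by rewrite divr_gt0// mulr_gt0.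
(* [be] is the value of x = xi b (1 - q) / 2 at xi = 1 and b = b0. For x >= be xi this choice gives
   m xi^2 / (1 + xi^2) <= x^2 / (1 + x^2): the part m <= be^2 serves small xi, the part m <= 1
   serves large xi. *)
pose m := Num.min 1 (be ^+ 2).
have m0 : 0 < m by rewrite lt_min ltr01 exprn_gt0.
exists ((1 - q) / r * (2 / 15 * m)).
  by apply: mulr_gt0; [exact: divr_gt0|apply: mulr_gt0 => //; exact: divr_gt0].
have md z : measurable_fun setT (fun u : R => 1 - cos (z * expR (- (r * u)))).
  apply: continuous_measurable_fun => u.
  apply/differentiable_continuous/derivable1_diffP; exact: ex_derive.
have me : measurable_fun setT (fun u : R => expR (- (r * u))).
  apply: continuous_measurable_fun => u.
  apply/differentiable_continuous/derivable1_diffP; exact: ex_derive.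
move=> xi b bb0; wlog x0 : xi / 0 < xi.
  move=> H; have [x0|x0|<-] := ltgtP 0 xi; first exact: H.
    have := H (- xi); rewrite oppr_gt0 => /(_ x0); rewrite sqrrN => h.
    by apply: (le_trans h); under eq_integral => u _ do rewrite mulNr cosN.
  rewrite expr0n mul0r mulr0; apply: integral_ge0 => u _.
  by rewrite lee_fin subr_ge0 cos_le1.
have b1 : 0 < b by exact: lt_le_trans bb0.
have z0 : 0 < xi * b by rewrite mulr_gt0.
(* The extra factor e^{-ru} <= 1 makes the integrand an exact derivative. *)
apply: (@le_trans _ _ (\int[leb]_(u in `[0%R, t]) (expR (- (r * u)) * (1 - cos (xi * b * expR (- (r * u)))))%:E)%E).
  rewrite integral_decay_cos// lee_fin; apply: le_trans (decay_cos_bound z0).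
  set p := xi ^+ 2 / (1 + xi ^+ 2).
  rewrite -(mulrA _ _ p) ler_wpM2l ?divr_ge0 ?(ltW q1) ?(ltW r_gt0)//.
  rewrite -(mulrA _ _ p) ler_wpM2l ?divr_ge0// /p.
  set x := xi * b * (1 - q) / 2.
  have xx : be ^+ 2 * xi ^+ 2 <= x ^+ 2.
    have bx : be * xi <= x.
      rewrite /x /be [leLHS](_ : _ = xi * (b0 * ((1 - q) / 2))); last by ring.
      rewrite -!mulrA.
      rewrite ler_wpM2l ?(ltW x0)// ler_wpM2r// divr_ge0// ltW//.
    have bx0 : 0 <= be * xi by exact: ltW (mulr_gt0 be0 x0).
    by rewrite -exprMn ler_sqr ?nnegrE//; exact: le_trans bx.
  have mx : m * xi ^+ 2 <= x ^+ 2.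
    by apply: le_trans xx; rewrite ler_wpM2r ?sqr_ge0// ge_min lexx orbT.
  have m1 : m <= 1 by rewrite ge_min lexx.
  have xi2 : 0 <= xi ^+ 2 by exact: sqr_ge0.
  have x2 : 0 <= x ^+ 2 by exact: sqr_ge0.
  rewrite mulrA ler_pdivrMr ?ltr_pwDl// mulrAC ler_pdivlMr ?ltr_pwDl//.
  have := ler_wpM2r (mulr_ge0 xi2 x2) m1.
  move: mx; set u := xi ^+ 2; set v := x ^+ 2; lra.
apply: ge0_le_integral => //=.
- apply/measurable_EFinP/measurable_funTS; exact: measurable_funM me (md _).
- apply/measurable_EFinP/measurable_funTS.
  have := md (xi * b); by under eq_fun do rewrite -mulrA.
move=> u; rewrite in_itv/= => /andP[u0 _]; rewrite lee_fin mulrA.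
by rewrite ler_piMl ?subr_ge0 ?cos_le1// -expR0 ler_expR oppr_le0 mulr_ge0// ltW.
Qed.

End oscillation.

(** The inequality | int f e^{ih} | <= int f in real terms: projecting e^{ih} on the direction of
    the integral p + iq gives p cos h + q sin h <= rho with rho = |p + iq|, and integrating against
    f gives rho^2 <= rho int f. *)
Lemma cos_sin_integral_le d (T : measurableType d) (R : realType) (P : {measure set T -> \bar R})
    (f h : T -> R) : P.-integrable setT (EFin \o f) -> measurable_fun setT h -> (forall w, 0 <= f w) ->
  (\int[P]_w (f w * cos (h w))) ^+ 2 + (\int[P]_w (f w * sin (h w))) ^+ 2 <= (\int[P]_w f w) ^+ 2.
Proof.
move=> fi mh f0.
have mf : measurable_fun setT f by exact/measurable_EFinP/(measurable_int P).
have im (g : R -> R) : continuous g -> (forall x, `|g x| <= 1) ->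
    P.-integrable setT (EFin \o (fun w => f w * g (h w))).
  move=> cg g1; apply: (integrable_dominated (C := 1)) fi _ _ => //.
    apply: measurable_funM => //; apply: (measurableT_comp (f := g)) => //.
    exact: continuous_measurable_fun.
  by move=> w _; rewrite mul1r normrM (ger0_norm (f0 w)) ler_piMr.
have ic := im _ (@continuous_cos R) (@cos_max R).
have i_s := im _ (@continuous_sin R) (@sin_max R).
set p := \int[P]_w (f w * cos (h w)); set q := \int[P]_w (f w * sin (h w)); set F := \int[P]_w f w.
have F0 : 0 <= F by rewrite Rintegral_ge0.
have pq0 : 0 <= p ^+ 2 + q ^+ 2 by rewrite addr_ge0 ?sqr_ge0.
pose rho := Num.sqrt (p ^+ 2 + q ^+ 2).
have rho2 : rho ^+ 2 = p ^+ 2 + q ^+ 2 by rewrite sqr_sqrtr.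
have rho0 : 0 <= rho by exact: sqrtr_ge0.
have ptw w : p * cos (h w) + q * sin (h w) <= rho.
  rewrite (le_trans (ler_norm _))// -ler_sqr ?nnegrE// real_normK ?num_real// rho2.
  rewrite -[leRHS]mulr1 -(cos2Dsin2 (h w)) -subr_ge0.
  by rewrite [leRHS](_ : _ = (p * sin (h w) - q * cos (h w)) ^+ 2) ?sqr_ge0//; ring.
have : rho ^+ 2 <= rho * F.
  rewrite rho2 /F -RintegralZl// [leLHS](_ : _ = \int[P]_w (p * (f w * cos (h w)) + q * (f w * sin (h w)))).
    apply: le_Rintegral => //.
    - by apply: (RintegrableD measurableT); exact: (RintegrableZl measurableT).
    - exact: (RintegrableZl measurableT).
    - move=> w _; rewrite [leLHS](_ : _ = (p * cos (h w) + q * sin (h w)) * f w); last by ring.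
      by rewrite ler_wpM2r.
  rewrite RintegralD//; [|exact: (RintegrableZl measurableT)|exact: (RintegrableZl measurableT)].
  by rewrite !RintegralZl// !expr2.
rewrite -rho2; move: rho0; rewrite le_eqVlt => /predU1P[<- _|r0].
  by rewrite expr0n sqr_ge0.
by rewrite expr2 ler_pM2l// => rF; rewrite -expr2 lerXn2r ?nnegrE// ltW.
Qed.

(** * The nonlattice bound for the shot noise *)

Section shot_noise_law.
Context (R : realType) (lambda r t : R).
Hypotheses (lambda_gt0 : 0 < lambda) (r_gt0 : 0 < r) (t_gt0 : 0 < t).
Context (d0 : measure_display) (T0 : measurableType d0) (P0 : probability T0 R).
Variables (lawB : probability R R) (N : {RV P0 >-> nat}) (B U : nat -> {RV P0 >-> R}).
Hypothesis inputs : shot_noise_inputs lambda t_gt0 lawB N B U.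
Local Notation Xs := (shot_noise r N B U).
Local Notation leb := (@lebesgue_measure R).

(** The number of summands is random; on each event N = k the storage is a fixed finite sum. *)
Lemma measurable_shot_noise : measurable_fun setT Xs.
Proof.
have mN : measurable_fun setT N by exact: measurable_funP.
move=> _ A mA; rewrite setTI.
pose S k w := \sum_(j < k) B j w * expR (- (r * U j w)).
have -> : Xs @^-1` A = \bigcup_k (N @^-1` [set k] `&` S k @^-1` A).
  by apply/seteqP; split => [w h|w [k _ [/= <-]]]//; exists (N w).
have mS k : measurable_fun setT (S k).
  apply: measurable_sum => j; apply: measurable_funM; first exact: measurable_funP.
  apply: (measurableT_comp (f := expR)) => //; apply: measurableT_comp => //.
  by apply: measurable_funM => //; exact: measurable_funP.
apply: bigcup_measurable => k _; apply: measurableI.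
  by rewrite -[X in measurable X]setTI; exact: mN.
by rewrite -[X in measurable X]setTI; exact: mS.
Qed.

Let mpre (V : {RV P0 >-> R}) A : measurable A -> measurable (V @^-1` A).
Proof. by move=> mA; exact: measurable_funPTI. Qed.

Let mpreN (A : set nat) : measurable (N @^-1` A).
Proof. exact: measurable_funPTI. Qed.

Lemma inputs_indep3 (C : set nat) (A D : set R) : measurable A -> measurable D ->
  P0 (N @^-1` C `&` B 0 @^-1` A `&` U 0 @^-1` D) =
  (P0 (N @^-1` C) * (P0 (B 0 @^-1` A) * P0 (U 0 @^-1` D)))%E.
Proof.
move=> mA mD; pose E (k : unit + (nat + nat)) := match k with
  | inl _ => N @^-1` C | inr (inl _) => B 0 @^-1` A | inr (inr _) => U 0 @^-1` D end.
pose J : {fset unit + (nat + nat)} := (inl tt |` (inr (inl 0) |` [fset inr (inr 0)]))%fset.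
have := sni_indep inputs (J := J) (E := E).
rewrite /J !big_fsetU1 ?inE//= big_seq_fset1/= => <-; last first.
  move=> i; rewrite !inE => /orP[/eqP ->|/orP[/eqP ->|/eqP ->]] /=.
  - by exists C => //; rewrite setTI.
  - by exists A => //; rewrite setTI.
  - by exists D => //; rewrite setTI.
congr (P0 _); apply/seteqP; split => [w [[h1 h2] h3] i /=|w h].
  by rewrite !inE => /orP[/eqP ->|/orP[/eqP ->|/eqP ->]].
split; first split.
- by apply: (h (inl tt)); rewrite /= !inE eqxx.
- by apply: (h (inr (inl 0))); rewrite /= !inE eqxx.
- by apply: (h (inr (inr 0))); rewrite /= !inE eqxx.
Qed.

(* Off the event N = 1 the value -1 lies outside every half-line of positive
   reals, so that the events B_0 >= b0, N = 1 are events about W alone. *)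
Let W w : R := if N w == 1%N then B 0 w else -1.

Let W_preimage A : W @^-1` A = (N @^-1` [set 1%N] `&` B 0 @^-1` A) `|`
  N @^-1` [set k | k != 1%N /\ A (-1)].
Proof.
apply/seteqP; split => w; rewrite /W/=.
  by case: ifPn => [/eqP e|e] h; [left|right].
by move=> [[-> h]|[/negbTE -> h]].
Qed.

Let mW : measurable_fun setT W.
Proof.
move=> _ A mA; rewrite setTI W_preimage.
by apply: measurableU => //; apply: measurableI => //; exact: mpre.
Qed.

Let WRV : {RV P0 >-> R} := HB.pack W (isMeasurableFun.Build _ _ _ _ W mW).

Let W_indep (A D : set R) : measurable A -> measurable D ->
  P0 (WRV @^-1` A `&` U 0 @^-1` D) = (P0 (WRV @^-1` A) * P0 (U 0 @^-1` D))%E.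
Proof.
move=> mA mD; rewrite (_ : WRV @^-1` A = W @^-1` A)// W_preimage setIUl.
have dis : (N @^-1` [set 1%N] `&` B 0 @^-1` A) `&` N @^-1` [set k | k != 1%N /\ A (-1)] = set0.
  by apply/seteqP; split => w // -[[/= -> _] []]; rewrite eqxx.
have mAB : measurable (N @^-1` [set 1%N] `&` B 0 @^-1` A).
  by apply: measurableI => //; exact: mpre.
have -> : P0 (N @^-1` [set 1%N] `&` B 0 @^-1` A `&` U 0 @^-1` D `|`
    N @^-1` [set k | k != 1%N /\ A (-1)%R] `&` U 0 @^-1` D) =
    (P0 (N @^-1` [set 1%N] `&` B 0 @^-1` A `&` U 0 @^-1` D) +
     P0 (N @^-1` [set k | k != 1%N /\ A (-1)%R] `&` U 0 @^-1` D))%E.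
  apply: measureU; [apply: measurableI => //; exact: mpre|apply: measurableI => //; exact: mpre|].
  by rewrite setIACA dis set0I.
have -> : P0 (N @^-1` [set 1%N] `&` B 0 @^-1` A `|` N @^-1` [set k | k != 1%N /\ A (-1)%R]) =
    (P0 (N @^-1` [set 1%N] `&` B 0 @^-1` A) + P0 (N @^-1` [set k | k != 1%N /\ A (-1)%R]))%E.
  exact: measureU.
rewrite inputs_indep3//.
have PT : P0 (B 0 @^-1` setT) = 1%E by rewrite preimage_setT probability_setT.
have := inputs_indep3 [set k | k != 1%N /\ A (-1)] measurableT mD.
rewrite PT mul1e preimage_setT setIT => ->.
have := inputs_indep3 [set 1%N] mA measurableT.
rewrite !preimage_setT setIT probability_setT mule1 => ->.
by rewrite ge0_muleDl ?mule_ge0 ?measure_ge0// muleA.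
Qed.

Let poisson_gt0 k : (0 < P0 (N @^-1` [set k]))%E.
Proof.
have -> : P0 (N @^-1` [set k]) = poisson_prob (lambda * t) 0 [set k] by exact: (sni_N inputs).
have lt0 : 0 < lambda * t by rewrite mulr_gt0.
rewrite /poisson_prob lt0 esum_set1 ?lee_fin ?poisson_pmf_ge0//.
by rewrite lte_fin /poisson_pmf lt0 !mulr_gt0 ?exprn_gt0 ?expR_gt0// invr_gt0 ltr0n fact_gt0.
Qed.

Let law_U : forall A, measurable A -> distribution P0 (U 0) A = uniform_prob t_gt0 A.
Proof. by move=> A mA; exact: (sni_U inputs). Qed.

(* The uniform law lives on a copy of R with another display, hence the
   detour through the identity map. *)
Let integral_uniform_law (f : R -> \bar R) : measurable_fun setT f -> (forall x, 0 <= f x)%E ->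
  (\int[distribution P0 (U 0)]_y f y = (t - 0)^-1%:E * \int[leb]_(y in `[0%R, t]) f y)%E.
Proof.
move=> mf f0; pose i : measurableTypeR R -> R := id.
have mi : measurable_fun setT i by move=> _ A mA; rewrite setTI.
pose pi : {mfun measurableTypeR R >-> R} := HB.pack i (isMeasurableFun.Build _ _ _ _ i mi).
rewrite -(@integral_uniform _ _ _ t_gt0 f mf f0).
transitivity (\int[pushforward (uniform_prob t_gt0) pi]_y f y)%E.
  apply: eq_measure_integral => A mA _; exact: law_U.
by rewrite ge0_integral_pushforward.
Qed.

(** E is the event of exactly one job, of size at least b0. There the storage is B_0 e^{-r U_0}, and
    averaging over U_0, of density 1 / t, gives the bound of [decay_oscillation] uniformly in B_0.
    Nonnegativity of the storage on E is recorded because it keeps the tilt, with theta >= 0, above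
    its value at 0. *)
Lemma shot_noise_oscillation b0 : 0 < b0 -> (0 < P0 (B 0 @^-1` `[b0, +oo[))%E ->
  exists E, [/\ measurable E, forall w, E w -> 0 <= Xs w &
    exists2 k, 0 < k & forall xi,
      ((k * (xi ^+ 2 / (1 + xi ^+ 2)))%:E <= \int[P0]_(w in E) (1 - cos (xi * Xs w))%:E)%E].
Proof.
move=> b00 PB; pose E := N @^-1` [set 1%N] `&` B 0 @^-1` `[b0, +oo[.
have mE : measurable E by apply: measurableI => //; exact: mpre.
have XsE w : E w -> Xs w = B 0 w * expR (- (r * U 0 w)).
  by move=> [/= N1 _]; rewrite /shot_noise N1 big_ord_recl big_ord0 addr0.
have [k k0 hk] := decay_oscillation r_gt0 t_gt0 b00.
have PE : P0 E = (P0 (N @^-1` [set 1%N]) * P0 (B 0 @^-1` `[b0, +oo[))%E.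
  have := inputs_indep3 [set 1%N] (measurable_itv `[b0, +oo[) measurableT.
  by rewrite !preimage_setT setIT probability_setT mule1.
have PE0 : (0 < P0 E)%E by rewrite PE mule_gt0.
have PEf : 0 < fine (P0 E) by rewrite fine_gt0// PE0/= ltey_eq fin_num_measure.
exists E; split => //.
  move=> w Ew; rewrite XsE// mulr_ge0 ?expR_ge0//.
  by case: Ew => _ /=; rewrite in_itv/= andbT; apply: le_trans; exact: ltW.
exists (fine (P0 E) * (t^-1 * k)); first by rewrite !mulr_gt0// invr_gt0.
move=> xi; set p := xi ^+ 2 / _.
have p0 : 0 <= p by rewrite divr_ge0 ?sqr_ge0// addr_ge0 ?sqr_ge0.
have tkp : 0 <= t^-1 * k * p by rewrite mulr_ge0// mulr_ge0 ?invr_ge0 ?(ltW t_gt0) ?(ltW k0).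
pose f (z : R * R) : \bar R := (\1_`[b0, +oo[ z.1 * (1 - cos (xi * (z.1 * expR (- (r * z.2))))))%:E.
have f0 z : (0 <= f z)%E.
  by rewrite lee_fin mulr_ge0 ?indicE// subr_ge0 cos_le1.
have m1 : measurable_fun setT (\1_`[b0, +oo[ : R -> R) by exact: measurable_indic.
have mf : measurable_fun setT f.
  apply/measurable_EFinP; apply: measurable_funM.
    exact: (measurableT_comp m1 measurable_fst).
  apply: measurable_funB => //; apply: (measurableT_comp (f := cos)).
    by apply: continuous_measurable_fun; exact: continuous_cos.
  apply: measurable_funM => //; apply: measurable_funM; first exact: measurable_fst.
  apply: (measurableT_comp (f := expR)) => //; apply: measurableT_comp => //.
  by apply: measurable_funM => //; exact: measurable_snd.
have -> : (\int[P0]_(w in E) (1 - cos (xi * Xs w))%:E = \int[P0]_w f (WRV w, U 0 w))%E.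
  rewrite [LHS]integral_mkcond; apply: eq_integral => w _; rewrite patchE /f/= /W indicE.
  case: ifPn; rewrite ?inE ?notin_setE.
    move=> Ew; rewrite XsE//; case: Ew => /= -> h; rewrite eqxx.
    by rewrite mem_set// mul1r.
  move=> nE; case: ifPn => [/eqP N1|_].
    by rewrite memNset ?mul0r// => h; apply: nE; split.
  rewrite memNset ?mul0r//= in_itv/= andbT => h.
  by move: (lt_le_trans b00 h); rewrite ltNge lerN10.
rewrite -(ge0_integral_indep W_indep mf f0) fubini_tonelli1// /fubini_F.
have inner x : ((\1_`[b0, +oo[ x * (t^-1 * k * p))%:E <= \int[distribution P0 (U 0)]_y f (x, y))%E.
  rewrite indicE; have [hx|hx] := boolP (x \in `[b0, +oo[%classic); last first.
    by rewrite mul0r; apply: integral_ge0.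
  rewrite mul1r.
  have mfx : measurable_fun setT (fun y : R => f (x, y)).
    by apply: (measurableT_comp mf); exact: measurable_pair1.
  rewrite (integral_uniform_law mfx)//.
  rewrite subr0 -mulrA EFinM lee_pmul2l ?lte_fin ?invr_gt0//.
  apply: (le_trans (hk xi x _)); first by move: hx; rewrite inE/= in_itv/= andbT.
  rewrite /f/= indicE hx; under [leRHS]eq_integral do rewrite mul1r.
  exact: lexx.
apply: (@le_trans _ _ (\int[distribution P0 WRV]_x (\1_`[b0, +oo[ x * (t^-1 * k * p))%:E)%E); last first.
  apply: ge0_le_integral => //.
  - by move=> x _; rewrite lee_fin mulr_ge0 ?indicE.
  - by apply/measurable_EFinP; exact: measurable_funM.
  - exact: measurable_fun_fubini_tonelli_F.
under eq_integral do rewrite EFinM.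
rewrite ge0_integralZr//.
- rewrite integral_indic// setIT.
  rewrite [X in (_ <= X * _)%E](_ : _ = P0 E).
    by rewrite -[P0 E]fineK ?fin_num_measure// -EFinM lee_fin !mulrA.
  congr (P0 _); apply/seteqP; split => w; rewrite /=/W.
    by case: ifPn => [/eqP N1 h|_]; [split|rewrite in_itv/= andbT => /(lt_le_trans b00); rewrite ltNge lerN10].
  by move=> [/= -> h]; rewrite eqxx.
- exact/measurable_EFinP.
Qed.

Lemma shot_noise_degenerate : (forall b0, 0 < b0 -> P0 (B 0 @^-1` `[b0, +oo[) = 0%E) ->
  {ae P0, forall w, Xs w = 0}.
Proof.
move=> B0; have lawBE j A : measurable A -> P0 (B j @^-1` A) = lawB A by exact: (sni_B inputs).
have m0 : measurable [set x : R | x < 0].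
  have -> : [set x : R | x < 0] = `]-oo, 0[%classic by apply/seteqP; split => x /=; rewrite in_itv.
  exact: measurable_itv.
(* Negative values are excluded by [sni_B_ge0]; positive ones are covered by the half-lines starting
   at 1 / (n + 1), which are null for every job because all jobs have the law of [B 0]. *)
have negl j : P0.-negligible (B j @^-1` [set x | x != 0]).
  apply: (@negligibleS _ _ _ _ (B j @^-1` [set x | x < 0] `|`
     \bigcup_n (B j @^-1` `[n.+1%:R^-1, +oo[))).
    move=> w /=; have [Bw _|Bw _|//] := ltgtP (B j w) 0; [by left|right].
    have [n _ hn] := near_infty_natSinv_lt (PosNum Bw).
    by exists n => //=; rewrite in_itv/= andbT ltW//; exact: (hn n (leqnn n)).
  apply: negligibleU.
    apply/negligibleP; first exact: mpre.
    exact: (etrans (lawBE j _ m0) (sni_B_ge0 inputs)).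
  apply: negligible_bigcup => n; apply/negligibleP; first exact: mpre.
  have mi := measurable_itv `[(n.+1%:R^-1 : R), +oo[.
  by apply: (etrans (lawBE j _ mi)); rewrite -(lawBE 0)// B0// invr_gt0.
apply: (@negligibleS _ _ _ _ (\bigcup_j (B j @^-1` [set x | x != 0]))).
  move=> w /=; apply: contra_notP => h.
  rewrite /shot_noise big1// => j _; rewrite (_ : B j w = 0) ?mul0r//.
  by apply/eqP/negPn/negP => Bj; apply: h; exists (j : nat).
exact: negligible_bigcup.
Qed.

(** With m0 the tilted mass of the event that no job arrives, |phi - m0| <= 1 - m0 expands to
    |phi|^2 <= 1 - 2 m0 (1 - Re phi). Only the real part then needs a lower bound on 1 - Re phi, and
    that integral of a nonnegative function may be restricted to the single-job event. Centring at a
    merely rotates phi. *)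
Lemma shot_noise_nonlattice (a theta Lam b0 : R) (w1 := fun x => expR (theta * (x - a)) / Lam) :
  0 <= theta -> 0 < Lam ->
  P0.-integrable setT (EFin \o (w1 \o Xs)) -> \int[P0]_w w1 (Xs w) = 1 ->
  0 < b0 -> (0 < P0 (B 0 @^-1` `[b0, +oo[))%E ->
  exists2 kappa, 0 < kappa & forall xi,
    (\int[P0]_w (w1 (Xs w) * cos (xi * (Xs w - a)))) ^+ 2 +
    (\int[P0]_w (w1 (Xs w) * sin (xi * (Xs w - a)))) ^+ 2 <= 1 - kappa * (xi ^+ 2 / (1 + xi ^+ 2)).
Proof.
move=> th0 L0 iw Ew b00 PB.
have [E [mE XE [k k0 hk]]] := shot_noise_oscillation b00 PB.
have mX := measurable_shot_noise.
pose A0 := N @^-1` [set 0%N].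
have mA0 : measurable A0 by exact: mpreN.
have XA0 w : A0 w -> Xs w = 0 by move=> /= N0; rewrite /shot_noise N0 big_ord0.
pose c0 := expR (- (theta * a)) / Lam.
have c00 : 0 < c0 by rewrite divr_gt0 ?expR_gt0.
have PA : 0 < fine (P0 A0).
  by rewrite fine_gt0// poisson_gt0/= ltey_eq fin_num_measure.
pose m0 := c0 * fine (P0 A0).
have m00 : 0 < m0 by rewrite mulr_gt0.
have w10 w : 0 <= w1 (Xs w) by rewrite divr_ge0 ?expR_ge0 ?(ltW L0).
have w1A0 w : A0 w -> w1 (Xs w) = c0 by move=> /XA0 ->; rewrite /w1 sub0r mulrN.
have w1E w : E w -> c0 <= w1 (Xs w).
  move=> /XE h; rewrite ler_wpM2r ?invr_ge0 ?(ltW L0)// ler_expR mulrBr lerDr.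
  exact: mulr_ge0.
have mw : measurable_fun setT (w1 \o Xs) by exact/measurable_EFinP/(measurable_int P0).
have im (g : R -> R) : continuous g -> (forall x, `|g x| <= 1) ->
    P0.-integrable setT (EFin \o (fun w => w1 (Xs w) * g (Xs w))).
  move=> cg g1; apply: (integrable_dominated (C := 1)) iw _ _ => //.
    apply: measurable_funM => //; apply: (measurableT_comp (f := g)) => //.
    exact: continuous_measurable_fun.
  by move=> w _; rewrite mul1r normrM (ger0_norm (w10 w)) ler_piMr.
(* 2 m0 is the factor left by the atom, and c0 k bounds 1 - Re phi from below: c0, the tilt density
   at storage 0, is also a lower bound for it on E. *)
exists (2 * m0 * (c0 * k)); first by apply: mulr_gt0; exact: mulr_gt0.
move=> xi; set p := xi ^+ 2 / _.
have ic := im _ (continuous_cosM (xi := xi)) (fun x => cos_max _).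
have i_s := im _ (continuous_sinM (xi := xi)) (fun x => sin_max _).
set C0 := \int[P0]_w (w1 (Xs w) * cos (xi * Xs w)) in ic.
set S0 := \int[P0]_w (w1 (Xs w) * sin (xi * Xs w)) in i_s.
have -> : \int[P0]_w (w1 (Xs w) * cos (xi * (Xs w - a))) = cos (xi * a) * C0 + sin (xi * a) * S0.
  rewrite -!RintegralZl// -RintegralD//; [|exact: (RintegrableZl measurableT)|exact: (RintegrableZl measurableT)].
  by apply: eq_Rintegral => w _; rewrite mulrBr cosB; ring.
have -> : \int[P0]_w (w1 (Xs w) * sin (xi * (Xs w - a))) = cos (xi * a) * S0 - sin (xi * a) * C0.
  rewrite -!RintegralZl// -RintegralB//; [|exact: (RintegrableZl measurableT)|exact: (RintegrableZl measurableT)].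
  by apply: eq_Rintegral => w _; rewrite mulrBr sinB; ring.
rewrite [leLHS](_ : _ = (cos (xi * a) ^+ 2 + sin (xi * a) ^+ 2) * (C0 ^+ 2 + S0 ^+ 2)); last by ring.
rewrite cos2Dsin2 mul1r.
have i1A : P0.-integrable setT (EFin \o (\1_A0 : T0 -> R)) by exact: integrable_indic.
have iA : P0.-integrable setT (EFin \o (fun w => c0 * \1_A0 w)) by exact: (RintegrableZl measurableT).
have EA : \int[P0]_w (c0 * \1_A0 w) = m0.
  by rewrite RintegralZl// /Rintegral integral_indic// setIT.
(* Splitting off the atom at 0 from phi leaves a positive measure of mass
   1 - m0, hence |phi - m0| <= 1 - m0. *)
pose v w := w1 (Xs w) - c0 * \1_A0 w.
have v0 w : 0 <= v w.
  rewrite /v indicE; have [/set_mem h|_] := boolP (w \in A0); last by rewrite mulr0 subr0.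
  by rewrite w1A0// mulr1 subrr.
have iv : P0.-integrable setT (EFin \o v) by exact: (RintegrableB measurableT iw iA).
have Ev : \int[P0]_w v w = 1 - m0 by rewrite (RintegralB measurableT iw iA) EA Ew.
have mxi : measurable_fun setT (fun w => xi * Xs w) by exact: measurable_funM.
have := cos_sin_integral_le iv mxi v0; rewrite Ev.
have -> : \int[P0]_w (v w * cos (xi * Xs w)) = C0 - m0.
  rewrite -EA -RintegralB//; apply: eq_Rintegral => w _; rewrite /v mulrBl; congr (_ - _).
  rewrite indicE; have [/set_mem/XA0 ->|_] := boolP (w \in A0); last by rewrite mulr0 mul0r.
  by rewrite mulr0 cos0 mulr1.
have -> : \int[P0]_w (v w * sin (xi * Xs w)) = S0.
  apply: eq_Rintegral => w _; rewrite /v mulrBl indicE.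
  have [/set_mem/XA0 ->|_] := boolP (w \in A0); last by rewrite mulr0 mul0r subr0.
  by rewrite mulr0 sin0 !mulr0 subrr.
have D0 : c0 * k * p <= 1 - C0.
  have i1c : P0.-integrable setT (EFin \o (fun w => w1 (Xs w) * (1 - cos (xi * Xs w)))).
    apply: eq_integrable (RintegrableB measurableT iw ic) => // w _.
    by rewrite /= mulrBr mulr1.
  have -> : 1 - C0 = \int[P0]_w (w1 (Xs w) * (1 - cos (xi * Xs w))).
    by rewrite -[X in X - _]Ew /C0 -RintegralB//; apply: eq_Rintegral => w _; rewrite mulrBr mulr1.
  rewrite -lee_fin /Rintegral fineK; last exact: integrable_fin_num.
  have m1c : measurable_fun setT (fun w => 1 - cos (xi * Xs w)).
    apply: measurable_funB => //; apply: (measurableT_comp (f := cos)) => //.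
    by apply: continuous_measurable_fun; exact: continuous_cos.
  apply: (@le_trans _ _ (\int[P0]_(w in E) (c0 * (1 - cos (xi * Xs w)))%:E)%E).
    under eq_integral do rewrite EFinM.
    rewrite ge0_integralZl//.
    - by rewrite -mulrA EFinM; apply: lee_wpmul2l; [rewrite lee_fin ltW|exact: hk].
    - by apply/measurable_EFinP/measurable_funTS.
    - by rewrite lee_fin ltW.
  apply: (@le_trans _ _ (\int[P0]_(w in E) (w1 (Xs w) * (1 - cos (xi * Xs w)))%:E)%E).
    apply: ge0_le_integral => //.
    - by move=> w _; rewrite lee_fin mulr_ge0 ?(ltW c00)// subr_ge0 cos_le1.
    - by apply/measurable_EFinP/measurable_funTS/measurable_funM.
    - by apply/measurable_EFinP/measurable_funTS/measurable_funM.
    - by move=> w Ew'; rewrite lee_fin ler_wpM2r ?w1E// subr_ge0 cos_le1.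
  apply: ge0_subset_integral => //.
  - by apply/measurable_EFinP/measurable_funM.
  - by move=> w _; rewrite lee_fin mulr_ge0// subr_ge0 cos_le1.
move: D0; rewrite -(ler_pM2l m00); set u := m0 * _; set z := m0 * _ => D0 h.
have -> : 2 * m0 * (c0 * k) * p = 2 * u by rewrite /u; ring.
move: D0 h; rewrite /z; nra.
Qed.

End shot_noise_law.

(** * Importance sampling *)

Import HBNNSimple.

Lemma ge0_integral_density d (T : measurableType d) (R : realType)
    (m1 m2 : {measure set T -> \bar R}) (D : T -> R) (f : T -> \bar R) :
  measurable_fun setT D -> (forall x, 0 <= D x) ->
  (forall A, measurable A -> m2 A = (\int[m1]_(x in A) (D x)%:E)%E) ->
  measurable_fun setT f -> (forall x, 0 <= f x)%E ->
  (\int[m2]_x f x = \int[m1]_x (f x * (D x)%:E))%E.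
Proof.
move=> mD D0 m2E mf f0.
have nnsfunE (g : {nnsfun T >-> R}) : (\int[m2]_x (g x)%:E = \int[m1]_x ((g x)%:E * (D x)%:E))%E.
  under [LHS]eq_integral do rewrite fimfunE -fsumEFin//.
  rewrite [LHS]ge0_integral_fsum//; last 2 first.
    - by move=> r; exact/measurable_EFinP/measurableT_comp.
    - by move=> n x _; rewrite EFinM nnfun_muleindic_ge0.
  under [RHS]eq_integral.
    move=> x xD; rewrite fimfunE -fsumEFin// ge0_mule_fsuml; last first.
      by move=> r; rewrite EFinM nnfun_muleindic_ge0.
    over.
  rewrite [RHS]ge0_integral_fsum//; last 2 first.
    - move=> r; apply: emeasurable_funM; last exact/measurable_EFinP.
      exact/measurable_EFinP/measurableT_comp.
    - by move=> n x _; apply: mule_ge0; rewrite ?lee_fin// -lee_fin EFinM nnfun_muleindic_ge0.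
  apply: eq_fsbigr => r _.
  rewrite integralZl_indic_nnsfun//= integral_indic// setIT m2E//.
  have [r0|r0] := leP 0 r; last first.
    rewrite preimage_nnfun0// integral_set0 mule0; apply/esym/integral0_eq => x _.
    by rewrite indicE in_set0 mulr0 mul0e.
  rewrite [in LHS]integral_mkcond -ge0_integralZl//.
  - apply: eq_integral => x _; rewrite patchE indicE.
    by case: ifPn => _; rewrite ?mulr1 ?mulr0 ?mule0 ?mul0e.
  - by apply/(measurable_restrictT _ _).1 => //; apply/measurable_EFinP/measurable_funTS.
  - by move=> x _; rewrite patchE; case: ifPn => _; rewrite ?lee_fin.
pose f_ := nnsfun_approx measurableT mf.
transitivity (lim (\int[m2]_x (f_ n x)%:E @[n --> \oo])%E).
  rewrite -monotone_convergence//=.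
  - apply: eq_integral => ? /[!inE] xD; apply/esym/cvg_lim => //=.
    exact: cvg_nnsfun_approx.
  - by move=> n; exact/measurable_EFinP/measurable_funTS.
  - by move=> n ? _; rewrite lee_fin.
  - by move=> ? _ ? ? mn; rewrite lee_fin; exact/lefP/nd_nnsfun_approx.
rewrite (_ : (fun n => _) = (fun n => \int[m1]_x ((f_ n x)%:E * (D x)%:E))%E); last first.
  by apply/funext => n; exact: nnsfunE.
rewrite -monotone_convergence//=.
- apply: eq_integral => x _; apply/cvg_lim => //=.
  by apply: cvgeMr => //; exact: cvg_nnsfun_approx.
- by move=> n; apply: emeasurable_funM; exact/measurable_EFinP.
- by move=> n x _; rewrite mule_ge0 ?lee_fin.
- move=> x _ m n mn; rewrite lee_wpmul2r ?lee_fin//; exact/lefP/nd_nnsfun_approx.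
Qed.

(** * Change of measure and the variance of the estimator *)

Section importance_sampling.
Context (R : realType) d (T : measurableType d) (P Q : probability T R) (M : R -> \bar R).
Variables (theta a : R) (X : nat -> {RV P >-> R}) (n : nat).
Hypothesis theta_gt0 : 0 < theta.
Hypothesis twist : exponential_twist P Q M theta X n.

Local Notation L := (likelihood_ratio M theta X n).
Local Notation A := (overflow X a n).

Let l (y : R) := expR (- (theta * y)) * expR (n%:R * logM M theta).

Let ml : measurable_fun setT l.
Proof.
apply: measurable_funM => //; apply: (measurableT_comp (f := expR)) => //.
by apply: measurableT_comp => //; exact: measurable_funM.
Qed.

Let l0 y : 0 <= l y. Proof. by rewrite mulr_ge0 ?expR_ge0. Qed.

Let mY := measurable_total_storage X n.
Let Y : {mfun T >-> R} := HB.pack (total_storage X n)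
  (isMeasurableFun.Build _ _ _ _ (total_storage X n) mY).

Let preimage_total_storage C : measurable C ->
  g_sigma_preimage (fun i : 'I_n => X i) (total_storage X n @^-1` C).
Proof.
move=> mC.
pose T' := g_sigma_algebraType (\big[setU/set0]_(i < n) preimage_set_system setT (X i) measurable).
have mX' (i : 'I_n) : measurable_fun setT (X i : T' -> R).
  move=> _ B mB; apply: sub_sigma_algebra.
  by rewrite (bigD1 i)//=; left; exists B.
have mY' : measurable_fun setT (total_storage X n : T' -> R).
  by apply: measurable_sum => i; exact: mX'.
by have := mY' measurableT C mC; rewrite setTI.
Qed.

(** [et_density] concerns only the events generated by the first n variables. Passing to the laws of
    Y_n on the real line turns it into a density [l] valid on all Borel sets, since every event
    about Y_n is of that kind. *)
Lemma twist_integral (g : R -> R) : measurable_fun setT g -> (forall y, 0 <= g y) ->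
  (\int[P]_w (g (total_storage X n w))%:E =
   \int[Q]_w (g (total_storage X n w) * L w)%:E)%E.
Proof.
move=> mg g0.
transitivity (\int[pushforward P Y]_y (g y)%:E)%E.
  rewrite ge0_integral_pushforward//.
    exact/measurable_EFinP.
  by move=> y _; rewrite lee_fin.
have dens C : measurable C -> pushforward P Y C = (\int[pushforward Q Y]_(y in C) (l y)%:E)%E.
  move=> mC; rewrite ge0_integral_pushforward//.
  - exact: (et_density twist (preimage_total_storage mC)).
  - exact/measurable_EFinP/measurable_funTS.
  - by move=> y _; rewrite lee_fin.
rewrite (ge0_integral_density ml l0 dens)//; last exact/measurable_EFinP.
rewrite ge0_integral_pushforward//.
- by apply/measurable_EFinP/measurable_funM.
- by move=> y _; rewrite -EFinM lee_fin mulr_ge0.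
Qed.

Let indic_overflow w : \1_A w = \1_`[n%:R * a, +oo[ (total_storage X n w) :> R.
Proof. by rewrite !indicE !mem_setE /= in_itv/= andbT. Qed.

Let mI : measurable_fun setT (\1_`[n%:R * a, +oo[ : R -> R).
Proof. exact: measurable_indic. Qed.

Let B := l (n%:R * a).

Let Z_bound w : `|L w * \1_A w| <= B.
Proof.
have L0 : 0 <= L w by exact: l0.
rewrite ger0_norm ?mulr_ge0// indicE; have [/set_mem h|_] := boolP (w \in A); last by rewrite mulr0 l0.
by rewrite mulr1 ler_wpM2r ?expR_ge0// ler_expR lerN2 ler_wpM2l// ltW.
Qed.

Let mL : measurable_fun setT L.
Proof. exact: (measurableT_comp ml mY). Qed.

Let mA : measurable A.
Proof.
have -> : A = total_storage X n @^-1` `[n%:R * a, +oo[.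
  by apply/seteqP; split => w; rewrite /= in_itv/= andbT.
by rewrite -[X in measurable X]setTI; exact: mY.
Qed.

Let mZ : measurable_fun setT (fun w => L w * \1_A w).
Proof. by apply: measurable_funM => //; exact: measurable_indic. Qed.

Lemma twist_variance : fine (variance Q (fun w => L w * \1_A w)) =
  \int[P]_w (L w * \1_A w) - fine (P A) ^+ 2.
Proof.
pose Z w := L w * \1_A w.
have iZ : Q.-integrable setT (EFin \o Z).
  have i1 : Q.-integrable setT (EFin \o cst (1 : R)) by exact: finite_measure_integrable_cst.
  apply: (integrable_dominated (C := B)) i1 _ _ => //.
  by move=> w _; rewrite mulr1; exact: Z_bound.
have iZ2 : Q.-integrable setT (EFin \o (fun w => Z w * Z w)).
  apply: (integrable_dominated (C := B)) iZ _ _ => //; first exact: measurable_funM.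
  move=> w _; have Z0 : 0 <= Z w by rewrite mulr_ge0 ?indicE//; exact: l0.
  rewrite ger0_norm ?mulr_ge0// ler_wpM2r//.
  by apply: le_trans (Z_bound w); exact: ler_norm.
have EZ : \int[Q]_w Z w = fine (P A).
  have I0 y : 0 <= \1_`[n%:R * a, +oo[ y :> R by rewrite indicE.
  rewrite /Rintegral; congr fine.
  transitivity (\int[P]_w (\1_`[n%:R * a, +oo[ (total_storage X n w))%:E)%E.
    by rewrite (twist_integral mI I0); apply: eq_integral => w _; rewrite -indic_overflow mulrC.
  transitivity (\int[P]_w (\1_A w)%:E)%E; last by rewrite integral_indic// setIT.
  by apply: eq_integral => w _; rewrite -indic_overflow.
have EZ2 : \int[Q]_w (Z w * Z w) = \int[P]_w (L w * \1_A w).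
  have mIl : measurable_fun setT (fun y => \1_`[n%:R * a, +oo[ y * l y) by exact: measurable_funM.
  have Il0 y : 0 <= \1_`[n%:R * a, +oo[ y * l y by rewrite mulr_ge0// indicE.
  rewrite /Rintegral; congr fine.
  transitivity (\int[P]_w (\1_`[n%:R * a, +oo[ (total_storage X n w) * l (total_storage X n w))%:E)%E; last first.
    by apply: eq_integral => w _; rewrite -indic_overflow mulrC.
  rewrite (twist_integral mIl Il0); apply: eq_integral => w _.
  rewrite /Z -indic_overflow indicE; case: (w \in A); rewrite ?mulr1 ?mulr0 ?mul0r//.
  by rewrite mul1r.
rewrite /variance !unlock -/(Rintegral _ _ _).
set c := fine _.
have cE : c = fine (P A) by exact: EZ.
have -> : \int[Q]_w ((Z \- cst c) * (Z \- cst c)) w = \int[Q]_w (Z w * Z w - (2 * c * Z w - c ^+ 2)).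
  apply: eq_Rintegral => w _; change ((Z w - c) * (Z w - c) = Z w * Z w - (2 * c * Z w - c ^+ 2)).
  by ring.
have i1 : Q.-integrable setT (EFin \o cst (c ^+ 2)) by exact: finite_measure_integrable_cst.
have icZ := RintegrableZl measurableT (2 * c) iZ.
rewrite (RintegralB measurableT iZ2 (RintegrableB measurableT icZ i1)).
rewrite (RintegralB measurableT icZ i1) RintegralZl// EZ2 EZ -cE.
rewrite [X in _ - (_ - X)](_ : _ = c ^+ 2); first by ring.
have QT : fine (Q setT) = 1 by rewrite probability_setT.
by rewrite (Rintegral_cst Q measurableT) ?QT ?mulr1 ?probability_setT ?ltry.
Qed.

End importance_sampling.

(** The exponential factors c n cancel in the ratio, leaving h2 / h1^2 - 1. The first term is of
    order sqrt n with coefficient ((2 theta)^{-1} / s) / (theta^{-1} / s)^2 = theta s / 2, and the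
    -1 is negligible against it. *)
Lemma relative_variance_asymptotics (R : realType) (theta s C : R) (c h1 h2 : nat -> R) :
  0 < theta -> 0 < s -> 0 < C -> (forall n, 0 < c n) ->
  Num.sqrt n.+1%:R * h1 n @[n --> \oo] --> theta^-1 / s ->
  Num.sqrt n.+1%:R * h2 n @[n --> \oo] --> (2 * theta)^-1 / s ->
  C * ((c n ^+ 2 * h2 n - (c n * h1 n) ^+ 2) / (c n * h1 n) ^+ 2) /
    (C * theta * 2^-1 * s * Num.sqrt n.+1%:R) @[n --> \oo] --> (1 : R).
Proof.
move=> t0 s0 C0 c0 cv1 cv2.
have l1 : 0 < theta^-1 / s by rewrite divr_gt0// invr_gt0.
have cvi := @cvg_inv_sqrt R.
have cv : ((Num.sqrt n.+1%:R * h2 n) * ((Num.sqrt n.+1%:R * h1 n) ^+ 2)^-1 - (Num.sqrt n.+1%:R)^-1)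
    * (theta * 2^-1 * s)^-1 @[n --> \oo] --> (1 : R).
  have e : (1 : R) = ((2 * theta)^-1 / s * ((theta^-1 / s) ^+ 2)^-1 - 0) * (theta * 2^-1 * s)^-1.
    by field; rewrite !lt0r_neq0.
  rewrite [X in _ --> X]e; apply: cvgMl; apply: cvgB => //.
  apply: cvgM => //; apply: cvgV; first by rewrite lt0r_neq0// exprn_gt0.
  by under eq_fun do rewrite expr2; rewrite expr2; apply: cvgM.
apply: cvg_trans cv; apply: near_eq_cvg.
near=> n.
have h : 0 < Num.sqrt n.+1%:R * h1 n by near: n; exact: (cvgr_gt _ cv1 _ l1).
have h10 : h1 n != 0 by apply/eqP => h0; move: h; rewrite h0 mulr0 ltxx.
have q0 : Num.sqrt n.+1%:R != 0 :> R by rewrite lt0r_neq0// sqrtr_gt0.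
have cn := lt0r_neq0 (c0 n).
by field; rewrite q0 h10 cn !lt0r_neq0.
Unshelve. all: by end_near. Qed.

Theorem proposition1 (R : realType) (lambda r t : R)
    (lambda_gt0 : 0 < lambda) (r_gt0 : 0 < r) (t_gt0 : 0 < t)
    (* the storage level at time t *)
    (d0 : measure_display) (T0 : measurableType d0) (P0 : probability T0 R)
    (lawB : probability R R)
    (N : {RV P0 >-> nat}) (B U : nat -> {RV P0 >-> R})
    (inputs : shot_noise_inputs lambda t_gt0 lawB N B U)
    (M : R -> \bar R)
    (ME : M = mmt_gen_fun P0 (shot_noise r N B U))
    (M_fin : \forall v \near (0 : R), (M v < +oo)%E)
    (* i.i.d. copies of it *)
    (d : measure_display) (T : measurableType d) (P : probability T R)
    (X : nat -> {RV P >-> R})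
    (X_law : forall i, same_law (distribution P (X i))
                         (pushforward P0 (shot_noise r N B U)))
    (X_indep : mutually_independent P (fun i : nat => sigma_rv (X i)))
    (* the rare event and the twist *)
    (a : R) (a_gt_mean : ('E_P0[shot_noise r N B U] < a%:E)%E)
    (theta : R) (theta_gt0 : 0 < theta)
    (theta_argsup : is_argsup M a theta)
    (theta_int : (interior [set v : R | (M v < +oo)%E]) theta)
    (tau : R) (tauE : tau = derive1n 2 (logM M) theta)
    (Q : nat -> probability T R)
    (Q_twist : forall n, exponential_twist P (Q n) M theta X n)
    (* the simulation parameters *)
    (Tc eps : R) (Tc_gt0 : 0 < Tc) (eps_gt0 : 0 < eps)
    (alpha : R)
    (alphaE : alpha = Tc ^+ 2 / eps ^+ 2 * theta * 2^-1 *
                      Num.sqrt (2 * pi * tau)) :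
  number_of_runs P (Q n) M theta X a Tc eps n / (alpha * Num.sqrt n%:R)
    @[n --> \oo] --> (1 : R).
Proof.
pose Xs := shot_noise r N B U.
have mXs : measurable_fun setT Xs by exact: measurable_shot_noise.
pose V : {RV P0 >-> R} := HB.pack Xs (isMeasurableFun.Build _ _ _ _ Xs mXs).
(* Otherwise X(t) = 0 almost surely, M is constantly 1 and, as 0 < a, the
   supremum of theta a - log M(theta) is not attained. *)
have [b0 b00 PB] : exists2 b0 : R, 0 < b0 & (0 < P0 (B 0%N @^-1` `[b0, +oo[))%E.
  apply: contrapT => nB.
  have Xs0 : {ae P0, forall w, Xs w = 0}.
    apply: (shot_noise_degenerate r inputs) => b0 b00; apply/eqP; rewrite -measure_le0 leNgt.
    by apply/negP => PB; apply: nB; exists b0.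
  have M1 v : M v = 1%E.
    rewrite ME /mmt_gen_fun unlock.
    rewrite (ae_eq_integral (cst 1%E))//.
    - by rewrite integral_cst// mul1e; exact: probability_setT.
    - apply/measurable_EFinP; apply: (measurableT_comp (f := expR)) => //.
      exact: measurable_funM.
    - move: Xs0; apply: filterS => w h _; have : Xs w * v = 0 by rewrite h mul0r.
      by rewrite /= /Xs => ->; rewrite expR0.
  have a0 : 0 < a.
    move: a_gt_mean; rewrite unlock (ae_eq_integral (cst 0%E))//.
    - by rewrite integral0 lte_fin.
    - exact/measurable_EFinP.
    - by move: Xs0; apply: filterS => w h _; exact: (congr1 EFin h).
  have := theta_argsup (theta + 1); rewrite !M1 lne1 !sube0 lee_fin.
  by rewrite ler_pM2r// gerDl leNgt ltr01.
have [] := @twisted_moments _ _ _ P0 V M a theta ME theta_argsup theta_int.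
set Lam := centered_moment _ _ _ _; pose w1 (x : R) := expR (theta * (x - a)) / Lam.
move=> L0 ML iV [E0 E1 E2].
have iw : P0.-integrable setT (EFin \o (w1 \o Xs)).
  by apply: eq_integrable (iV 0%N isT) => // w _; rewrite /= expr0 mulr1.
have [kappa k0 hk] := shot_noise_nonlattice lambda_gt0 r_gt0 inputs (ltW theta_gt0) L0 iw E0 b00 PB.
have law0 : same_law (distribution P (X 0)) (distribution P0 V) by exact: X_law.
have lawX i A : measurable A -> distribution P (X i) A = distribution P (X 0) A.
  by move=> mA; rewrite !X_law.
have mw1 : measurable_fun setT w1.
  apply: measurable_funM => //; apply: (measurableT_comp (f := expR)) => //.
  by apply: measurable_funM => //; exact: measurable_funB.
have tr (g : R -> R) (mg : measurable_fun setT g) := same_law_integral law0 mg.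
have mp j : measurable_fun setT (fun x : R => w1 x * (x - a) ^+ j).
  by apply: measurable_funM => //; apply: measurable_funX; exact: measurable_funB.
have iX j : (j <= 4)%N -> P.-integrable setT (EFin \o (fun w => w1 (X 0 w) * (X 0 w - a) ^+ j)).
  by move=> j4; exact: (tr _ (mp j) (iV j j4)).1.
have mtrig (f : R -> R) xi : continuous f -> measurable_fun setT (fun x : R => w1 x * f (xi * (x - a))).
  move=> cf; apply: measurable_funM => //; apply: (measurableT_comp (f := f)).
    exact: continuous_measurable_fun.
  by apply: measurable_funM => //; exact: measurable_funB.
have itrig (f : R -> R) xi : continuous f -> (forall x, `|f x| <= 1) ->
    P0.-integrable setT (EFin \o (fun w => w1 (Xs w) * f (xi * (Xs w - a)))).
  move=> cf f1; apply: (integrable_dominated (C := 1)) iw _ _ => //.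
    exact: (measurableT_comp (mtrig f xi cf) mXs).
  move=> w _; rewrite mul1r normrM ger0_norm ?divr_ge0 ?expR_ge0 ?(ltW L0)//.
  by rewrite ler_piMr// divr_ge0 ?expR_ge0 ?(ltW L0).
have hk' xi : (\int[P]_w (w1 (X 0 w) * cos (xi * (X 0 w - a)))) ^+ 2 +
    (\int[P]_w (w1 (X 0 w) * sin (xi * (X 0 w - a)))) ^+ 2 <= 1 - kappa * (xi ^+ 2 / (1 + xi ^+ 2)).
  rewrite (tr _ (mtrig _ xi (@continuous_cos R)) (itrig _ xi (@continuous_cos R) (@cos_max R))).2.
  rewrite (tr _ (mtrig _ xi (@continuous_sin R)) (itrig _ xi (@continuous_sin R) (@sin_max R))).2.
  exact: hk.
have i0X : P.-integrable setT (EFin \o (w1 \o X 0)) by exact: (tr _ mw1 iw).1.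
have E0X : \int[P]_w w1 (X 0 w) = 1 by rewrite (tr _ mw1 iw).2.
have E1X : \int[P]_w (w1 (X 0 w) * (X 0 w - a)) = 0.
  by rewrite (tr _ (mp 1%N) (iV 1%N isT)).2.
have E2X : \int[P]_w (w1 (X 0 w) * (X 0 w - a) ^+ 2) = tau.
  by rewrite (tr _ (mp 2) (iV 2 isT)).2 tauE.
have i3X : P.-integrable setT (EFin \o (fun w => w1 (X 0 w) * `|X 0 w - a| ^+ 3)).
  apply: eq_integrable (integrable_norm (iX 3 isT)) => // w _.
  by rewrite /= normrM normrX ger0_norm// divr_ge0 ?expR_ge0 ?(ltW L0).
have loc := tilted_local_limit X_indep lawX L0 i0X E0X (iX 1%N isT) E1X (iX 2 isT) E2X i3X (iX 4 isT) k0 hk'.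
have tau0 := tilt_variance_gt0 L0 i0X E0X (iX 2 isT) E2X k0 hk'.
pose H k n := \int[P]_w (tilt_weight X theta a Lam n w * exphalf k (centered_sum X a n w)).
have mA n : measurable (overflow X a n).
  have -> : overflow X a n = total_storage X n @^-1` `[n%:R * a, +oo[.
    by apply/seteqP; split => w; rewrite /= in_itv/= andbT.
  by rewrite -[X in measurable X]setTI; exact: measurable_total_storage.
have Ln n : Lam ^+ n != 0 by rewrite lt0r_neq0// exprn_gt0.
(* The case k = theta removes the exponential and leaves the overflow probability; k = 2 theta
   leaves e^{-theta S_n}, which is the likelihood ratio up to a constant. *)
have WE k n w : tilt_weight X theta a Lam n w * exphalf k (centered_sum X a n w) =
    (Lam ^+ n)^-1 * (\1_(overflow X a n) w * expR ((theta - k) * centered_sum X a n w)).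
  rewrite /tilt_weight /exphalf indicE.
  have -> : (w \in overflow X a n) = (0 <= centered_sum X a n w).
    by apply/idP/idP => [/set_mem|h]; [|apply/mem_set; move: h]; rewrite /overflow/= subr_ge0.
  case: ifPn => _; last by rewrite mulr0 !mul0r mulr0.
  by rewrite mul1r mulrBl expRD; ring.
have i1 n : P.-integrable setT (EFin \o (\1_(overflow X a n) : T -> R)) by exact: integrable_indic.
have mS n := measurable_centered_sum X a n.
(* On the overflow event S_n >= 0, so for k >= theta the exponential is at most 1. *)
have iH k n : theta <= k -> P.-integrable setT (EFin \o
    (fun w => \1_(overflow X a n) w * expR ((theta - k) * centered_sum X a n w))).
  move=> tk; apply: (integrable_dominated (C := 1)) (i1 n) _ _ => //.
    apply: measurable_funM; first exact: measurable_indic.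
    by apply: (measurableT_comp (f := expR)) => //; exact: measurable_funM.
  move=> w _; rewrite mul1r normrM indicE.
  have [/set_mem h|_] := boolP (w \in _); last by rewrite normr0 mul0r.
  rewrite normr1 mul1r ger0_norm ?expR_ge0// -expR0 ler_expR.
  by rewrite mulr_le0_ge0 ?subr_le0// subr_ge0.
have pE n : fine (P (overflow X a n)) = Lam ^+ n * H theta n.
  have -> : H theta n = \int[P]_w ((Lam ^+ n)^-1 * \1_(overflow X a n) w).
    by apply: eq_Rintegral => w _; rewrite WE subrr mul0r expR0 mulr1.
  by rewrite RintegralZl// mulVKf// /Rintegral integral_indic// setIT.
have qE n : \int[P]_w (likelihood_ratio M theta X n w * \1_(overflow X a n) w) =
    (Lam ^+ n) ^+ 2 * H (2 * theta) n.
  have t2 : theta <= 2 * theta by rewrite ler_pMl// ler1n.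
  have -> : H (2 * theta) n = \int[P]_w ((Lam ^+ n)^-1 *
      (\1_(overflow X a n) w * expR ((theta - 2 * theta) * centered_sum X a n w))).
    by apply: eq_Rintegral => w _; exact: WE.
  rewrite RintegralZl//; last exact: iH.
  rewrite expr2 -mulrA mulVKf// -RintegralZl//; last exact: iH.
  (* As M(theta) = e^{theta a} Lam, the factors e^{n theta a} recentre Y_n and the likelihood ratio
     becomes Lam^n e^{-theta S_n}. *)
  apply: eq_Rintegral => w _; rewrite /likelihood_ratio /logM expRM_natl.
  have M0 : 0 < fine (M theta) by rewrite ML mulr_gt0 ?expR_gt0.
  rewrite lnK ?posrE// ML exprMn -expRM_natl /centered_sum.
  rewrite [(theta - 2 * theta) * _](_ : _ = - (theta * total_storage X n w) + n%:R * (theta * a)); last by ring.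
  by rewrite expRD; ring.
(* The local limits are indexed by n + 1 summands; the shift also discards n = 0, where the quotient
   by sqrt 0 is a default value. *)
rewrite -cvg_shiftS alphaE /number_of_runs.
have C0 : 0 < Tc ^+ 2 / eps ^+ 2 by rewrite divr_gt0 ?exprn_gt0.
have s0 : 0 < Num.sqrt (2 * pi * tau) by rewrite sqrtr_gt0 !mulr_gt0// pi_gt0.
have := relative_variance_asymptotics theta_gt0 s0 C0 (fun n => exprn_gt0 n.+1 L0)
  (loc theta theta_gt0) (loc (2 * theta) _).
rewrite mulr_gt0// => /(_ isT).
apply: cvg_trans; apply: near_eq_cvg; near=> n.
by rewrite /= (twist_variance a theta_gt0 (Q_twist n.+1)) qE pE.
Unshelve. all: by end_near. Qed.
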